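(* Let $N,k$ be positive integers, $n=kN$, and let $t=\boldsymbol q^N$, $\boldsymbol r=\boldsymbol q^{1-N^2}$. Let $a\in K^\times$ be a primitive $n$-th root of unity. (1) The induced module $\overline M(k^N)=\mathrm{Ind}_{H(\mathcal Z)}^{\mathbb H_{\boldsymbol q,t}(SL_n)}\mathrm{Rect}(N,k)$ has maximal semisimple quotient $$\overline L(k^N)\oplus\overline L(k^N)^{a}\oplus\cdots\oplus\overline L(k^N)^{a^{k-1}}.$$ (2) For $n$-th roots of unity $a,b\in K^\times$, we have $\overline L(k^N)^a\cong\overline L(k^N)^b$ if and only if $a^N=b^N$. (3) These $k$ twists are, up to isomorphism, all the irreducible representations of $\mathbb H_{\boldsymbol q,t}(SL_n)$ that have the same support as $\overline L(k^N)$. Their isomorphism type is distinguished by the extra datum of the scalar by which $\pi^N$ acts on the weight vector $v_{\overline R_0}$: in $\overline L(k^N)^{a}$ (for an $n$-th root of unity $a$) one has $\pi^Nv_{\overline R_0}=a^Nv_{\overline R_0}$.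
   Context: $K$ is a field of characteristic $0$ containing primitive $n$-th roots of unity; $\boldsymbol q,t,\boldsymbol r\in K^\times$ are not roots of unity; $n\ge2$. $\mathbb H_{\boldsymbol q,t}(SL_n)$ is generated by $T_0,\dots,T_{n-1}$ (indices mod $n$), $\pi^{\pm1},Z_1^{\pm1},\dots,Z_n^{\pm1}$, the $Z_i$ commuting pairwise, with relations $(T_i-t)(T_i+t^{-1})=0$; $T_iT_jT_i=T_jT_iT_j$ if $j\equiv i\pm1$ and $T_iT_j=T_jT_i$ otherwise (both dropped if $n=2$); $\pi T_i\pi^{-1}=T_{i+1}$; $T_iZ_iT_i=Z_{i+1}$ $(1\le i\le n-1)$; $T_iZ_j=Z_jT_i$ for $j\not\equiv i,i+1$; $T_0Z_nT_0=\boldsymbol q^{2n}Z_1$; $Z_1\cdots Z_n=\boldsymbol q^{n(n-1)}\boldsymbol r^n$; $\pi^n=1$; $\pi Z_i\pi^{-1}=\boldsymbol q^{-2}Z_{i+1}$ $(1\le i\le n-1)$; $\pi Z_n\pi^{-1}=\boldsymbol q^{2n-2}Z_1$. $\mathcal Z$ is the subalgebra generated by the $Z_i^{\pm1}$, and $H(\mathcal Z)$ the subalgebra generated by $T_1,\dots,T_{n-1}$ and $\mathcal Z$. For $a\in K^\times$ with $a^n=1$, $M^a$ denotes the twist of a module $M$ by the automorphism $T_i\mapsto T_i$, $Z_i\mapsto Z_i$, $\pi\mapsto a\pi$. The support of $M$ is the set of $\underline z\in(K^\times)^n$ for which there is a nonzero $v\in M$ with $Z_iv=z_iv$ for all $i$.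 $\mathrm{Rect}(N,k)$ is the irreducible $H(\mathcal Z)$-module with basis $v_R$ indexed by standard Young tableaux of shape $(k^N)$ ($N$ rows of length $k$), whose restriction to the finite Hecke algebra $\langle T_1,\dots,T_{n-1}\rangle$ is the irreducible module indexed by $(k^N)$, and with $Z_iv_R=t^{2(m-j)}v_R$ if $i$ lies in row $j$ and column $m$ of $R$ (it is the inflation of the finite Hecke algebra module along $T_i\mapsto T_i$, $Z_1\mapsto1$). An $n$-periodic standard tableau is a bijective filling $R$ of the strip of boxes $(j,c)$, $1\le j\le N$, $c\in\mathbb Z$, by $\mathbb Z$, increasing along rows and down columns, such that the entry of $(j,c+k)$ is the entry of $(j,c)$ plus $n$ and the entries in columns $1,\dots,k$ are distinct mod $n$. $\overline P$ is the set of classes $\overline R$ of such $R$ modulo horizontal translations of the strip by integers. If the sum of the entries of $R$ in columns $1,\dots,k$ is $\frac{n(n+1)}2+np$ ($p\in\mathbb Z$) and $i$ lies in box $(j,c)$, put $\mathrm{diag}_{\overline R}(i)=c-j+\frac pN$ (independent of the representative). Since $t=\boldsymbol q^N$, $t^{b/N}$ means $\boldsymbol q^b$. $R_0$ is the periodic tableau whose entry in $(j,c)$, $1\le j\le N$, $1\le c\le k$, is $(c-1)N+j$. $\overline L(k^N)$ is the irreducible $\mathbb H_{\boldsymbol q,t}(SL_n)$-module, unique up to isomorphism, on the $K$-span of $\{v_{\overline R}:\overline R\in\overline P\}$, in which $Z_iv_{\overline R}=t^{2\mathrm{diag}_{\overline R}(i)}v_{\overline R}$ $(1\le i\le n)$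 and $\pi^Nv_{\overline R_0}=v_{\overline R_0}$. *)

(* Defs.v *)
From HB Require Import structures.
From mathcomp Require Import all_boot all_order all_algebra.
From mathcomp Require Import boolp.

Set Implicit Arguments.
Unset Strict Implicit.
Unset Printing Implicit Defensive.

Import Order.TTheory GRing.Theory Num.Theory.
Local Open Scope ring_scope.
Local Open Scope quotient_scope.

(* Algebras given by generators and relations: noncommutative polynomial      *)
(* expressions in the generators modulo the congruence generated by the ring  *)
(* axioms, the centrality of the constants and the given relations.           *)
(* The resulting algebra is only a pzRingType (it may be zero for arbitrary   *)
(* relations), hence not an algType: its K-structure is the central           *)
(* morphism palg_cst.                                                         *)

Inductive pterm (K X : Type) : Type :=
  | PGen of X
  | PCst of K
  | PAdd of pterm K X & pterm K X
  | PMul of pterm K X & pterm K X.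
Arguments PGen {K X}.
Arguments PCst {K X}.

HB.instance Definition _ (K X : Type) := gen_eqMixin (pterm K X).
HB.instance Definition _ (K X : Type) := gen_choiceMixin (pterm K X).

Section PresentedAlgebra.
Variables (K : fieldType) (X : Type) (rel : pterm K X -> pterm K X -> Prop).
Implicit Types s u v w : pterm K X.

Inductive peqv : pterm K X -> pterm K X -> Prop :=
  | peqv_refl s : peqv s s
  | peqv_sym s u : peqv s u -> peqv u s
  | peqv_trans s u v : peqv s u -> peqv u v -> peqv s v
  | peqv_add s s' u u' : peqv s s' -> peqv u u' -> peqv (PAdd s u) (PAdd s' u')
  | peqv_mul s s' u u' : peqv s s' -> peqv u u' -> peqv (PMul s u) (PMul s' u')
  | peqv_addA s u v : peqv (PAdd s (PAdd u v)) (PAdd (PAdd s u) v)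
  | peqv_addC s u : peqv (PAdd s u) (PAdd u s)
  | peqv_add0 s : peqv (PAdd (PCst 0) s) s
  | peqv_addN s : peqv (PAdd (PMul (PCst (-1)) s) s) (PCst 0)
  | peqv_mulA s u v : peqv (PMul s (PMul u v)) (PMul (PMul s u) v)
  | peqv_mul1l s : peqv (PMul (PCst 1) s) s
  | peqv_mul1r s : peqv (PMul s (PCst 1)) s
  | peqv_mulDl s u v : peqv (PMul (PAdd s u) v) (PAdd (PMul s v) (PMul u v))
  | peqv_mulDr s u v : peqv (PMul s (PAdd u v)) (PAdd (PMul s u) (PMul s v))
  | peqv_cstD c d : peqv (PCst (c + d)) (PAdd (PCst c) (PCst d))
  | peqv_cstM c d : peqv (PCst (c * d)) (PMul (PCst c) (PCst d))
  | peqv_cstC c s : peqv (PMul (PCst c) s) (PMul s (PCst c))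
  | peqv_rel s u : rel s u -> peqv s u.

Definition peqvb s u : bool := `[< peqv s u >].

Fact peqvb_refl : reflexive peqvb.
Proof. by move=> s; apply/asboolP/peqv_refl. Qed.
Fact peqvb_sym : symmetric peqvb.
Proof. by move=> s u; apply/asboolP/asboolP => /peqv_sym. Qed.
Fact peqvb_trans : transitive peqvb.
Proof. by move=> u s v /asboolP su /asboolP uv; apply/asboolP/(peqv_trans su). Qed.

Canonical peqv_equiv := EquivRel peqvb peqvb_refl peqvb_sym peqvb_trans.

Definition palg : Type := {eq_quot peqv_equiv}.
HB.instance Definition _ := Choice.on palg.

Definition palg_pi (s : pterm K X) : palg := \pi_({eq_quot peqv_equiv}) s.
Definition palg_repr (x : palg) : pterm K X := repr (x : {eq_quot peqv_equiv}).

Lemma palg_eq s u : palg_pi s = palg_pi u <-> peqv s u.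
Proof.
split=> [/eqP|su]; first by rewrite /palg_pi eqmodE => /asboolP.
by apply/eqP; rewrite /palg_pi eqmodE; apply/asboolP.
Qed.

Lemma palg_reprK x : palg_pi (palg_repr x) = x.
Proof. exact: reprK. Qed.

Lemma palg_repr_eqv s : peqv (palg_repr (palg_pi s)) s.
Proof. by apply/palg_eq; rewrite palg_reprK. Qed.

Lemma palg_ind (P : palg -> Prop) : (forall s, P (palg_pi s)) -> forall x, P x.
Proof. by move=> Ps x; rewrite -(palg_reprK x). Qed.

Definition padd x y := palg_pi (PAdd (palg_repr x) (palg_repr y)).
Definition pmul x y := palg_pi (PMul (palg_repr x) (palg_repr y)).
Definition popp x := palg_pi (PMul (PCst (-1)) (palg_repr x)).

Lemma pi_add s u : padd (palg_pi s) (palg_pi u) = palg_pi (PAdd s u).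
Proof. by apply/palg_eq/peqv_add; apply: palg_repr_eqv. Qed.
Lemma pi_mul s u : pmul (palg_pi s) (palg_pi u) = palg_pi (PMul s u).
Proof. by apply/palg_eq/peqv_mul; apply: palg_repr_eqv. Qed.
Lemma pi_opp s : popp (palg_pi s) = palg_pi (PMul (PCst (-1)) s).
Proof. by apply/palg_eq/peqv_mul; [apply: peqv_refl | apply: palg_repr_eqv]. Qed.

Fact paddA : associative padd.
Proof.
elim/palg_ind=> s; elim/palg_ind=> u; elim/palg_ind=> v.
by rewrite !pi_add; apply/palg_eq/peqv_addA.
Qed.
Fact paddC : commutative padd.
Proof.
by elim/palg_ind=> s; elim/palg_ind=> u; rewrite !pi_add; apply/palg_eq/peqv_addC.
Qed.
Fact padd0 : left_id (palg_pi (PCst 0)) padd.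
Proof. by elim/palg_ind=> s; rewrite pi_add; apply/palg_eq/peqv_add0. Qed.
Fact paddN : left_inverse (palg_pi (PCst 0)) popp padd.
Proof. by elim/palg_ind=> s; rewrite pi_opp pi_add; apply/palg_eq/peqv_addN. Qed.
Fact pmulA : associative pmul.
Proof.
elim/palg_ind=> s; elim/palg_ind=> u; elim/palg_ind=> v.
by rewrite !pi_mul; apply/palg_eq/peqv_mulA.
Qed.
Fact pmul1l : left_id (palg_pi (PCst 1)) pmul.
Proof. by elim/palg_ind=> s; rewrite pi_mul; apply/palg_eq/peqv_mul1l. Qed.
Fact pmul1r : right_id (palg_pi (PCst 1)) pmul.
Proof. by elim/palg_ind=> s; rewrite pi_mul; apply/palg_eq/peqv_mul1r. Qed.
Fact pmulDl : left_distributive pmul padd.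
Proof.
elim/palg_ind=> s; elim/palg_ind=> u; elim/palg_ind=> v.
by rewrite !(pi_add, pi_mul); apply/palg_eq/peqv_mulDl.
Qed.
Fact pmulDr : right_distributive pmul padd.
Proof.
elim/palg_ind=> s; elim/palg_ind=> u; elim/palg_ind=> v.
by rewrite !(pi_add, pi_mul); apply/palg_eq/peqv_mulDr.
Qed.

HB.instance Definition _ := GRing.isZmodule.Build palg paddA paddC padd0 paddN.
HB.instance Definition _ :=
  GRing.Zmodule_isPzRing.Build palg pmulA pmul1l pmul1r pmulDl pmulDr.

Definition palg_gen (x : X) : palg := palg_pi (PGen x).
Definition palg_cst (c : K) : palg := palg_pi (PCst c).

Lemma palg_piD s u : palg_pi (PAdd s u) = palg_pi s + palg_pi u.
Proof. exact/esym/pi_add. Qed.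
Lemma palg_piM s u : palg_pi (PMul s u) = palg_pi s * palg_pi u.
Proof. exact/esym/pi_mul. Qed.

Fact palg_cst_is_zmod_morphism : zmod_morphism palg_cst.
Proof.
move=> c d; apply: (addIr (palg_cst d)); rewrite subrK /palg_cst -palg_piD.
by have := peqv_cstD (c - d) d; rewrite subrK => /peqv_sym cd; apply/palg_eq.
Qed.
Fact palg_cst_is_monoid_morphism : monoid_morphism palg_cst.
Proof. by split=> // c d; rewrite /palg_cst -palg_piM; apply/palg_eq/peqv_cstM. Qed.

HB.instance Definition _ :=
  GRing.isZmodMorphism.Build K palg palg_cst palg_cst_is_zmod_morphism.
HB.instance Definition _ :=
  GRing.isMonoidMorphism.Build K palg palg_cst palg_cst_is_monoid_morphism.

Lemma palg_cstC c x : palg_cst c * x = x * palg_cst c.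
Proof. by elim/palg_ind: x => s; rewrite -!palg_piM; apply/palg_eq/peqv_cstC. Qed.

Section Endomorphism.
Variable f : X -> palg.

Fixpoint peval s : palg :=
  match s with
  | PGen x => f x
  | PCst c => palg_cst c
  | PAdd u v => peval u + peval v
  | PMul u v => peval u * peval v
  end.

Hypothesis f_rel : forall s u, rel s u -> peval s = peval u.

Lemma peval_eqv s u : peqv s u -> peval s = peval u.
Proof.
elim=> //=.
- by move=> s1 u1 v1 _ -> _ ->.
- by move=> s1 s2 u1 u2 _ -> _ ->.
- by move=> s1 s2 u1 u2 _ -> _ ->.
- by move=> *; rewrite addrA.
- by move=> *; rewrite addrC.
- by move=> s1; rewrite rmorph0 add0r.
- by move=> s1; rewrite rmorphN1 mulN1r addNr rmorph0.
- by move=> *; rewrite mulrA.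
- by move=> s1; rewrite rmorph1 mul1r.
- by move=> s1; rewrite rmorph1 mulr1.
- by move=> *; rewrite mulrDl.
- by move=> *; rewrite mulrDr.
- by move=> *; rewrite rmorphD.
- by move=> *; rewrite rmorphM.
- by move=> c s1; rewrite palg_cstC.
Qed.

(* The K-algebra endomorphism sending each generator x to f x. *)
Definition palg_end of (forall s u, rel s u -> peval s = peval u) :=
  fun x : palg => peval (palg_repr x).

Lemma palg_end_pi s : palg_end f_rel (palg_pi s) = peval s.
Proof. exact/peval_eqv/palg_repr_eqv. Qed.

Fact palg_end_is_zmod_morphism : zmod_morphism (palg_end f_rel).
Proof.
move=> x y; elim/palg_ind: x => s; elim/palg_ind: y => u.
rewrite -mulN1r -(rmorphN1 palg_cst) -palg_piM -palg_piD !palg_end_pi /=.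
by rewrite rmorphN1 mulN1r.
Qed.
Fact palg_end_is_monoid_morphism : monoid_morphism (palg_end f_rel).
Proof.
split=> [|x y]; first by rewrite -(rmorph1 palg_cst) palg_end_pi.
by elim/palg_ind: x => s; elim/palg_ind: y => u; rewrite -palg_piM !palg_end_pi.
Qed.

HB.instance Definition _ :=
  GRing.isZmodMorphism.Build palg palg (palg_end f_rel) palg_end_is_zmod_morphism.
HB.instance Definition _ :=
  GRing.isMonoidMorphism.Build palg palg (palg_end f_rel) palg_end_is_monoid_morphism.
End Endomorphism.
End PresentedAlgebra.

Section Subalgebra.
Variables (K : fieldType) (A : pzRingType) (cst : {rmorphism K -> A}).
Variable S : A -> Prop.

Inductive in_subalg : A -> Prop :=
  | subalg_gen x : S x -> in_subalg x
  | subalg_const c : in_subalg (cst c)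
  | subalg_sub x y : in_subalg x -> in_subalg y -> in_subalg (x - y)
  | subalg_mul x y : in_subalg x -> in_subalg y -> in_subalg (x * y).

Definition subalg_pred : {pred A} := [pred x | `[< in_subalg x >]].

Fact subalg_closed : subring_closed subalg_pred.
Proof.
split=> [|x y|x y]; rewrite !inE.
- by rewrite -(rmorph1 cst); apply/asboolP/subalg_const.
- by move=> /asboolP Sx /asboolP Sy; apply/asboolP/subalg_sub.
- by move=> /asboolP Sx /asboolP Sy; apply/asboolP/subalg_mul.
Qed.
HB.instance Definition _ := GRing.isSubringClosed.Build A subalg_pred subalg_closed.

Definition subalg : Type := {x : A | x \in subalg_pred}.
HB.instance Definition _ := SubChoice.on subalg.
HB.instance Definition _ :=
  GRing.SubChoice_isSubPzRing.Build A subalg_pred subalg subalg_closed.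

Fact subalg_cstP c : cst c \in subalg_pred.
Proof. by apply/asboolP/subalg_const. Qed.
Definition subalg_cst (c : K) : subalg := exist _ (cst c) (subalg_cstP c).
End Subalgebra.

Section Modules.
Variable A : pzRingType.
Implicit Types V W Q : lmodType A.

Definition stable_under (S : A -> Prop) V (U : V -> Prop) : Prop :=
  [/\ U 0, forall u v, U u -> U v -> U (u - v)
    & forall a u, S a -> U u -> U (a *: u)].

Definition irreducible_under (S : A -> Prop) V : Prop :=
  (exists v : V, v <> 0) /\
  forall U : V -> Prop, stable_under S U ->
    (forall u, U u -> u = 0) \/ (forall u, U u).

Definition submodule V (U : V -> Prop) : Prop := stable_under (fun=> True) U.
Definition irreducible V : Prop := irreducible_under (fun=> True) V.

Definition simple_submodule V (U : V -> Prop) : Prop :=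
  [/\ submodule U, exists2 u, U u & u <> 0
    & forall W : V -> Prop, submodule W -> (forall u, W u -> U u) ->
        (forall u, W u -> u = 0) \/ (forall u, U u -> W u)].

(* V is the sum of its simple submodules. *)
Definition semisimple V : Prop :=
  forall v : V, exists2 s : seq V, v = \sum_(x <- s) x &
    forall x, x \in s -> exists2 U : V -> Prop, simple_submodule U & U x.

Definition mod_iso V W : Prop := exists f : {linear V -> W}, bijective f.

Definition surj (T T' : Type) (f : T -> T') : Prop := forall y, exists x, f x = y.

Definition max_semisimple_quotient V Q : Prop :=
  exists p : {linear V -> Q}, [/\ surj p, semisimple Q
    & forall (Q' : lmodType A) (p' : {linear V -> Q'}),
        surj p' -> semisimple Q' -> exists g : {linear Q -> Q'}, p' =1 g \o p].

Section Basis.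
Variables (K : fieldType) (cst : K -> A) (V : lmodType A).

Definition is_basis (I : eqType) (v : I -> V) : Prop :=
  (forall (s : seq I) (c : I -> K), uniq s ->
     \sum_(i <- s) cst (c i) *: v i = 0 -> forall i, i \in s -> c i = 0) /\
  (forall x : V, exists (s : seq I) (c : I -> K), x = \sum_(i <- s) cst (c i) *: v i).
End Basis.
End Modules.

Definition twist (A : pzRingType) (phi : {rmorphism A -> A}) (V : lmodType A) : Type := V.

Section Twist.
Variables (A : pzRingType) (phi : {rmorphism A -> A}) (V : lmodType A).

HB.instance Definition _ := GRing.Zmodule.on (twist phi V).

Definition twist_scale (a : A) (v : twist phi V) : twist phi V := phi a *: (v : V).

Fact twist_scaleA a b v : twist_scale a (twist_scale b v) = twist_scale (a * b) v.
Proof. by rewrite /twist_scale scalerA rmorphM. Qed.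
Fact twist_scale1 : left_id 1 twist_scale.
Proof. by move=> v; rewrite /twist_scale rmorph1 scale1r. Qed.
Fact twist_scaleDr : right_distributive twist_scale +%R.
Proof. by move=> a u v; rewrite /twist_scale scalerDr. Qed.
Fact twist_scaleDl v : {morph twist_scale^~ v : a b / a + b}.
Proof. by move=> a b; rewrite /twist_scale rmorphD scalerDl. Qed.

HB.instance Definition _ := GRing.Zmodule_isLmodule.Build A (twist phi V)
  twist_scaleA twist_scale1 twist_scaleDr twist_scaleDl.

Definition to_twist (v : V) : twist phi V := v.
End Twist.

(* Direct sum of a finite family of modules. *)
Definition dsum (A : pzRingType) (I : finType) (V : I -> lmodType A) : Type :=
  forall i, V i.

Section DirectSum.
Variables (A : pzRingType) (I : finType) (V : I -> lmodType A).

HB.instance Definition _ := gen_eqMixin (dsum V).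
HB.instance Definition _ := gen_choiceMixin (dsum V).

Definition dsum_add (u v : dsum V) : dsum V := fun i => u i + v i.
Definition dsum_zero : dsum V := fun i => 0.
Definition dsum_opp (u : dsum V) : dsum V := fun i => - u i.
Definition dsum_scale (a : A) (u : dsum V) : dsum V := fun i => a *: u i.

Fact dsum_addA : associative dsum_add.
Proof. by move=> u v w; apply: functional_extensionality_dep => i; apply: addrA. Qed.
Fact dsum_addC : commutative dsum_add.
Proof. by move=> u v; apply: functional_extensionality_dep => i; apply: addrC. Qed.
Fact dsum_add0 : left_id dsum_zero dsum_add.
Proof. by move=> u; apply: functional_extensionality_dep => i; apply: add0r. Qed.
Fact dsum_addN : left_inverse dsum_zero dsum_opp dsum_add.
Proof. by move=> u; apply: functional_extensionality_dep => i; apply: addNr. Qed.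
HB.instance Definition _ :=
  GRing.isZmodule.Build (dsum V) dsum_addA dsum_addC dsum_add0 dsum_addN.

Fact dsum_scaleA a b v : dsum_scale a (dsum_scale b v) = dsum_scale (a * b) v.
Proof. by apply: functional_extensionality_dep => i; apply: scalerA. Qed.
Fact dsum_scale1 : left_id 1 dsum_scale.
Proof. by move=> v; apply: functional_extensionality_dep => i; apply: scale1r. Qed.
Fact dsum_scaleDr : right_distributive dsum_scale +%R.
Proof. by move=> a u v; apply: functional_extensionality_dep => i; apply: scalerDr. Qed.
Fact dsum_scaleDl v : {morph dsum_scale^~ v : a b / a + b}.
Proof. by move=> a b; apply: functional_extensionality_dep => i; apply: scalerDl. Qed.
HB.instance Definition _ := GRing.Zmodule_isLmodule.Build A (dsum V)
  dsum_scaleA dsum_scale1 dsum_scaleDr dsum_scaleDl.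
End DirectSum.

(* The induced module A (x)_B V along a ring morphism iota : B -> A:          *)
(* formal sums of tensors modulo the usual biadditivity and balancing rules.  *)

Inductive tterm (A V : Type) : Type :=
  | TPure of A & V
  | TAdd of tterm A V & tterm A V.

HB.instance Definition _ (A V : Type) := gen_eqMixin (tterm A V).
HB.instance Definition _ (A V : Type) := gen_choiceMixin (tterm A V).

Section Induction.
Variables (A B : pzRingType) (iota : {rmorphism B -> A}) (V : lmodType B).
Local Notation tm := (tterm A V).
Implicit Types (s u w : tm).

Inductive teqv : tm -> tm -> Prop :=
  | teqv_refl s : teqv s s
  | teqv_sym s u : teqv s u -> teqv u s
  | teqv_trans s u w : teqv s u -> teqv u w -> teqv s w
  | teqv_add s s' u u' : teqv s s' -> teqv u u' -> teqv (TAdd s u) (TAdd s' u')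
  | teqv_addA s u w : teqv (TAdd s (TAdd u w)) (TAdd (TAdd s u) w)
  | teqv_addC s u : teqv (TAdd s u) (TAdd u s)
  | teqv_add0 v s : teqv (TAdd (TPure 0 v) s) s
  | teqv_pureDl a a' v : teqv (TPure (a + a') v) (TAdd (TPure a v) (TPure a' v))
  | teqv_pureDr a v v' : teqv (TPure a (v + v')) (TAdd (TPure a v) (TPure a v'))
  | teqv_bal a b v : teqv (TPure (a * iota b) v) (TPure a (b *: v)).

Definition teqvb s u : bool := `[< teqv s u >].

Fact teqvb_refl : reflexive teqvb.
Proof. by move=> s; apply/asboolP/teqv_refl. Qed.
Fact teqvb_sym : symmetric teqvb.
Proof. by move=> s u; apply/asboolP/asboolP => /teqv_sym. Qed.
Fact teqvb_trans : transitive teqvb.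
Proof. by move=> u s w /asboolP su /asboolP uw; apply/asboolP/(teqv_trans su). Qed.

Canonical teqv_equiv := EquivRel teqvb teqvb_refl teqvb_sym teqvb_trans.

Definition induced : Type := {eq_quot teqv_equiv}.
HB.instance Definition _ := Choice.on induced.

Definition ind_pi (s : tm) : induced := \pi_({eq_quot teqv_equiv}) s.
Definition ind_repr (x : induced) : tm := repr (x : {eq_quot teqv_equiv}).

Lemma ind_eq s u : ind_pi s = ind_pi u <-> teqv s u.
Proof.
split=> [/eqP|su]; first by rewrite /ind_pi eqmodE => /asboolP.
by apply/eqP; rewrite /ind_pi eqmodE; apply/asboolP.
Qed.

Lemma ind_reprK x : ind_pi (ind_repr x) = x.
Proof. exact: reprK. Qed.

Lemma ind_repr_eqv s : teqv (ind_repr (ind_pi s)) s.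
Proof. by apply/ind_eq; rewrite ind_reprK. Qed.

Lemma induced_ind (P : induced -> Prop) : (forall s, P (ind_pi s)) -> forall x, P x.
Proof. by move=> Ps x; rewrite -(ind_reprK x). Qed.

Fixpoint tscale (a : A) s : tm :=
  match s with
  | TPure b v => TPure (a * b) v
  | TAdd u w => TAdd (tscale a u) (tscale a w)
  end.

Lemma tscale_eqv a s u : teqv s u -> teqv (tscale a s) (tscale a u).
Proof.
elim=> //=.
- by move=> s1; apply: teqv_refl.
- by move=> s1 u1 _; apply: teqv_sym.
- by move=> s1 u1 w1 _ h1 _; apply: teqv_trans.
- by move=> s1 s2 u1 u2 _ h1 _ h2; apply: teqv_add.
- by move=> *; apply: teqv_addA.
- by move=> *; apply: teqv_addC.
- by move=> v s1; rewrite mulr0; apply: teqv_add0.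
- by move=> b b' v; rewrite mulrDr; apply: teqv_pureDl.
- by move=> *; apply: teqv_pureDr.
- by move=> b c v; rewrite mulrA; apply: teqv_bal.
Qed.

Definition ind_add x y := ind_pi (TAdd (ind_repr x) (ind_repr y)).
Definition ind_zero := ind_pi (TPure 0 0).
Definition ind_scale a x := ind_pi (tscale a (ind_repr x)).
Definition ind_opp x := ind_scale (-1) x.

Lemma pi_ind_add s u : ind_add (ind_pi s) (ind_pi u) = ind_pi (TAdd s u).
Proof. by apply/ind_eq/teqv_add; apply: ind_repr_eqv. Qed.
Lemma pi_ind_scale a s : ind_scale a (ind_pi s) = ind_pi (tscale a s).
Proof. exact/ind_eq/tscale_eqv/ind_repr_eqv. Qed.

Fact ind_addA : associative ind_add.
Proof.
elim/induced_ind=> s; elim/induced_ind=> u; elim/induced_ind=> w.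
by rewrite !pi_ind_add; apply/ind_eq/teqv_addA.
Qed.
Fact ind_addC : commutative ind_add.
Proof.
elim/induced_ind=> s; elim/induced_ind=> u.
by rewrite !pi_ind_add; apply/ind_eq/teqv_addC.
Qed.
Fact ind_add0 : left_id ind_zero ind_add.
Proof. by elim/induced_ind=> s; rewrite pi_ind_add; apply/ind_eq/teqv_add0. Qed.

Fact ind_scaleDl x : {morph ind_scale^~ x : a b / a + b >-> ind_add a b}.
Proof.
move=> a b; elim/induced_ind: x => s; rewrite !pi_ind_scale pi_ind_add; apply/ind_eq.
elim: s => [c v|s hs u hu] /=; first by rewrite mulrDl; apply: teqv_pureDl.
move: hs hu => /ind_eq; rewrite -pi_ind_add => hs /ind_eq; rewrite -pi_ind_add => hu.
apply/ind_eq; rewrite -!pi_ind_add hs hu -!ind_addA; congr ind_add.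
by rewrite ind_addC -ind_addA; congr ind_add; rewrite ind_addC.
Qed.

Fact ind_scale1 x : ind_scale 1 x = x.
Proof.
elim/induced_ind: x => s; rewrite pi_ind_scale; congr ind_pi.
by elim: s => [c v|s hs u hu] /=; rewrite ?mul1r ?hs ?hu.
Qed.

Fact ind_scale0 x : ind_scale 0 x = ind_zero.
Proof.
have pure0 v : ind_pi (TPure 0 v) = ind_zero.
  by rewrite -[LHS]ind_add0 ind_addC pi_ind_add; apply/ind_eq/teqv_add0.
elim/induced_ind: x => s; rewrite pi_ind_scale.
elim: s => [c v|s hs u hu] /=; first by rewrite mul0r pure0.
by rewrite -pi_ind_add hs hu ind_add0.
Qed.

Fact ind_addN : left_inverse ind_zero ind_opp ind_add.
Proof.
by move=> x; rewrite -{2}(ind_scale1 x) /ind_opp -ind_scaleDl addNr ind_scale0.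
Qed.

HB.instance Definition _ :=
  GRing.isZmodule.Build induced ind_addA ind_addC ind_add0 ind_addN.

Fact ind_scaleA a b x : ind_scale a (ind_scale b x) = ind_scale (a * b) x.
Proof.
elim/induced_ind: x => s; rewrite !pi_ind_scale; congr ind_pi.
by elim: s => [c v|s hs u hu] /=; rewrite ?mulrA ?hs ?hu.
Qed.
Fact ind_scaleDr : right_distributive ind_scale +%R.
Proof.
have addE x y : x + y = ind_add x y by [].
move=> a; elim/induced_ind=> s; elim/induced_ind=> u.
by rewrite !addE pi_ind_add !pi_ind_scale pi_ind_add.
Qed.

HB.instance Definition _ := GRing.Zmodule_isLmodule.Build A induced
  ind_scaleA ind_scale1 ind_scaleDr ind_scaleDl.

Definition tensor (a : A) (v : V) : induced := ind_pi (TPure a v).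
End Induction.

Record nroot (K : fieldType) (n : nat) := NRoot {
  nroot_val :> K;
  nroot_neq0 : nroot_val != 0;
  nrootP : nroot_val ^+ n = 1 }.

Section NrootExp.
Variables (K : fieldType) (n : nat) (a : nroot K n) (j : nat).
Fact nroot_exp_neq0 : nroot_val a ^+ j != 0.
Proof. exact/expf_neq0/nroot_neq0. Qed.
Fact nroot_expP : (nroot_val a ^+ j) ^+ n = 1.
Proof. by rewrite exprAC nrootP expr1n. Qed.
Definition nroot_exp : nroot K n := NRoot nroot_exp_neq0 nroot_expP.
End NrootExp.

(* The generators T_i and Z_i are indexed by residues modulo n, so that Z_n   *)
(* is DZ of the residue 0 and ordS is the cyclic successor i |-> i + 1; DpiV  *)
(* and DZV are the inverses.                                                  *)
Variant daha_gen (n : nat) : Type :=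
  DT of 'I_n | Dpi | DpiV | DZ of 'I_n | DZV of 'I_n.
Arguments Dpi {n}.
Arguments DpiV {n}.

(* The representative in {1, ..., n} of a residue modulo n. *)
Definition residue_rep (n : nat) (i : 'I_n) : nat := if i == 0%N :> nat then n else i.

Section DahaRelations.
Variables (K : fieldType) (n : nat) (q t r : K).
Local Notation term := (pterm K (daha_gen n)).
Local Notation T i := (PGen (DT i) : term).
Local Notation Z i := (PGen (DZ i) : term).
Local Notation ZV i := (PGen (DZV i) : term).
Local Notation pi := (PGen Dpi : term).
Local Notation piV := (PGen DpiV : term).
Local Infix "**" := (@PMul K (daha_gen n)) (at level 40, left associativity).
Local Infix "++" := (@PAdd K (daha_gen n)) (at level 60, right associativity).
Implicit Types i j : 'I_n.

Definition cyc_adj i j : bool := (j == ordS i) || (i == ordS j).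

Inductive daha_rel : term -> term -> Prop :=
  | rel_pipiV : daha_rel (pi ** piV) (PCst 1)
  | rel_piVpi : daha_rel (piV ** pi) (PCst 1)
  | rel_ZZV i : daha_rel (Z i ** ZV i) (PCst 1)
  | rel_ZVZ i : daha_rel (ZV i ** Z i) (PCst 1)
  | rel_ZZ i j : daha_rel (Z i ** Z j) (Z j ** Z i)
  | rel_quad i : daha_rel ((T i ++ PCst (- t)) ** (T i ++ PCst t^-1)) (PCst 0)
  | rel_braid i j : n <> 2 -> cyc_adj i j ->
      daha_rel (T i ** T j ** T i) (T j ** T i ** T j)
  | rel_TT i j : n <> 2 -> ~~ cyc_adj i j -> daha_rel (T i ** T j) (T j ** T i)
  | rel_piT i : daha_rel (pi ** T i ** piV) (T (ordS i))
  | rel_TZT i : i != 0%N :> nat -> daha_rel (T i ** Z i ** T i) (Z (ordS i))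
  | rel_TZ i j : j != i -> j != ordS i -> daha_rel (T i ** Z j) (Z j ** T i)
  | rel_T0Z i : i = 0%N :> nat ->
      daha_rel (T i ** Z i ** T i) (PCst (q ^+ (2 * n)) ** Z (ordS i))
  | rel_prodZ : daha_rel (\big[@PMul K (daha_gen n)/PCst 1]_(i < n) Z (ordS i))
      (PCst (q ^+ (n * (n - 1)) * r ^+ n))
  | rel_pin : daha_rel (iter n (@PMul K (daha_gen n) pi) (PCst 1)) (PCst 1)
  | rel_piZ i : i != 0%N :> nat ->
      daha_rel (pi ** Z i ** piV) (PCst (q ^- 2) ** Z (ordS i))
  | rel_piZ0 i : i = 0%N :> nat ->
      daha_rel (pi ** Z i ** piV) (PCst (q ^+ (2 * n - 2)) ** Z (ordS i)).

Definition daha : pzRingType := palg daha_rel.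
Definition daha_cst : {rmorphism K -> daha} := @palg_cst K _ daha_rel.

Definition daha_T i : daha := palg_gen daha_rel (DT i).
Definition daha_pi : daha := palg_gen daha_rel Dpi.
Definition daha_Z i : daha := palg_gen daha_rel (DZ i).
Definition daha_ZV i : daha := palg_gen daha_rel (DZV i).

Section PiTwist.
Variable a : nroot K n.

Definition pi_twist_gen (x : daha_gen n) : daha :=
  match x with
  | Dpi => daha_cst (nroot_val a) * palg_gen daha_rel Dpi
  | DpiV => daha_cst (nroot_val a)^-1 * palg_gen daha_rel DpiV
  | _ => palg_gen daha_rel x
  end.

Lemma pi_twist_genP s u : daha_rel s u ->
  peval pi_twist_gen s = peval pi_twist_gen u.
Proof.
pose g := palg_gen daha_rel.
have relE s1 u1 : daha_rel s1 u1 -> peval g s1 = peval g u1.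
  have pevalE w : peval g w = palg_pi daha_rel w.
    by elim: w => //= [w -> w' ->|w -> w' ->]; rewrite (palg_piD, palg_piM).
  by move=> su; rewrite !pevalE; apply/palg_eq/peqv_rel.
have cC c x : daha_cst c * x = x * daha_cst c by exact: palg_cstC.
have a1 : daha_cst (nroot_val a)^-1 * daha_cst (nroot_val a) = 1.
  by rewrite -rmorphM mulVf ?rmorph1 // nroot_neq0.
have conjE x y z : daha_cst (nroot_val a) * x * y * (daha_cst (nroot_val a)^-1 * z)
    = x * y * z.
  by rewrite (cC _ z) mulrA -cC -!mulrA mulrA a1 mul1r.
have bigE (h : 'I_n -> pterm K (daha_gen n)) :
    (forall i, peval pi_twist_gen (h i) = peval g (h i)) ->
    peval pi_twist_gen (\big[@PMul K (daha_gen n)/PCst 1]_(i < n) h i)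
    = peval g (\big[@PMul K (daha_gen n)/PCst 1]_(i < n) h i).
  move=> hE; elim: (index_enum _) => [|i e IHe]; first by rewrite !big_nil.
  by rewrite !big_cons /= IHe hE.
have piE m : peval pi_twist_gen (iter m (PMul (PGen Dpi)) (PCst 1))
    = daha_cst (nroot_val a ^+ m) * peval g (iter m (PMul (PGen Dpi)) (PCst 1)).
  elim: m => [|m IHm] /=; first by rewrite expr0 rmorph1 mul1r.
  by rewrite IHm exprS rmorphM -!mulrA; congr (_ * _); rewrite !mulrA cC.
move=> su; move: (su) => /relE; case: su => //=.
- by have := conjE (g Dpi) 1 (g DpiV); rewrite !mulr1 => ->.
- by rewrite (cC _ (g Dpi)) mulrA => h; rewrite -(mulrA _ (g DpiV)) h mulr1 a1.
- by move=> i; rewrite conjE.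
- by move=> ?; rewrite bigE.
- by rewrite piE nrootP rmorph1 mul1r.
- by move=> i _; rewrite conjE.
- by move=> i _; rewrite conjE.
Qed.

(* The automorphism T_i |-> T_i, Z_i |-> Z_i, pi |-> a pi. *)
Definition pi_twist : {rmorphism daha -> daha} := palg_end pi_twist_genP.
End PiTwist.

Definition gen_HfinT (x : daha) : Prop :=
  exists2 i : 'I_n, i != 0%N :> nat & x = daha_T i.

Definition gen_calZ (x : daha) : Prop :=
  exists i : 'I_n, x = daha_Z i \/ x = daha_ZV i.

Definition Hfin : daha -> Prop := in_subalg daha_cst gen_HfinT.
Definition calZ : daha -> Prop := in_subalg daha_cst gen_calZ.

Definition gen_HZ (x : daha) : Prop := gen_HfinT x \/ calZ x.
Definition HZ : pzRingType := subalg daha_cst gen_HZ.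
Definition HZ_cst (c : K) : HZ := subalg_cst daha_cst gen_HZ c.
Definition HZ_incl : {rmorphism HZ -> daha} := (\val : HZ -> daha).

Definition Ind (V : lmodType HZ) : lmodType daha := induced HZ_incl V.

Definition pitwist (a : nroot K n) (M : lmodType daha) : lmodType daha :=
  twist (pi_twist a) M.

Definition to_pitwist (a : nroot K n) (M : lmodType daha) (v : M) : pitwist a M :=
  to_twist (pi_twist a) v.

Definition weight_support (M : lmodType daha) (z : 'I_n -> K) : Prop :=
  (forall i, z i != 0) /\
  exists2 v : M, v <> 0 & forall i, daha_Z i *: v = daha_cst (z i) *: v.
End DahaRelations.

(* Standard Young tableaux of shape (k^N). A box is a pair (row, column)      *)
(* counted from 0; its entry in {1, ..., k * N} is stored as a residue.       *)
Section Tableaux.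
Variables (N k : nat).

Definition is_syt (R : {ffun 'I_N * 'I_k -> 'I_(k * N)}) : bool :=
  [&& injectiveb R, [forall i : 'I_(k * N), exists b, R b == i],
      [forall j : 'I_N, forall m : 'I_k, forall m' : 'I_k, (m < m')%N ==>
        (residue_rep (R (j, m)) < residue_rep (R (j, m')))%N]
    & [forall j : 'I_N, forall j' : 'I_N, forall m : 'I_k, (j < j')%N ==>
        (residue_rep (R (j, m)) < residue_rep (R (j', m)))%N]].

Definition syt : Type := {R : {ffun 'I_N * 'I_k -> 'I_(k * N)} | is_syt R}.
HB.instance Definition _ := Finite.on syt.

(* R j c is the entry of the box in row j + 1 (j : 'I_N) and column c : int.  *)
Definition is_ptab (R : 'I_N -> int -> int) : Prop :=
  [/\ bijective (fun b : 'I_N * int => R b.1 b.2),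
      forall j (c c' : int), c < c' -> R j c < R j c',
      forall (j j' : 'I_N) c, (j < j')%N -> R j c < R j' c,
      forall j c, R j (c + k%:Z) = R j c + (k * N)%N%:Z
    & forall j j' (c c' : int), 1 <= c <= k%:Z -> 1 <= c' <= k%:Z ->
        (R j c = R j' c' %[mod (k * N)%N])%Z -> j = j' /\ c = c'].

Record ptab := Ptab { ptab_entry :> 'I_N -> int -> int; ptabP : is_ptab ptab_entry }.

HB.instance Definition _ := gen_eqMixin ptab.
HB.instance Definition _ := gen_choiceMixin ptab.

Definition translate_of (R R' : ptab) : bool :=
  `[< exists s : int, forall j c, R' j c = R j (c + s) >].

Fact translate_refl : reflexive translate_of.
Proof. by move=> R; apply/asboolP; exists 0 => j c; rewrite addr0. Qed.
Fact translate_sym : symmetric translate_of.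
Proof.
by move=> R R'; apply/asboolP/asboolP => -[s Rs]; exists (- s) => j c; rewrite Rs subrK.
Qed.
Fact translate_trans : transitive translate_of.
Proof.
move=> R' R R'' /asboolP[s Rs] /asboolP[s' Rs']; apply/asboolP.
by exists (s' + s) => j c; rewrite Rs' Rs addrA.
Qed.
Canonical translate_equiv :=
  EquivRel translate_of translate_refl translate_sym translate_trans.

Definition Pbar : Type := {eq_quot translate_equiv}.
HB.instance Definition _ := Choice.on Pbar.
Definition ptab_class (R : ptab) : Pbar := \pi_({eq_quot translate_equiv}) R.

(* The integer p such that the entries of R in columns 1, ..., k sum to       *)
(* n (n + 1) / 2 + n p, where n = k N.                                        *)
Definition ptab_p (R : ptab) : int :=
  ((\sum_(j < N) \sum_(1 <= c < k.+1) R j c%:Z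
    - ((k * N) * (k * N).+1 %/ 2)%N%:Z) %/ (k * N)%N)%Z.

(* N * diag for the box in row j + 1 and column c: since t = q^N, the scalar  *)
(* written t^(2 diag) is q^(2 N diag).                                        *)
Definition Ndiag (R : ptab) (j : 'I_N) (c : int) : int :=
  N%:Z * (c - j.+1%:Z) + ptab_p R.

Definition R0_entry (j : 'I_N) (c : int) : int := (c - 1) * N%:Z + j.+1%:Z.

Fact R0_is_ptab : (0 < N)%N -> is_ptab R0_entry.
Proof.
move=> N_gt0; rewrite /R0_entry.
have inj (j j' : 'I_N) (x x' : int) :
    x * N%:Z + j%:Z = x' * N%:Z + j'%:Z -> j = j' /\ x = x'.
  have modE (i : 'I_N) (y : int) : ((y * N%:Z + i%:Z) %% N%:Z)%Z = i.
    by rewrite modzMDl modz_small //= ltz_nat ltn_ord.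
  move=> e; have jj' : j = j'.
    by apply/val_inj/eqP; rewrite -eqz_nat -(modE j x) e modE.
  split=> //; move: e; rewrite jj' => /addIr /mulIf; apply.
  by rewrite eqz_nat -lt0n.
have PoszS (m : nat) : m.+1%:Z = m%:Z + 1 by rewrite -addn1 PoszD.
split.
- pose f (e : int) : 'I_N * int :=
    (Ordinal (ltn_pmod `|((e - 1) %% N%:Z)%Z|%N N_gt0), ((e - 1) %/ N%:Z)%Z + 1).
  have fK : cancel f (fun b : 'I_N * int => (b.2 - 1) * N%:Z + b.1.+1%:Z).
    move=> e; rewrite /f /= addrK PoszS addrA modn_small; last first.
      by rewrite -ltz_nat gez0_abs ?modz_ge0 ?ltz_pmod // eqz_nat -lt0n.
    by rewrite gez0_abs ?modz_ge0 ?eqz_nat -?lt0n // -divz_eq subrK.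
  move: f fK => f fK; exists f => // -[j c]; move: (fK ((c - 1) * N%:Z + j.+1%:Z)) => /=.
  case: (f _) => j' c' /=; rewrite !PoszS !addrA.
  by move=> /addIr /inj[-> /addIr ->].
- by move=> j c c' cc'; rewrite ltrD2r ltr_pM2r ?ltz_nat // ltrD2r.
- by move=> j j' c jj'; rewrite ltrD2l ltz_nat ltnS.
- by move=> j c; rewrite PoszM [c + _]addrC -addrA mulrDl -addrA addrC.
- move=> j j' c c' /andP[c1 ck] /andP[c1' ck'].
  rewrite !PoszS !addrA => /eqP; rewrite eqz_modDr => /eqP.
  have small (i : 'I_N) (d : int) : 1 <= d -> d <= k%:Z ->
      (((d - 1) * N%:Z + i%:Z) %% (k * N)%N%:Z)%Z = (d - 1) * N%:Z + i%:Z.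
    move=> d1 dk; rewrite modz_small // addr_ge0 ?mulr_ge0 ?subr_ge0 //=.
    apply: (@lt_le_trans _ _ ((d - 1) * N%:Z + N%:Z)); first by rewrite ltrD2l ltz_nat.
    by rewrite -[X in _ + X]mul1r -mulrDl subrK PoszM ler_wpM2r.
  by rewrite !small // => /inj[-> /addIr].
Qed.
Definition R0 (N_gt0 : (0 < N)%N) : ptab := Ptab (R0_is_ptab N_gt0).
End Tableaux.

Section RectAndL.
Variables (K : fieldType) (N k : nat) (q t r : K).
Local Notation n := (k * N)%N.
Local Notation H := (daha n q t r).
Local Notation cst := (daha_cst n q t r).

(* The irreducible module of the finite Hecke algebra indexed by (k^N) is the *)
(* one having a nonzero vector on which the parabolic subalgebra of the row   *)
(* stabiliser acts by the trivial character T_i |-> t and a nonzero vector on *)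
(* which that of the column stabiliser acts by the sign T_i |-> - t^-1.       *)
Definition finite_Hecke_shape (V : lmodType (HZ n q t r)) : Prop :=
  [/\ irreducible_under (fun h : HZ n q t r => Hfin (\val h)) V,
      exists2 w : V, w <> 0 & forall (i : 'I_n) (h : HZ n q t r),
        ~~ (k %| i)%N -> \val h = daha_T q t r i -> h *: w = HZ_cst n q t r t *: w
    & exists2 w : V, w <> 0 & forall (i : 'I_n) (h : HZ n q t r),
        ~~ (N %| i)%N -> \val h = daha_T q t r i ->
          h *: w = HZ_cst n q t r (- t^-1) *: w].

Definition is_Rect (V : lmodType (HZ n q t r)) (v : syt N k -> V) : Prop :=
  [/\ irreducible V,
      is_basis (@HZ_cst K n q t r) v,
      finite_Hecke_shape V
    & forall (R : syt N k) (j : 'I_N) (m : 'I_k) (h : HZ n q t r),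
        \val h = daha_Z q t r (val R (j, m)) ->
        h *: v R = HZ_cst n q t r (t ^ (2 * (m%:Z - j%:Z))) *: v R].

Definition is_Lbar (N_gt0 : (0 < N)%N) (L : lmodType H) (v : Pbar N k -> L) : Prop :=
  [/\ irreducible L,
      is_basis cst v,
      forall (R : ptab N k) (i : 'I_n) (j : 'I_N) (c : int),
        R j c = (residue_rep i)%:Z ->
        daha_Z q t r i *: v (ptab_class R)
          = cst (q ^ (2 * Ndiag R j c)) *: v (ptab_class R)
    & daha_pi n q t r ^+ N *: v (ptab_class (R0 k N_gt0)) = v (ptab_class (R0 k N_gt0))].
End RectAndL.

(* Main.v *)
From HB Require Import structures.
Require Import Defs.
From mathcomp Require Import all_boot all_order all_algebra.
From mathcomp Require Import boolp zify ring.

(** Put Z_{e+n} = q^(2n) Z_e, so that all integers are indices and the relations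
    become uniform: T_i Z_e T_i = Z_{e+1} when e = i modulo n, and
    pi Z_e = q^(-2) Z_{e+1} pi. A vector has weight D when Z_e multiplies it by
    q^(2 D(e)) for all e. The vector x0 of R_0 has weight diag0, T_i acts on it by
    - t^(-1) when i and i+1 are in the same column of R_0, and pi^N fixes it. The
    first two properties define column vectors; they survive in the twist by b,
    where pi^N multiplies x0 by b^N.

    The key lemma (weight_diag0_top) says that in a module generated by a column
    vector x, the vectors of weight diag0 are spanned by the pi^(N s) x. The
    module is filtered by the length of words in the T_i. Applied to pi^m x, a
    word is a weight vector modulo shorter words, its weight being moved by the
    affine permutation of the word (word_weight). A word that can be shortened
    by the braid and quadratic relations or by the sign action on x contributes
    nothing new (exchange); when a word that cannot be shortened in this way
    takes pi^m x to the weight diag0, comparing diagonals column by column shows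
    that the word is empty and that N divides m (same_diagonals_shift). All other
    leading terms have different weights.

    Column vectors can then be compared (column_glue). Let x and y be column
    vectors with the same eigenvalue of pi^N, the second one in a simple
    submodule. In the module generated by (x, y) in the direct sum, the space of
    weight diag0 is the line of (x, y), so it does not contain (0, y). Hence the
    annihilator of x kills y, and x |-> y extends to a homomorphism. An irreducible
    module with a column vector is therefore determined by the eigenvalue of
    pi^N (column_iso), which gives (2) and the last assertion of (3).

    For (3), let M be irreducible with the support of L. It has a vector u of
    weight diag0. The intertwiner at i maps u to the weight in which i and i+1
    are exchanged; when these are in adjacent boxes this is not the weight of a
    standard tableau (diag_fun_swap), so that the intertwiner kills u, which means
    that u is a column vector (supported_column_vector). Its projections to the
    eigenspaces of pi^N, whose k-th power is pi^n = 1, are column vectors, one of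
    them is not zero, and M is the corresponding twist of L.

    For (1), the generator of Rect satisfies the same relations as x0
    (Rect_column), so Ind Rect is generated by a column vector. In a semisimple
    quotient its image is a sum of elements of simple submodules, which may be
    taken independent (semisimple_independent), hence column vectors, hence sums
    of eigenvectors of pi^N, and gluing maps the twists of L onto what they
    generate. It remains to map Ind Rect to L, that is Rect to the restriction of
    L. The obstruction is the image in L of the annihilator of the generator of
    Rect. By the key lemma it contains no nonzero vector of weight diag0; as
    intertwiners between weights of L are invertible, H(Z) x0 is spanned by
    vectors whose weights do not occur in the obstruction. The obstruction is
    contained in H(Z) x0, so it is zero (obstruction0). *)

Set Implicit Arguments.
Unset Strict Implicit.
Unset Printing Implicit Defensive.

Import Order.TTheory GRing.Theory Num.Theory.
Local Open Scope ring_scope.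

(** * Affine permutations *)

Section AffinePermutations.
Variable n : nat.

Lemma dvdz_add_small (a b : int) :
  (n %| a)%Z -> 0 < `|b| < n%:Z -> (n %| a + b)%Z = false.
Proof.
by move=> na /andP[b0 bn]; rewrite (rpredDl b na) dvdzE gtnNdvd //; lia.
Qed.

Lemma dvdz_eqarg (a b : int) : a = b -> (n %| a)%Z -> (n %| b)%Z.
Proof. by move=> ->. Qed.

(** A simple reflection of the affine symmetric group. *)
Definition affine_swap (i e : int) : int :=
  if (n %| e - i)%Z then e + 1 else if (n %| e - i - 1)%Z then e - 1 else e.

Lemma affine_swapL i e : (n %| e - i)%Z -> affine_swap i e = e + 1.
Proof. by rewrite /affine_swap => ->. Qed.

Lemma affine_swapN i e : (n %| e - i)%Z = false -> (n %| e - i - 1)%Z = false ->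
  affine_swap i e = e.
Proof. by rewrite /affine_swap => -> ->. Qed.

Lemma affine_swap_bounds i e : e - 1 <= affine_swap i e <= e + 1.
Proof. by rewrite /affine_swap; case: ifP => _; [|case: ifP => _]; lia. Qed.

Lemma affine_swapP i e :
  [\/ (n %| e - i)%Z, (n %| e - i - 1)%Z |
      (n %| e - i)%Z = false /\ (n %| e - i - 1)%Z = false].
Proof.
case ei: (n %| e - i)%Z; first by constructor 1.
by case ei1: (n %| e - i - 1)%Z; [constructor 2 | constructor 3].
Qed.

Lemma affine_swap_shift i m e : affine_swap (i + m) (e + m) = affine_swap i e + m.
Proof.
rewrite /affine_swap (_ : e + m - (i + m) = e - i); last lia.
by case: ifP => _; [lia | case: ifP => _; lia].
Qed.

Lemma affine_swap_cong i j : (n %| i - j)%Z -> affine_swap i =1 affine_swap j.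
Proof.
move=> ij e; rewrite /affine_swap.
have -> : e - j = (i - j) + (e - i) by lia.
have -> : (i - j) + (e - i) - 1 = (i - j) + (e - i - 1) by lia.
by rewrite (rpredDl (e - i) ij) (rpredDl (e - i - 1) ij).
Qed.

Lemma affine_swap_periodic i e m : (n %| m)%Z -> affine_swap i (e + m) = affine_swap i e + m.
Proof.
move=> nm; rewrite -affine_swap_shift; apply: affine_swap_cong.
by rewrite opprD addrA subrr sub0r rpredN.
Qed.

Lemma affine_swap_far i e b : (n %| e - i - b)%Z -> 0 < `|b| < n%:Z ->
  0 < `|b - 1| < n%:Z -> affine_swap i e = e.
Proof.
move=> eib b0 b1; rewrite affine_swapN // -[e - i](subrK b); first exact: dvdz_add_small.
by rewrite -addrA dvdz_add_small.
Qed.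

Hypothesis n_gt1 : (1 < n)%N.

Lemma affine_swapR i e : (n %| e - i - 1)%Z -> affine_swap i e = e - 1.
Proof.
move=> ei; rewrite /affine_swap ei -[X in (_ %| X)%Z](subrK 1 (e - i)).
by rewrite dvdz_add_small ?ei //; lia.
Qed.

Lemma affine_swapK i : involutive (affine_swap i).
Proof.
move=> e; case: (affine_swapP i e) => [ei|ei|[ei ei1]].
- by rewrite (affine_swapL ei) affine_swapR ?addrK //; apply: dvdz_eqarg ei; lia.
- by rewrite (affine_swapR ei) affine_swapL ?subrK //; apply: dvdz_eqarg ei; lia.
- by rewrite !(affine_swapN ei ei1).
Qed.

Lemma affine_swap_comm i j e : (n %| i - j)%Z = false ->
  (n %| i - j - 1)%Z = false -> (n %| i - j + 1)%Z = false ->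
  affine_swap i (affine_swap j e) = affine_swap j (affine_swap i e).
Proof.
have fixd a b x (c : bool) : (n %| a - b)%Z = false -> (n %| a - b - 1)%Z = false ->
    (n %| a - b + 1)%Z = false -> (n %| x - b - c%:Z)%Z -> affine_swap a x = x.
  move=> h0 h1 h2 hx; have no (d : int) : (n %| a - b - c%:Z + d)%Z = false ->
      (n %| x - a - d)%Z = false.
    apply: contraFF => xa.
    by apply: dvdz_eqarg (rpredB hx xa); move: (c%:Z) => C; lia.
  have no0 := no 0; rewrite subr0 addr0 in no0; case: c {no} hx (no 1) no0 => /= hx n1 n0.
    by rewrite affine_swapN ?n0 ?n1 ?subrK.
  by rewrite affine_swapN ?n0 ?n1 ?subr0.
move=> h0 h1 h2.
have h0' : (n %| j - i)%Z = false by rewrite -rpredN opprB.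
have h1' : (n %| j - i - 1)%Z = false by rewrite -rpredN -h2; congr (_ %| _)%Z; lia.
have h2' : (n %| j - i + 1)%Z = false by rewrite -rpredN -h1; congr (_ %| _)%Z; lia.
have key a b x : (n %| a - b)%Z = false -> (n %| a - b - 1)%Z = false ->
    (n %| a - b + 1)%Z = false -> affine_swap b x <> x ->
    affine_swap a (affine_swap b x) = affine_swap b (affine_swap a x).
  move=> k0 k1 k2; case: (affine_swapP b x) => [xb|xb|[xb xb1]] bx.
  - rewrite (fixd a b x false) ?subr0 // (affine_swapL xb) (fixd a b _ true) //=.
    by apply: dvdz_eqarg xb; lia.
  - rewrite (fixd a b x true) // (affine_swapR xb) (fixd a b _ false) //=.
    by apply: dvdz_eqarg xb; lia.
  - by case: bx; apply: affine_swapN.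
have [je|/eqP/key ->//] := eqVneq (affine_swap j e) e.
have [ie|/eqP ie] := eqVneq (affine_swap i e) e; first by rewrite je ie je.
by rewrite (key j i).
Qed.

Lemma affine_swap_braid i e : (2 < n)%N ->
  affine_swap i (affine_swap (i + 1) (affine_swap i e))
    = affine_swap (i + 1) (affine_swap i (affine_swap (i + 1) e)).
Proof.
move=> n2.
have L j x : (n %| x - j)%Z -> affine_swap j x = x + 1 by apply: affine_swapL.
have R j x : (n %| x - j - 1)%Z -> affine_swap j x = x - 1 by apply: affine_swapR.
have Nb y x j (b : int) : (n %| y)%Z -> x - j = y + b -> 0 < `|b| < n%:Z ->
    0 < `|b - 1| < n%:Z -> affine_swap j x = x.
  by move=> yn xj; apply: affine_swap_far; rewrite xj addrK.
have dv x y : (n %| x)%Z -> x = y -> (n %| y)%Z by move=> + <-.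
case e0: (n %| e - i)%Z.
  have -> : affine_swap i e = e + 1 by exact: L.
  have -> : affine_swap (i + 1) (e + 1) = e + 1 + 1.
    by apply: L; apply: (dv _ _ e0); lia.
  have -> : affine_swap i (e + 1 + 1) = e + 1 + 1 by apply: (Nb _ _ _ 2 e0); lia.
  have -> : affine_swap (i + 1) e = e by apply: (Nb _ _ _ (-1) e0); lia.
  have -> : affine_swap i e = e + 1 by exact: L.
  by rewrite L //; apply: (dv _ _ e0); lia.
case e1: (n %| e - i - 1)%Z.
  have -> : affine_swap i e = e - 1 by exact: R.
  have -> : affine_swap (i + 1) (e - 1) = e - 1.
    by apply: (Nb _ _ _ (-1) e1); lia.
  have -> : affine_swap i (e - 1) = e by rewrite L ?subrK //; apply: (dv _ _ e1); lia.
  have -> : affine_swap (i + 1) e = e + 1 by apply: L; apply: (dv _ _ e1); lia.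
  have -> : affine_swap i (e + 1) = e + 1 by apply: (Nb _ _ _ 2 e1); lia.
  by rewrite R ?addrK //; apply: (dv _ _ e1); lia.
case e2: (n %| e - i - 1 - 1)%Z.
  have -> : affine_swap i e = e by apply: (Nb _ _ _ 2 e2); lia.
  have -> : affine_swap (i + 1) e = e - 1 by apply: R; apply: (dv _ _ e2); lia.
  have -> : affine_swap i (e - 1) = e - 1 - 1 by apply: R; apply: (dv _ _ e2); lia.
  by apply/esym; apply: (Nb _ _ _ (-1) e2); lia.
have fix1 : affine_swap i e = e by exact: affine_swapN.
have fix2 : affine_swap (i + 1) e = e.
  by apply: affine_swapN; [rewrite -e1 | rewrite -e2]; congr (_ %| _)%Z; lia.
by rewrite fix1 fix2 fix1 fix2.
Qed.

Definition affine_act (w : seq int) (e : int) : int := foldr affine_swap e w.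

Lemma affine_act_rcons w i e : affine_act (rcons w i) e = affine_act w (affine_swap i e).
Proof. exact: foldr_rcons. Qed.

Lemma affine_act_periodic w e m : (n %| m)%Z -> affine_act w (e + m) = affine_act w e + m.
Proof. by move=> nm; elim: w => //= i w ->; apply: affine_swap_periodic. Qed.

Lemma affine_act_inj w : injective (affine_act w).
Proof. by elim: w => [|i w IHw] e e' //= /(inv_inj (affine_swapK i))/IHw. Qed.

Lemma affine_act_surj w e : exists e', affine_act w e' = e.
Proof.
elim: w e => [|i w IHw] e; first by exists e.
by have [e' we'] := IHw (affine_swap i e); exists e'; rewrite /= we' affine_swapK.
Qed.

End AffinePermutations.

(** * The columns of R_0 *)

Section ColumnReading.
Variable N : nat.
Hypothesis N_gt0 : (0 < N)%N.

(** The entry e is in row (e - 1) mod N and column (e - 1) / N of R_0, both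
    counted from 0. Diagonals are multiplied by N throughout, which makes them
    integers also for tableaux with a nonzero shift p / N. *)
Definition diag0 (e : int) : int := N%:Z * (((e - 1) %/ N)%Z - ((e - 1) %% N)%Z).

Lemma diag0E (c j : int) : 0 <= j < N%:Z -> diag0 (c * N%:Z + j + 1) = N%:Z * (c - j).
Proof.
move=> jN; rewrite /diag0 addrK divzMDl ?modzMDl; last lia.
by rewrite divz_small ?modz_small ?addr0 //; lia.
Qed.

Lemma diag0_addMr (e d : int) : diag0 (e + d * N%:Z) = diag0 e + d * N%:Z.
Proof.
rewrite /diag0 (_ : e + _ - 1 = d * N%:Z + (e - 1)); last by lia.
have N0 : N%:Z != 0 by lia.
by rewrite divzMDl // modzMDl -addrA mulrDr (mulrC N%:Z d) [RHS]addrC.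
Qed.

Lemma column_coords (e : int) : exists c j, [/\ 0 <= j < N%:Z & e = c * N%:Z + j + 1].
Proof.
exists ((e - 1) %/ N)%Z, ((e - 1) %% N)%Z; rewrite modz_ge0 ?ltz_pmod //; last lia.
by split=> //; rewrite -divz_eq; lia.
Qed.

Lemma diag0_step i : ~~ (N %| i)%Z -> diag0 i - diag0 (i + 1) = N%:Z.
Proof.
move=> Ni; have [c [j [jN iE]]] := column_coords i.
have jN1 : j + 1 < N%:Z.
  suff : j + 1 != N%:Z by lia.
  by apply: contraNneq Ni => jE; rewrite iE -addrA jE rpredD ?dvdz_mull ?dvdzz.
rewrite iE (_ : c * N + j + 1 + 1 = c * N%:Z + (j + 1) + 1); last by lia.
by rewrite !diag0E //; lia.
Qed.

Lemma increasing_id (g : nat -> int) : (forall j, (j < N)%N -> 0 <= g j < N%:Z) ->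
  (forall j, (j.+1 < N)%N -> g j < g j.+1) -> forall j, (j < N)%N -> g j = j%:Z.
Proof.
move=> gN g_inc.
have up d j : (j + d < N)%N -> g j + d%:Z <= g (j + d)%N.
  elim: d => [|d IHd] jd; first by rewrite addn0; lia.
  rewrite addnS in jd *; have := IHd (ltnW jd); have := g_inc _ jd; lia.
move=> j jN; have := up j 0%N; rewrite add0n => /(_ jN).
have := up (N.-1 - j)%N j; rewrite subnKC; last lia.
have := gN 0%N N_gt0; have := gN N.-1; rewrite prednK // leqnn => /(_ isT).
move=> gN1 g0 /(_ isT) upj up0; lia.
Qed.

(** On the diagonals of the c-th column of R_0, the entry of R_0 grows with its
    row. As x increases, the rows of its entries in R_0 increase strictly, hence
    they are 0, ..., N - 1. *)
Lemma column_of_diagonals (x : nat -> int) (c : int) :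
  (forall j, (j.+1 < N)%N -> x j < x j.+1) ->
  (forall j, (j < N)%N -> diag0 (x j) = N%:Z * (c - j%:Z)) ->
  forall j, (j < N)%N -> x j = c * N%:Z + j%:Z + 1.
Proof.
move=> x_inc x_diag; pose g i := ((x i - 1) %% N)%Z.
have N0 : N%:Z != 0 by lia.
have xE (i : nat) : (i < N)%N -> x i = (c - i%:Z + g i) * N%:Z + g i + 1.
  move=> iN; have := x_diag i iN; rewrite /diag0 -/(g i) => /(mulfI N0) h.
  rewrite -[LHS](subrK 1) [x i - 1](divz_eq _ N) -/(g i).
  have -> : ((x i - 1) %/ N)%Z = c - i%:Z + g i by lia.
  by [].
move=> j jN; have gj : g j = j%:Z.
  apply: (@increasing_id g) jN => [i iN|i iN].
    by rewrite /g modz_ge0 ?ltz_pmod //; lia.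
  by have iN' := ltnW iN; have := x_inc i iN; rewrite !xE //; nia.
by rewrite xE // gj subrK.
Qed.

(** By column_of_diagonals, F moves each column of R_0 to the one at distance
    m / N. *)
Lemma same_diagonals_shift (F : int -> int) (m : int) :
  (forall e, ~~ (N %| e)%Z -> F e < F (e + 1)) ->
  (forall e, diag0 (F e) = diag0 e + m) ->
  (N %| m)%Z /\ forall e, F e = e + m.
Proof.
move=> F_col F_diag.
have /dvdzP[s mE] : (N %| m)%Z.
  rewrite (_ : m = diag0 (F 1) - diag0 1); last by rewrite F_diag; lia.
  by rewrite rpredB // /diag0 dvdz_mulr.
split=> [|e]; first by rewrite mE dvdz_mull.
have [c [j [jN ->]]] := column_coords e.
have := @column_of_diagonals (fun i => F (c * N%:Z + i%:Z + 1)) (c + s) _ _ `|j|%N.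
rewrite gez0_abs; last by lia.
move=> ->; [by rewrite mE; lia | | |by lia].
  move=> i iN; rewrite (_ : c * N + i.+1%:Z + 1 = (c * N + i%:Z + 1) + 1); last by lia.
  apply: F_col; rewrite -addrA rpredDl ?dvdz_mull //.
  by rewrite dvdzE gtnNdvd //; lia.
by move=> i iN; rewrite F_diag diag0E ?mE; lia.
Qed.
End ColumnReading.

(** * Affine Hecke relations and the key lemma *)

Section Spans.
Variables (K : fieldType) (A : pzRingType) (cst : {rmorphism K -> A}).
Hypothesis cstC : forall c x, cst c * x = x * cst c.
Variable E : lmodType A.
Implicit Types (G : E -> Prop) (x y : E) (h : A).

Inductive kspan G : E -> Prop :=
  | kspan_gen x of G x : kspan G x
  | kspan0 : kspan G 0
  | kspanD x y of kspan G x & kspan G y : kspan G (x + y)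
  | kspanZ c x of kspan G x : kspan G (cst c *: x).

Lemma kspanN G x : kspan G x -> kspan G (- x).
Proof. by move=> Gx; rewrite -scaleN1r -(rmorphN1 cst); apply: kspanZ. Qed.

Lemma kspanB G x y : kspan G x -> kspan G y -> kspan G (x - y).
Proof. by move=> Gx Gy; apply/kspanD/kspanN. Qed.

Lemma cst_scaleC c h x : cst c *: (h *: x) = h *: (cst c *: x).
Proof. by rewrite !scalerA cstC. Qed.

Lemma cst_scaleI c x : c != 0 -> cst c *: x = 0 -> x = 0.
Proof.
move=> c0 cx; rewrite -(scale1r x) -(rmorph1 cst) -(mulVf c0) rmorphM -scalerA.
by rewrite cx scaler0.
Qed.

Lemma kspan_map h G G' : (forall x, G x -> kspan G' (h *: x)) ->
  forall x, kspan G x -> kspan G' (h *: x).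
Proof.
move=> hG x; elim=> [{}x /hG //||{}x y _ + _|c {}x _].
- by rewrite scaler0; apply: kspan0.
- by rewrite scalerDr; apply: kspanD.
- by rewrite -cst_scaleC; apply: kspanZ.
Qed.

Lemma kspan_sub G G' : (forall x, G x -> kspan G' x) -> forall x, kspan G x -> kspan G' x.
Proof.
move=> GG' x Gx; rewrite -[x]scale1r; apply: kspan_map Gx => y /GG'.
by rewrite scale1r.
Qed.

Lemma kspan_seq G w : (forall c u, G u -> G (cst c *: u)) -> kspan G w ->
  exists2 s : seq E, (forall u, u \in s -> G u) & w = \sum_(u <- s) u.
Proof.
move=> Gc; elim=> [{}w Gw||u u' _ [s sG ->] _ [s' sG' ->]|c u _ [s sG ->]].
- by exists [:: w]; [move=> u; rewrite inE => /eqP -> | rewrite big_seq1].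
- by exists [::]; rewrite ?big_nil.
- exists (s ++ s'); last by rewrite big_cat.
  by move=> w'; rewrite mem_cat => /orP[/sG|/sG'].
- exists [seq cst c *: u | u <- s]; last by rewrite big_map scaler_sumr.
  by move=> _ /mapP[w' /sG Gw' ->]; apply: Gc.
Qed.

Lemma cst_scale_inj x a b : x <> 0 -> cst a *: x = cst b *: x -> a = b.
Proof.
move=> x0 /eqP; rewrite -subr_eq0 -scalerBl -rmorphB => /eqP ab; apply/eqP.
by rewrite -subr_eq0; apply/negPn/negP => /cst_scaleI/(_ ab).
Qed.
End Spans.

(** One package of relations serves both the double affine algebra, where J is
    the set of all integers, and its subalgebra H(Z), where J consists of the
    non-multiples of n. *)
Record affine_hecke (K : fieldType) (n : nat) (t : K) (A : pzRingType)
    (cst : {rmorphism K -> A}) (J : pred int) (T Z Y : int -> A) : Prop := AffineHecke {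
  ah_cstC c x : cst c * x = x * cst c;
  ah_J i j : (n %| i - j)%Z -> J i = J j;
  ah_T i j : (n %| i - j)%Z -> T i = T j;
  ah_quad i : J i -> T i * T i = cst (t - t^-1) * T i + 1;
  ah_braid i : n <> 2 -> J i -> J (i + 1) ->
    T i * T (i + 1) * T i = T (i + 1) * T i * T (i + 1);
  ah_comm i j : (n %| i - j)%Z = false -> (n %| i - j - 1)%Z = false ->
    (n %| i - j + 1)%Z = false -> J i -> J j -> T i * T j = T j * T i;
  ah_ZTl i e : J i -> (n %| e - i)%Z ->
    Z (e + 1) * T i = T i * Z e + cst (t - t^-1) * Z (e + 1);
  ah_ZTr i e : J i -> (n %| e - i)%Z ->
    Z e * T i = T i * Z (e + 1) - cst (t - t^-1) * Z (e + 1);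
  ah_ZTn i e : J i -> (n %| e - i)%Z = false -> (n %| e - i - 1)%Z = false ->
    Z e * T i = T i * Z e;
  ah_ZZ e e' : Z e * Z e' = Z e' * Z e;
  ah_ZY e : Z e * Y e = 1;
  ah_YZ e : Y e * Z e = 1 }.

Section KeyLemma.
Variables (K : fieldType) (n : nat) (t : K) (A : pzRingType).
Variables (cst : {rmorphism K -> A}) (J : pred int) (T Z Y : int -> A).
Hypothesis n_gt1 : (1 < n)%N.
Hypothesis AH : affine_hecke n t cst J T Z Y.
Variable E : lmodType A.
Implicit Types (w u : seq int) (x y : E) (i j e : int) (l : nat).

Local Notation act := (affine_act n).
Local Notation swap := (affine_swap n).
Local Notation cstC := (ah_cstC AH).

Definition Tword w : A := foldr (fun i h => T i * h) 1 w.

Lemma Tword_rcons w i : Tword (rcons w i) = Tword w * T i.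
Proof. by elim: w => /= [|j w ->]; rewrite ?mulr1 ?mul1r ?mulrA. Qed.

Definition short y l : E -> Prop :=
  kspan cst (fun z => exists w, [/\ all J w, (size w < l)%N & z = Tword w *: y]).

Lemma short_word y l w : all J w -> (size w < l)%N -> short y l (Tword w *: y).
Proof. by move=> Jw wl; apply: kspan_gen; exists w. Qed.

Lemma short_leq y l l' x : (l <= l')%N -> short y l x -> short y l' x.
Proof.
move=> ll'; apply: (kspan_sub cstC) => _ [w [Jw wl ->]].
by apply: short_word => //; apply: leq_trans wl ll'.
Qed.

Lemma short_T y l i x : J i -> short (T i *: y) l x -> short y l.+1 x.
Proof.
move=> Ji; apply: (kspan_sub cstC).
move=> _ [w [Jw wl ->]]; rewrite scalerA -Tword_rcons.
by apply: short_word; rewrite ?all_rcons ?Ji ?size_rcons.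
Qed.

(** A word with a descent at j can be rewritten, up to shorter words, so that it
    ends in j: this is the exchange condition, proved by pushing j through the
    last letter of the word with the braid relations. It replaces the choice of
    basis elements T_w. *)
Lemma exchange l w j y : size w = l -> all J w -> J j -> act w (j + 1) < act w j ->
  short y l (Tword w *: y) \/
  exists u, [/\ all J u, (size u).+1 = l, act u =1 (fun e => act w (swap j e))
    & short y l (Tword w *: y - Tword u *: (T j *: y))].
Proof.
elim/ltn_ind: l w j y => l IHl w j y; case/lastP: w => [/= _ _ _|w i]; first by lia.
rewrite size_rcons all_rcons => wl /andP[Ji Jw] Jj desc.
set f := act (rcons w i) in desc *.
have f_per e m : (n %| m)%Z -> f (e + m) = f e + m by apply: affine_act_periodic.
have wE e : act w e = f (swap i e) by rewrite /f affine_act_rcons affine_swapK.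
have f_inj e e' : f e = f e' -> e = e' by apply: affine_act_inj.
have IHw j' := IHl _ (eq_leq wl) w j' (T i *: y) erefl Jw.
have TwE : Tword (rcons w i) *: y = Tword w *: (T i *: y).
  by rewrite Tword_rcons scalerA.
case ij: (n %| i - j)%Z.
  right; exists w; split=> //.
    by move=> e; rewrite wE; congr f; apply: affine_swap_cong.
  by rewrite TwE (ah_T AH ij) subrr; apply: kspan0.
have swapI a : swap a a = a + 1 by rewrite affine_swapL ?subrr.
have swapI1 a : swap a (a + 1) = a.
  by rewrite affine_swapR // ?addrK // (_ : a + 1 - a - 1 = 0) //; lia.
have sub_split x a b : short y l (x - a) -> short y l (a - b) -> short y l (x - b).
  by move=> xa ab; rewrite -(subrK a x) -addrA; apply: kspanD.
have [inv|ndesc] := ltP (f i) (f (i + 1)).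
  left; rewrite TwE; case: (IHw i Ji) => [|h|[u [Ju ul _ h]]].
  - by rewrite !wE swapI swapI1.
  - by rewrite -wl; apply: short_T h.
  rewrite -[X in short _ _ X](subrK (Tword u *: (T i *: (T i *: y)))).
  apply: kspanD; first by rewrite -wl; apply: short_T h.
  rewrite (scalerA (T i)) (ah_quad AH) // scalerDl scalerDr scale1r -scalerA.
  rewrite -(cst_scaleC cstC) (scalerA _ (T i)) -Tword_rcons.
  by apply: kspanD; [apply: kspanZ|]; apply: short_word;
    rewrite ?all_rcons ?Ji ?size_rcons //; lia.
have {}ndesc : f (i + 1) < f i.
  by rewrite lt_neqAle ndesc andbT; apply/eqP => /f_inj; lia.
have braid : T i * T j * T i = T j * T i * T j ->
    (forall e, swap i (swap j (swap i e)) = swap j (swap i (swap j e))) ->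
    f (swap i (j + 1)) < f (swap i j) ->
    f (swap i (swap j (i + 1))) < f (swap i (swap j i)) ->
    short y l (Tword (rcons w i) *: y) \/
    exists u, [/\ all J u, (size u).+1 = l, act u =1 (fun e => f (swap j e))
      & short y l (Tword (rcons w i) *: y - Tword u *: (T j *: y))].
  move=> TTT sss desc1 desc2.
  case: (IHw j Jj) => [|h|[u [Ju ul uE h]]]; rewrite ?wE //.
    by left; rewrite TwE -wl; apply: short_T h.
  have {}h : short y l (Tword (rcons w i) *: y - Tword u *: (T j *: (T i *: y))).
    by rewrite TwE -wl; apply: short_T h.
  have up x : short (T j *: (T i *: y)) (size u) x -> short y l x.
    by move=> /(short_T Jj)/(short_T Ji); rewrite ul wl.
  have lu : (size u < l)%N by rewrite -wl -ul.
  case: (IHl _ lu u i (T j *: (T i *: y)) erefl Ju Ji) => [|/up h'|].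
  - by rewrite !uE !wE.
  - by left; rewrite -(subrK (Tword u *: (T j *: (T i *: y))) (Tword _ *: y)); apply: kspanD.
  case=> u' [Ju' ul' uE' /up h'].
  right; exists (rcons (rcons u' j) i); split;
    rewrite 2?all_rcons ?Ji ?Jj 2?size_rcons ?ul' ?ul ?wl //.
    by move=> e; rewrite !affine_act_rcons uE' uE wE sss !affine_swapK.
  have TTTy : T j *: (T i *: (T j *: y)) = T i *: (T j *: (T i *: y)).
    by rewrite !scalerA TTT.
  apply: sub_split h _; rewrite (Tword_rcons (rcons u' j)) (Tword_rcons u').
  by rewrite -!scalerA TTTy.
case ij1: (n %| i - j - 1)%Z; last case ij2: (n %| i - j + 1)%Z; first last.
- (* i and j commute *)
  have swij e : swap i (swap j e) = swap j (swap i e) by apply: affine_swap_comm.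
  have fixj : swap i j = j /\ swap i (j + 1) = j + 1.
    split; apply: affine_swapN; rewrite -rpredN.
    - by rewrite opprB.
    - by rewrite -ij2; congr (_ %| _)%Z; lia.
    - by rewrite -ij1; congr (_ %| _)%Z; lia.
    - by rewrite -ij; congr (_ %| _)%Z; lia.
  case: (IHw j Jj) => [|h|[u [Ju ul uE h]]].
  - by rewrite !wE fixj.1 fixj.2.
  - by left; rewrite TwE -wl; apply: short_T h.
  right; exists (rcons u i); split; rewrite ?all_rcons ?Ji ?size_rcons ?ul //.
    by move=> e; rewrite affine_act_rcons uE wE -swij affine_swapK.
  rewrite TwE Tword_rcons -scalerA (scalerA (T i)) (ah_comm AH) // -(scalerA (T j)).
  by rewrite -wl; apply: short_T h.
- (* i = j - 1 mod n *)
  have n2 : n <> 2.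
    move=> n2; move: ij1; rewrite (_ : i - j - 1 = (i - j + 1) - 2); last by lia.
    by rewrite rpredBr ?ij2 // n2.
  set m := i - j + 1 in ij2; have iE : i = j - 1 + m by rewrite /m; lia.
  have im : (n %| i - (j - 1))%Z by apply: dvdz_eqarg ij2; lia.
  have siE : swap i =1 swap (j - 1) by apply: affine_swap_cong.
  have desc' : f j < f (j - 1).
    have i1 : i + 1 = j + m by lia.
    by move: ndesc; rewrite i1 [X in _ < f X]iE !(f_per _ m) // ltrD2r.
  have sj1 e : (n %| e)%Z -> swap j (j - 1 + e) = j - 1 + e.
    move=> en; apply: (@affine_swap_far _ _ _ (-1)); try lia.
    by apply: dvdz_eqarg en; lia.
  have si1 e : (n %| e)%Z -> swap i (j + 1 + e) = j + 1 + e.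
    move=> en; rewrite siE; apply: (@affine_swap_far _ _ _ 2); try lia.
    by apply: dvdz_eqarg en; lia.
  apply: braid.
  - have := ah_braid AH n2 (i := j - 1); rewrite subrK (ah_T AH im) => -> //.
    by rewrite -(ah_J AH im).
  - move=> e; rewrite !siE; have := affine_swap_braid n_gt1 (j - 1) e.
    by rewrite subrK => -> //; lia.
  - rewrite -[j + 1]addr0 si1 // addr0 siE (affine_swapR n_gt1).
      by apply: lt_trans desc'.
    by apply: dvdz_eqarg (dvdz0 n); lia.
  - have i1 : i + 1 = j + m by lia.
    have -> : swap j i = i by rewrite iE sj1.
    have -> : swap j (i + 1) = j + 1 + m by rewrite i1 affine_swap_periodic // swapI.
    by rewrite si1 // swapI i1 !(f_per _ m) // ltrD2r.
- (* i = j + 1 mod n *)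
  set m := i - j - 1 in ij1; have iE : i = j + 1 + m by rewrite /m; lia.
  have im : (n %| i - (j + 1))%Z by apply: dvdz_eqarg ij1; lia.
  have siE : swap i =1 swap (j + 1) by apply: affine_swap_cong.
  have desc' : f (j + 1 + 1) < f (j + 1).
    have i1 : i + 1 = j + 1 + 1 + m by lia.
    by move: ndesc; rewrite i1 [X in _ < f X]iE !(f_per _ m) // ltrD2r.
  have n2 : n <> 2.
    move=> n2; have := f_per j 2; rewrite n2 => /(_ isT) f2.
    by move: (lt_trans desc' desc); rewrite -addrA f2; lia.
  have sj2 e : (n %| e)%Z -> swap j (j + 1 + 1 + e) = j + 1 + 1 + e.
    move=> en; apply: (@affine_swap_far _ _ _ 2); try lia.
    by apply: dvdz_eqarg en; lia.
  have si1 e : (n %| e)%Z -> swap i (j + e) = j + e.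
    move=> en; rewrite siE; apply: (@affine_swap_far _ _ _ (-1)); try lia.
    by apply: dvdz_eqarg en; lia.
  apply: braid.
  - have := ah_braid AH n2 (i := j); rewrite (ah_T AH im) => -> //.
    by rewrite -(ah_J AH im).
  - by move=> e; rewrite !siE affine_swap_braid //; lia.
  - have := si1 0 (dvdz0 n); rewrite addr0 => ->; rewrite siE swapI.
    exact: lt_trans desc.
  - have i1 : i + 1 = j + 1 + 1 + m by lia.
    have -> : swap j i = j + m by rewrite iE affine_swap_periodic // swapI1.
    have -> : swap j (i + 1) = i + 1 by rewrite i1 sj2.
    by rewrite si1 // swapI1 iE !(f_per _ m) // ltrD2r.
Qed.

Lemma short_Tl y l i x : J i -> short y l x -> short y l.+1 (T i *: x).
Proof.
move=> Ji; apply: (kspan_map cstC) => _ [w [Jw wl ->]].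
by rewrite scalerA; apply: (@short_word _ _ (i :: w)); rewrite /= ?Ji.
Qed.

(** Both the Z_e and their inverses have this commutation rule. *)
Definition swaps_past_T (X : int -> A) : Prop :=
  forall i e, J i -> exists c e', X (swap i e) * T i = T i * X e + cst c * X e'.

Lemma Z_swaps : swaps_past_T Z.
Proof.
move=> i e Ji; case: (affine_swapP n i e) => [ei|ei|[ei ei1]].
- exists (t - t^-1), (e + 1); rewrite affine_swapL //; exact: (ah_ZTl AH).
- have ei' : (n %| e - 1 - i)%Z by apply: dvdz_eqarg ei; lia.
  exists (- (t - t^-1)), e; rewrite (affine_swapR n_gt1) // (ah_ZTr AH Ji ei').
  by rewrite subrK rmorphN mulNr.
- exists 0, e; rewrite affine_swapN // rmorph0 mul0r addr0; exact: (ah_ZTn AH).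
Qed.

Lemma Y_swaps : swaps_past_T Y.
Proof.
have conj i a b (X : A) : Z b * T i = T i * Z a + X -> Y b * T i = T i * Y a - Y b * X * Y a.
  move=> ZT; have -> : X = Z b * T i - T i * Z a by rewrite ZT addrAC subrr add0r.
  rewrite mulrBr mulrBl !mulrA (ah_YZ AH) mul1r -!mulrA (ah_ZY AH) mulr1.
  by rewrite opprB addrC subrK.
move=> i e Ji; case: (affine_swapP n i e) => [ei|ei|[ei ei1]].
- exists (- (t - t^-1)), e; rewrite affine_swapL // (conj _ _ _ _ (ah_ZTl AH Ji ei)).
  by rewrite mulrA -(cstC _ (Y _)) -(mulrA (cst _) (Y _)) (ah_YZ AH) mulr1 rmorphN mulNr.
- have ei' : (n %| e - 1 - i)%Z by apply: dvdz_eqarg ei; lia.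
  exists (t - t^-1), (e - 1); rewrite (affine_swapR n_gt1) //.
  have := ah_ZTr AH Ji ei'; rewrite subrK -mulNr -rmorphN => /conj ->.
  by rewrite mulrA -(cstC _ (Y _)) -!mulrA (ah_ZY AH) mulr1 rmorphN mulNr opprK.
- exists 0, e; rewrite affine_swapN // rmorph0 mul0r addr0.
  have := ah_ZTn AH Ji ei ei1; rewrite -[T i * _]addr0 => /conj ->.
  by rewrite mulr0 mul0r subr0.
Qed.

(** Each letter of w moves the index of X by its reflection, up to a term in
    which the letter has disappeared: modulo shorter words, T_w b has the weight
    of b transported by the affine permutation of w. *)
Lemma word_weight (X : int -> A) (z : int -> K) (b : E) w e :
  swaps_past_T X -> (forall e, X e *: b = cst (z e) *: b) -> all J w ->
  short b (size w) (X (act w e) *: (Tword w *: b) - cst (z e) *: (Tword w *: b)).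
Proof.
move=> XT Xb; elim: w e => [|i w IHw] e /=.
  by rewrite scale1r Xb subrr => _; apply: kspan0.
case/andP=> Ji Jw; have [c [e' XTe]] := XT i (act w e) Ji.
have [f fE] := affine_act_surj n_gt1 w e'.
rewrite -scalerA (scalerA (X _)) XTe scalerDl addrAC (cst_scaleC cstC) -!scalerA.
apply: kspanD; first by rewrite -scalerBr; apply: short_Tl => //; apply: IHw.
apply: kspanZ; rewrite -fE -[X in kspan _ _ X](subrK (cst (z f) *: (Tword w *: b))).
apply: kspanD; last by apply/kspanZ/short_word.
exact: (short_leq (leqnSn (size w)) (IHw f Jw)).
Qed.

Lemma short_stable (X : int -> A) (z : int -> K) (b : E) l x e :
  swaps_past_T X -> (forall e, X e *: b = cst (z e) *: b) ->
  short b l x -> short b l (X e *: x).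
Proof.
move=> XT Xb; apply: (kspan_map cstC) => _ [w [Jw wl ->]].
have [f <-] := affine_act_surj n_gt1 w e.
rewrite -[X in kspan _ _ X](subrK (cst (z f) *: (Tword w *: b))).
apply: kspanD; last by apply/kspanZ/short_word.
by apply: (short_leq (ltnW wl)); apply: word_weight.
Qed.

(** For the double affine algebra, b m is pi^m x with x a column vector. For H(Z),
    which does not contain pi, Pm allows only m = 0 and b 0 is x. *)
Variables (N : nat) (q : K) (Pm : pred nat) (b : nat -> E).
Hypothesis N_gt0 : (0 < N)%N.
Hypothesis q_inj : forall a c : int, q ^ (2 * a) = q ^ (2 * c) -> a = c.
Hypothesis q_neq0 : q != 0.
Hypothesis b_weight : forall m e, Pm m ->
  Z (e + m%:Z) *: b m = cst (q ^ (2 * (diag0 N e + m%:Z))) *: b m.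
Hypothesis b_sign : forall m i, Pm m -> ~~ (N %| i - m%:Z)%Z ->
  J i /\ T i *: b m = cst (- t^-1) *: b m.

Definition word_span l : E -> Prop :=
  kspan cst (fun z => exists w m, [/\ Pm m, all J w, (size w < l)%N & z = Tword w *: b m]).

Definition top_span : E -> Prop :=
  kspan cst (fun z => exists m, [/\ Pm m, (N %| m)%N & z = b m]).

Lemma short_word_span m l x : Pm m -> short (b m) l x -> word_span l x.
Proof.
move=> Pmm; apply: (kspan_sub cstC) => _ [w [Jw wl ->]].
by apply: kspan_gen; exists w, m.
Qed.

Lemma word_span_leq l l' x : (l <= l')%N -> word_span l x -> word_span l' x.
Proof.
move=> ll'; apply: (kspan_sub cstC) => _ [w [m [Pmm Jw wl ->]]].
by apply: kspan_gen; exists w, m; split=> //; apply: leq_trans wl ll'.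
Qed.

Lemma b_weightE m e : Pm m ->
  Z e *: b m = cst (q ^ (2 * (diag0 N (e - m%:Z) + m%:Z))) *: b m.
Proof. by move=> Pmm; rewrite -b_weight // subrK. Qed.

Lemma word_span_T l i x : J i -> word_span l x -> word_span l.+1 (T i *: x).
Proof.
move=> Ji; apply: (kspan_map cstC) => _ [w [m [Pmm Jw wl ->]]].
by rewrite scalerA; apply: kspan_gen; exists (i :: w), m; rewrite /= Ji.
Qed.

Lemma word_span_Z l e x : word_span l x -> word_span l (Z e *: x).
Proof.
apply: (kspan_map cstC) => _ [w [m [Pmm Jw wl ->]]].
apply: (short_word_span Pmm); apply: short_stable Z_swaps _ _ => [f|].
  exact: b_weightE.
exact: short_word.
Qed.

Lemma word_span_Y l e x : word_span l x -> word_span l (Y e *: x).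
Proof.
apply: (kspan_map cstC) => _ [w [m [Pmm Jw wl ->]]].
pose z f := (q ^ (2 * (diag0 N (f - m%:Z) + m%:Z)))^-1.
have Yb f : Y f *: b m = cst (z f) *: b m.
  rewrite -{2}[b m]scale1r -(ah_YZ AH f) -(scalerA (Y f)) b_weightE //.
  rewrite (cst_scaleC cstC) [cst (z f) *: _]scalerA -rmorphM mulVf ?rmorph1 ?scale1r //.
  exact: expfz_neq0.
apply: (short_word_span Pmm); apply: short_stable Y_swaps Yb _.
exact: short_word.
Qed.

Lemma word_span0 x : word_span 0 x -> x = 0.
Proof.
elim=> [{}x [w [m []]] //|//|{}x y _ -> _ ->|c {}x _ ->]; first by rewrite addr0.
by rewrite scaler0.
Qed.

(** If w has a descent inside a column of R_0 translated by m, T_w b m reduces to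
    shorter words by exchange, since T acts on b m by a scalar there. Otherwise
    e |-> w (e + m) sorts the columns and shifts the diagonals, so that w acts
    trivially (same_diagonals_shift), and a nonempty word that acts trivially is
    shortened by the quadratic relation. *)
Lemma word_diag0 w m : Pm m -> all J w ->
  (forall e, diag0 N (act w (e + m%:Z)) = diag0 N e + m%:Z) ->
  (w = [::] /\ (N %| m)%N) \/ word_span (size w) (Tword w *: b m).
Proof.
move=> Pmm Jw wdiag.
have [[e [Ne desc]]|no_desc] :=
    pselect (exists e, ~~ (N %| e)%Z /\ act w (e + m%:Z + 1) < act w (e + m%:Z)).
  have Nem : ~~ (N %| e + m%:Z - m%:Z)%Z by rewrite addrK.
  have [Jem Tb] := b_sign Pmm Nem.
  right; apply: (short_word_span Pmm).
  have [//|[u [Ju ul _]]] := exchange (b m) erefl Jw Jem desc.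
  rewrite Tb -(cst_scaleC cstC) => h.
  rewrite -[X in short _ _ X](subrK (cst (- t^-1) *: (Tword u *: b m))).
  by apply: kspanD h _; apply/kspanZ/short_word; rewrite ?ul.
have [e|Nm wE] := same_diagonals_shift N_gt0 (F := fun e => act w (e + m%:Z)) _ wdiag.
  move=> Ne; rewrite addrAC lt_neqAle; apply/andP; split.
    by apply/eqP => /(affine_act_inj n_gt1); lia.
  by rewrite leNgt; apply/negP => desc; apply: no_desc; exists e.
case/lastP: w Jw wE {wdiag no_desc} => [|w i]; first by left.
rewrite all_rcons => /andP[Ji Jw] wE; right; apply: (short_word_span Pmm).
have wiE e : act w e = swap i e.
  have := wE (swap i e - m%:Z); rewrite affine_act_rcons subrK.
  by rewrite affine_swapK.
have desc : act w (i + 1) < act w i.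
  have -> : act w (i + 1) = i.
    by rewrite wiE (affine_swapR n_gt1) ?addrK //; apply: dvdz_eqarg (dvdz0 n); lia.
  by rewrite wiE affine_swapL ?subrr //; lia.
rewrite Tword_rcons size_rcons -scalerA.
have [h|[u [Ju ul _ h]]] := exchange (T i *: b m) erefl Jw Ji desc.
  exact: (short_T Ji h).
rewrite -[X in short _ _ X](subrK (Tword u *: (T i *: (T i *: b m)))).
apply: kspanD; first exact: (short_T Ji h).
rewrite (scalerA (T i)) (ah_quad AH) // scalerDl scalerDr scale1r -scalerA.
rewrite -(cst_scaleC cstC) (scalerA _ (T i)) -Tword_rcons.
by apply: kspanD; [apply: kspanZ|]; apply: short_word;
  rewrite ?all_rcons ?Ji ?size_rcons //; lia.
Qed.

Definition Zprod (s : seq (int * K)) : A :=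
  foldr (fun p h => (Z p.1 - cst p.2) * h) 1 s.

Lemma Zprod_comm s p : GRing.comm (Zprod s) (Z p.1 - cst p.2).
Proof.
elim: s => [|p' s IHs] /=; first exact/commr_sym/commr1.
apply/commr_sym/commrM/commr_sym => //.
have ZC e c : GRing.comm (Z e) (cst c) by rewrite /GRing.comm cstC.
apply: commrB; first exact/commr_sym/commrB/ZC/(ah_ZZ AH).
by apply/commr_sym/commrB; [apply/commr_sym/ZC | rewrite /GRing.comm cstC].
Qed.

Lemma Zprod_cat s s' : Zprod (s ++ s') = Zprod s * Zprod s'.
Proof. by elim: s => [|p s IHs] /=; rewrite ?mul1r // IHs mulrA. Qed.

Lemma Zprod_catC s s' : Zprod (s ++ s') = Zprod s' * Zprod s.
Proof.
rewrite Zprod_cat; elim: s => [|p s IHs] /=; first by rewrite mul1r mulr1.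
by rewrite -mulrA IHs !mulrA Zprod_comm.
Qed.

Lemma Zprod_span s l x : word_span l x -> word_span l (Zprod s *: x).
Proof.
elim: s => [|p s IHs] /=; rewrite ?scale1r // => /IHs {}IHs.
rewrite -scalerA scalerBl; apply: kspanB; first exact: word_span_Z.
exact: kspanZ.
Qed.

Lemma Zprod_weight (z : int -> K) s x : (forall e, Z e *: x = cst (z e) *: x) ->
  Zprod s *: x = cst (\prod_(p <- s) (z p.1 - p.2)) *: x.
Proof.
move=> zx; elim: s => [|p s IHs] /=; first by rewrite big_nil rmorph1.
rewrite big_cons -scalerA IHs -(cst_scaleC cstC) scalerBl zx -scalerBl -rmorphB.
by rewrite scalerA -rmorphM mulrC.
Qed.

(** Modulo shorter words and top_span, word_span is a sum of weight spaces for
    weights other than diag0, and for each of them a factor of Zprod s vanishes. *)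
Lemma word_span_kill l x : word_span l.+1 x -> exists s g,
  [/\ all (fun p => p.2 != q ^ (2 * diag0 N p.1)) s, top_span g
    & word_span l (Zprod s *: (x - g))].
Proof.
elim=> [{}x [w [m [Pmm Jw wl ->]]]||{}x y _ [s [g [sq gt sx]]] _ [s' [g' [sq' gt' sx']]]
    |c {}x _ [s [g [sq gt sx]]]].
- have [{}wl|lw] := ltnP (size w) l.
    exists [::], 0; rewrite subr0 scale1r; split=> //; first exact: kspan0.
    by apply: kspan_gen; exists w, m.
  have {lw} {}wl : size w = l by apply/eqP; rewrite eqn_leq lw andbT.
  have [wdiag|/existsNP[e ediag]] :=
      pselect (forall e, diag0 N (act w (e + m%:Z)) = diag0 N e + m%:Z).
    exists [::]; case: (word_diag0 Pmm Jw wdiag) => [[-> Nm]|h].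
      exists (b m); rewrite !scale1r subrr; split=> //; last exact: kspan0.
      by apply: kspan_gen; exists m.
    exists 0; rewrite subr0 scale1r; split=> //; first exact: kspan0.
    by rewrite -wl.
  exists [:: (act w (e + m%:Z), q ^ (2 * (diag0 N e + m%:Z)))], 0; split; last 2 first.
  - exact: kspan0.
  - rewrite subr0 /= mulr1 scalerBl -wl; apply: (short_word_span Pmm).
    have := word_weight (e + m%:Z) Z_swaps (fun e => b_weightE e Pmm) Jw.
    by rewrite addrK.
  - by rewrite /= andbT; apply/eqP => /q_inj h; apply: ediag.
- by exists [::], 0; rewrite subr0 scaler0; split=> //; apply: kspan0.
- exists (s ++ s'), (g + g'); rewrite all_cat sq; split=> //; first exact: kspanD.
  rewrite opprD addrACA scalerDr {1}Zprod_catC Zprod_cat -!scalerA.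
  by apply: kspanD; apply: Zprod_span.
- exists s, (cst c *: g); split=> //; first exact: kspanZ.
  by rewrite -scalerBr -(cst_scaleC cstC); apply: kspanZ.
Qed.

(** Zprod s acts on vectors of weight diag0 by a nonzero scalar, so
    word_span_kill makes x, up to an element of top_span, a combination of
    shorter words. *)
Lemma weight_diag0_top l x : word_span l x ->
  (forall e, Z e *: x = cst (q ^ (2 * diag0 N e)) *: x) -> top_span x.
Proof.
elim: l x => [|l IHl] x; first by move=> /word_span0 -> _; apply: kspan0.
move=> /word_span_kill[s [g [sq gt sx]]] xz.
have gz e : Z e *: g = cst (q ^ (2 * diag0 N e)) *: g.
  elim: gt {sx} => [_ [m [Pmm /dvdnP[d mE] ->]]||g1 g2 _ h1 _ h2|c g1 _ h1].
  - rewrite mE in Pmm *; rewrite b_weightE // -{2}(subrK (d * N)%N%:Z e) PoszM.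
    by rewrite diag0_addMr.
  - by rewrite !scaler0.
  - by rewrite !scalerDr h1 h2.
  - by rewrite -(cst_scaleC cstC c) h1 (cst_scaleC cstC).
have xgz e : Z e *: (x - g) = cst (q ^ (2 * diag0 N e)) *: (x - g).
  by rewrite !scalerBr xz gz.
suff xgl : word_span l (x - g).
  by rewrite -(subrK g x); apply: kspanD (IHl _ xgl xgz) gt.
move: sx; rewrite (Zprod_weight _ xgz).
set c := \prod_(_ <- s) _ => sx.
have c0 : c != 0.
  rewrite /c prodf_seq_neq0; apply: sub_all sq => p.
  by rewrite subr_eq0 eq_sym.
rewrite -[_ - _]scale1r -(rmorph1 cst) -(mulVf c0) rmorphM -scalerA.
exact: kspanZ.
Qed.
End KeyLemma.

(** * Intertwiners *)

Section Intertwiners.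
Variables (K : fieldType) (n N : nat) (q t : K) (A : pzRingType).
Variables (cst : {rmorphism K -> A}) (J : pred int) (T Z Y : int -> A).
Hypothesis n_gt1 : (1 < n)%N.
Hypothesis q_neq0 : q != 0.
Hypothesis t_def : t = q ^+ N.
Hypothesis q_inj : forall a c : int, q ^ (2 * a) = q ^ (2 * c) -> a = c.
Hypothesis AH : affine_hecke n t cst J T Z Y.
Variable E : lmodType A.
Implicit Types (y : E) (D : int -> int) (i e : int).
Local Notation swap := (affine_swap n).
Local Notation cstC := (ah_cstC AH).

Definition has_weight y D : Prop := forall e, Z e *: y = cst (q ^ (2 * D e)) *: y.

(** The weights compatible with Z_{e+n} = q^(2n) Z_e. *)
Definition quasi_periodic D : Prop := forall e d, D (e + n%:Z * d) = D e + n%:Z * d.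

(** The scalar for which T_i + twining D i carries vectors of weight D to vectors
    of weight D o swap i. *)
Definition twining D i : K :=
  (t - t^-1) * q ^ (2 * D (i + 1)) / (q ^ (2 * D i) - q ^ (2 * D (i + 1))).

Definition intertwine D i y : E := T i *: y + cst (twining D i) *: y.

Lemma quasi_periodic_swap D i : quasi_periodic D -> quasi_periodic (D \o swap i).
Proof.
by move=> Dper e d; rewrite /= affine_swap_periodic ?Dper // dvdz_mulr ?dvdzz.
Qed.

Lemma weight_diff_neq0 D i : D i <> D (i + 1) -> q ^ (2 * D i) - q ^ (2 * D (i + 1)) != 0.
Proof. by move=> Di; rewrite subr_eq0; apply/eqP => /q_inj. Qed.

Lemma twiningE D i e : quasi_periodic D -> D i <> D (i + 1) -> (n %| e - i)%Z ->
  twining D i * q ^ (2 * D e)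
    = (t - t^-1) * q ^ (2 * D (e + 1)) + twining D i * q ^ (2 * D (e + 1)).
Proof.
move=> Dper Di /dvdzP[d dE]; have -> : e = i + n%:Z * d by lia.
rewrite addrAC !Dper !mulrDr !expfzDr //; have := weight_diff_neq0 Di.
rewrite /twining; move: (q ^ (2 * D i)) (q ^ (2 * D (i + 1))) (q ^ _) (t - t^-1) => x y z s.
move=> xy0; field; exact: xy0.
Qed.

Lemma intertwine_weight D i y : J i -> quasi_periodic D -> D i <> D (i + 1) ->
  has_weight y D -> has_weight (intertwine D i y) (D \o swap i).
Proof.
move=> Ji Dper Di yD e; rewrite /intertwine !scalerDr scalerA.
have twE f := twiningE Dper Di (e := f).
case: (affine_swapP n i e) => [ei|ei|[ei ei1]] /=.
- rewrite (affine_swapL ei) (ah_ZTr AH) // scalerBl -!scalerA yD -!(cst_scaleC cstC _ (Z e)) yD.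
  rewrite -(cst_scaleC cstC _ (T i)) -addrA; congr (_ + _).
  rewrite !scalerA -scaleNr -scalerDl -!rmorphM -rmorphN -rmorphD; congr (cst _ *: _).
  by rewrite twE // [RHS]mulrC addrA addNr add0r.
- have ei' : (n %| e - 1 - i)%Z by apply: dvdz_eqarg ei; lia.
  rewrite (affine_swapR n_gt1 ei) -{1 2}(subrK 1 e) (ah_ZTl AH) // scalerDl -!scalerA yD.
  rewrite -(cst_scaleC cstC _ (Z _)) yD -(cst_scaleC cstC _ (T i)) -addrA; congr (_ + _).
  rewrite !scalerA -scalerDl -!rmorphM -rmorphD; congr (cst _ *: _).
  by rewrite -twE // mulrC.
- rewrite affine_swapN // (ah_ZTn AH) // -scalerA yD -(cst_scaleC cstC _ (T i)).
  rewrite -(cst_scaleC cstC _ (Z e)) yD; congr (_ + _); exact: (cst_scaleC cstC).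
Qed.

(** With a and b the eigenvalues of Z_i and Z_{i+1}, the constant is
    (a - t^2 b) (t^2 a - b) / (t^2 (a - b)^2), which vanishes only on neighbouring
    diagonals as t^2 = q^(2N). *)
Lemma intertwineK D i y : J i -> D i <> D (i + 1) ->
  `|D i - D (i + 1)| <> N%:Z -> exists2 c, c != 0 &
    intertwine (D \o swap i) i (intertwine D i y) = cst c *: y.
Proof.
move=> Ji Di DN; have sK : swap i i = i + 1 by rewrite affine_swapL ?subrr.
have sK1 : swap i (i + 1) = i by rewrite -sK affine_swapK.
exists (1 + twining D i * twining (D \o swap i) i).
  have xy0 := weight_diff_neq0 Di.
  rewrite /twining /= sK sK1.
  have t0 : t != 0 by rewrite t_def expf_neq0.
  have E1 : q ^ (2 * D i) - t ^+ 2 * q ^ (2 * D (i + 1)) != 0.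
    rewrite subr_eq0; apply/eqP; rewrite t_def -exprM exprnP -expfzDr //.
    rewrite (_ : _ + _ = 2 * (D (i + 1) + N%:Z)); last by lia.
    by move=> /q_inj; lia.
  have E2 : t ^+ 2 * q ^ (2 * D i) - q ^ (2 * D (i + 1)) != 0.
    rewrite subr_eq0; apply/eqP; rewrite t_def -exprM exprnP -expfzDr //.
    rewrite (_ : _ + _ = 2 * (D i + N%:Z)); last by lia.
    by move=> /q_inj; lia.
  move: (q ^ (2 * D i)) (q ^ (2 * D (i + 1))) xy0 E1 E2 => a b ab E1 E2.
  have -> : 1 + (t - t^-1) * b / (a - b) * ((t - t^-1) * a / (b - a))
      = (a - t ^+ 2 * b) * (t ^+ 2 * a - b) / (t ^+ 2 * (a - b) ^+ 2).
    by field; rewrite t0 ab /= -opprB oppr_eq0.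
  by rewrite !mulf_neq0 ?invr_eq0 ?mulf_neq0 ?expf_neq0.
have sum0 : twining D i + twining (D \o swap i) i = - (t - t^-1).
  have xy0 := weight_diff_neq0 Di.
  rewrite /twining /= sK sK1.
  move: (q ^ (2 * D i)) (q ^ (2 * D (i + 1))) (t - t^-1) xy0 => a b s ab.
  by have ba : b - a != 0 by [rewrite -opprB oppr_eq0]; field; rewrite ab ba.
have TTy : T i *: (T i *: y) = cst (t - t^-1) *: (T i *: y) + y.
  by rewrite scalerA (ah_quad AH) // scalerDl scale1r -scalerA.
rewrite /intertwine scalerDr TTy -(cst_scaleC cstC _ (T i)).
move: (twining D i) (twining (D \o swap i) i) (T i *: y) sum0 => a b x ab.
rewrite scalerDr [cst b *: (cst a *: y)]scalerA -rmorphM.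
rewrite [cst (1 + _)]rmorphD rmorph1 scalerDl scale1r [b * a]mulrC addrA; congr (_ + _).
by rewrite -addrA -scalerDl -rmorphD ab rmorphN scaleNr addrAC subrr add0r.
Qed.

(** A vector killed by the intertwiner is thus an eigenvector of T_i for - t^(-1),
    the sign action expected for i + 1 below i. *)
Lemma twining_column D i : D i - D (i + 1) = N%:Z -> D i <> D (i + 1) -> twining D i = t^-1.
Proof.
move=> DN Di; have := weight_diff_neq0 Di.
rewrite /twining; have -> : D i = D (i + 1) + N%:Z by lia.
have -> : q ^ (2 * (D (i + 1) + N%:Z)) = q ^ (2 * D (i + 1)) * t ^+ 2.
  by rewrite t_def -exprM exprnP -expfzDr //; congr (q ^ _); lia.
have t0 : t != 0 by rewrite t_def expf_neq0.
have : q ^ (2 * D (i + 1)) != 0 by apply: expfz_neq0.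
move: (q ^ _) => b b0 nz; apply: (mulIf nz); rewrite mulfVK //; field; exact: t0.
Qed.

Lemma intertwine0 D i y : intertwine D i y = 0 -> T i *: y = cst (- twining D i) *: y.
Proof. by move=> /eqP; rewrite addr_eq0 => /eqP ->; rewrite rmorphN scaleNr. Qed.

Lemma has_weight_scale D y c : has_weight y D -> has_weight (cst c *: y) D.
Proof. by move=> yD e; rewrite -(cst_scaleC cstC) yD (cst_scaleC cstC). Qed.
End Intertwiners.

Section Bases.
Variables (K : fieldType) (A : pzRingType) (cst : {rmorphism K -> A}).
Hypothesis cstC : forall c x, cst c * x = x * cst c.
Variables (E : lmodType A) (I : eqType) (v : I -> E).
Hypothesis v_basis : is_basis cst v.

Lemma basis_neq0 i : v i <> 0.
Proof.
move=> vi0; have := v_basis.1 [:: i] (fun=> 1) isT.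
rewrite big_seq1 vi0 scaler0 => /(_ erefl i); rewrite inE eqxx => /(_ isT)/eqP.
by rewrite oner_eq0.
Qed.

Lemma basis_uniq_span x : exists (s : seq I) (c : I -> K),
  uniq s /\ x = \sum_(i <- s) cst (c i) *: v i.
Proof.
have [s [c ->]] := v_basis.2 x; exists (undup s), (fun i => c i *+ count_mem i s).
split; first exact: undup_uniq.
rewrite -[LHS](big_undup_iterop_count _ _ predT (fun i => cst (c i) *: v i)).
by apply: eq_bigr => i _; rewrite rmorphMn -scalerMnl.
Qed.

(** Compare the coefficients of h e *: w and z e *: w on a basis vector that
    occurs in w. *)
Lemma basis_weight (h : int -> A) (z : int -> K) (w : E) :
  (forall i e, exists c, h e *: v i = cst c *: v i) ->
  w <> 0 -> (forall e, h e *: w = cst (z e) *: w) ->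
  exists i, forall e, h e *: v i = cst (z e) *: v i.
Proof.
move=> hv w0 hw; have [s [c [s_uniq wE]]] := basis_uniq_span w.
have [[i [si ci]]|c0] := pselect (exists i, i \in s /\ c i <> 0); last first.
  case: w0; rewrite wE big_seq big1 // => i si.
  have [-> | ci] := eqVneq (c i) 0; first by rewrite rmorph0 scale0r.
  by case: c0; exists i; split=> //; apply/eqP.
exists i => e; have [d dE] := choice (fun i => hv i e).
have /(v_basis.1 s (fun i => c i * (d i - z e)) s_uniq)/(_ i si)/eqP :
    \sum_(i <- s) cst (c i * (d i - z e)) *: v i = 0.
  have := hw e; rewrite {1 2}wE !scaler_sumr => /eqP; rewrite -subr_eq0 -sumrB.
  move=> /eqP hw0; rewrite -[RHS]hw0.
  apply: eq_bigr => j _; rewrite -(cst_scaleC cstC _ (h e)) dE.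
  by rewrite !scalerA -!rmorphM -scalerBl -rmorphB mulrBr (mulrC (z e)).
by rewrite mulf_eq0 subr_eq0 => /orP[/eqP//|/eqP <-].
Qed.
End Bases.

(** * Modules *)

Section ModuleTheory.
Variable A : pzRingType.
Implicit Types V W Q M : lmodType A.

Lemma linear_ofP V W (f : V -> W) :
  (forall u v, f (u + v) = f u + f v) -> (forall a v, f (a *: v) = a *: f v) ->
  exists g : {linear V -> W}, g =1 f.
Proof.
move=> fD fZ.
have fB : zmod_morphism f.
  by move=> u v; rewrite -[- v]scaleN1r fD fZ scaleN1r.
pose fa := GRing.isZmodMorphism.Build V W f fB.
pose fs := GRing.isScalable.Build A V W *:%R f fZ.
pose g : {linear V -> W} := HB.pack f fa fs.
by exists g.
Qed.

Lemma submoduleP V (U : V -> Prop) : U 0 -> (forall u v, U u -> U v -> U (u + v)) ->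
  (forall a u, U u -> U (a *: u)) -> submodule U.
Proof.
move=> U0 UD UZ; split=> // [u v Uu Uv|a u _]; last exact: UZ.
by rewrite -[- v]scaleN1r; apply/UD/UZ.
Qed.

Lemma submoduleD V (U : V -> Prop) u v : submodule U -> U u -> U v -> U (u + v).
Proof.
case=> U0 UB _ Uu Uv; rewrite -[v]opprK; apply: (UB _ _ Uu).
by rewrite -[- v]sub0r; apply: UB.
Qed.

Lemma submoduleZ V (U : V -> Prop) a u : submodule U -> U u -> U (a *: u).
Proof. by case=> _ _ UZ; apply: UZ. Qed.

Lemma cyclic_submodule V (x : V) : submodule (fun u => exists a, u = a *: x).
Proof.
apply: submoduleP => [|_ _ [a ->] [b ->]|b _ [a ->]].
- by exists 0; rewrite scale0r.
- by exists (a + b); rewrite scalerDl.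
- by exists (b * a); rewrite scalerA.
Qed.

Lemma irreducible_cyclic V (x : V) : irreducible V -> x <> 0 -> forall u, exists a, u = a *: x.
Proof.
case=> _ /(_ _ (cyclic_submodule x))[h x0|//]; case: x0; apply: h.
by exists 1; rewrite scale1r.
Qed.

Lemma simple_cyclic V (U : V -> Prop) x : simple_submodule U -> U x -> x <> 0 ->
  forall u, U u -> exists a, u = a *: x.
Proof.
move=> [Um _ Us] Ux x0; have [|h|//] := Us _ (cyclic_submodule x).
  by move=> _ [a ->]; apply: submoduleZ.
by case: x0; apply: h; exists 1; rewrite scale1r.
Qed.

Lemma cyclic_extend V W (x : V) (y : W) : (forall u, exists a, u = a *: x) ->
  (forall a, a *: x = 0 -> a *: y = 0) -> exists g : {linear V -> W}, g x = y.
Proof.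
move=> Vx ann; have [f fE] := choice Vx.
have ext a b : a *: x = b *: x -> a *: y = b *: y.
  move=> /eqP; rewrite -subr_eq0 -scalerBl => /eqP/ann/eqP.
  by rewrite scalerBl subr_eq0 => /eqP.
have [|a u|g gE] := @linear_ofP V W (fun u => f u *: y).
- by move=> u v; rewrite -scalerDl; apply: ext; rewrite scalerDl -!fE.
- by rewrite scalerA; apply: ext; rewrite -scalerA -!fE.
exists g; rewrite gE -[RHS]scale1r; apply: ext.
by rewrite scale1r -fE.
Qed.

Lemma ker_submodule V W (f : {linear V -> W}) : submodule (fun u => f u = 0).
Proof.
apply: submoduleP => [|u v fu fv|a u fu]; first exact: linear0.
- by rewrite linearD fu fv addr0.
- by rewrite linearZ /= fu scaler0.
Qed.

Lemma im_submodule V W (f : {linear V -> W}) : submodule (fun w => exists u, w = f u).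
Proof.
apply: submoduleP => [|_ _ [u ->] [v ->]|a _ [u ->]]; first by exists 0; rewrite linear0.
- by exists (u + v); rewrite linearD.
- by exists (a *: u); rewrite linearZ.
Qed.

(** Schur's lemma: the kernel and the image of f are submodules. *)
Lemma irreducible_bij V W (f : {linear V -> W}) x : irreducible V -> irreducible W ->
  f x <> 0 -> bijective f.
Proof.
move=> [_ irrV] [_ irrW] fx0.
have kf u : f u = 0 -> u = 0.
  by case: (irrV _ (ker_submodule f)) => h; [apply: h | case: fx0; apply: h].
have sf w : exists u, w = f u.
  by case: (irrW _ (im_submodule f)) => h; [case: fx0; apply: h; exists x | apply: h].
have [g gE] := choice sf; exists g => [u|w]; last by rewrite -gE.
by apply/eqP; rewrite -subr_eq0; apply/eqP/kf; rewrite linearB /= -gE subrr.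
Qed.

(** In a shortest expression of v as a sum of elements of simple submodules the
    terms are independent: were h x nonzero for a term x while h v = 0, then x
    would be a multiple of h x, hence could be absorbed in the other terms. *)
Lemma semisimple_independent V (v : V) : semisimple V ->
  exists s : seq V, [/\ v = \sum_(x <- s) x,
    forall x, x \in s -> exists2 U : V -> Prop, simple_submodule U & U x
    & forall x a, x \in s -> a *: v = 0 -> a *: x = 0].
Proof.
move=> /(_ v)[s vE sU]; have [m] := ubnP (size s).
elim: m => // m IHm in s vE sU *; rewrite ltnS => sm.
have [[x [a [xs av ax]]]|dep] := pselect (exists x a, [/\ x \in s, a *: v = 0 & a *: x <> 0]);
  last first.
  exists s; split=> // x a xs av; apply: contrapT => ax; apply: dep.
  by exists x, a.
have [U Us Ux] := sU x xs; have [Um _ _] := Us.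
have [b xE] := simple_cyclic Us (submoduleZ a Um Ux) ax Ux.
pose s' := [seq y - (b * a) *: y | y <- rem x s].
have v' : v = \sum_(y <- s') y.
  have bav : (b * a) *: v = 0 by rewrite -scalerA av scaler0.
  rewrite big_map sumrB -scaler_sumr; move: bav vE; rewrite (perm_big _ (perm_to_rem xs)).
  rewrite big_cons => + vE; rewrite vE scalerDr -scalerA -xE => /eqP.
  by rewrite addr_eq0 => /eqP {1}->; rewrite addrC.
apply: (IHm s') => //.
  move=> _ /mapP[y /mem_rem/sU[W Ws Wy] ->]; exists W => //.
  by have [Wm _ _] := Ws; case: (Wm) => _ WB _; apply: WB => //; apply: submoduleZ.
rewrite size_map size_rem //; apply: leq_trans sm.
by rewrite prednK //; case: (s) xs.
Qed.
End ModuleTheory.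

Definition restr (A B : pzRingType) (iota : {rmorphism B -> A}) (V : lmodType A) : Type := V.

Section RestrictionOfScalars.
Variables (A B : pzRingType) (iota : {rmorphism B -> A}) (V : lmodType A).
Local Notation rV := (restr iota V).
HB.instance Definition _ := GRing.Zmodule.on rV.

Definition restr_scale (b : B) (v : rV) : rV := iota b *: (v : V).

Fact restr_scaleA b c v : restr_scale b (restr_scale c v) = restr_scale (b * c) v.
Proof. by rewrite /restr_scale scalerA rmorphM. Qed.
Fact restr_scale1 : left_id 1 restr_scale.
Proof. by move=> v; rewrite /restr_scale rmorph1 scale1r. Qed.
Fact restr_scaleDr : right_distributive restr_scale +%R.
Proof. by move=> b u v; rewrite /restr_scale scalerDr. Qed.
Fact restr_scaleDl v : {morph restr_scale^~ v : b c / b + c}.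
Proof. by move=> b c; rewrite /restr_scale rmorphD scalerDl. Qed.
HB.instance Definition _ := GRing.Zmodule_isLmodule.Build B rV
  restr_scaleA restr_scale1 restr_scaleDr restr_scaleDl.

Lemma restr_scaleE (b : B) (v : rV) : b *: v = iota b *: (v : V).
Proof. by []. Qed.
End RestrictionOfScalars.

Section InducedModule.
Variables (A B : pzRingType) (iota : {rmorphism B -> A}) (V : lmodType B).
Local Notation ten := (@tensor A B iota V).

Lemma tensorZ a b v : a *: ten b v = ten (a * b) v.
Proof. exact: pi_ind_scale. Qed.

Lemma tensor_bal a b v : ten (a * iota b) v = ten a (b *: v).
Proof. exact/ind_eq/teqv_bal. Qed.

(** Frobenius reciprocity: the map defined on formal sums of tensors respects
    the congruence. *)
Lemma induced_extend (M : lmodType A) (F : V -> M) :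
  (forall u v, F (u + v) = F u + F v) -> (forall b v, F (b *: v) = iota b *: F v) ->
  exists g : {linear induced iota V -> M}, forall a v, g (ten a v) = a *: F v.
Proof.
move=> FD FZ.
pose ev := fix ev (s : tterm A V) : M :=
  match s with TPure a v => a *: F v | TAdd s u => ev s + ev u end.
have ev_eqv s u : teqv iota s u -> ev s = ev u.
  elim=> //=.
  - by move=> s1 u1 w1 _ -> _ ->.
  - by move=> s1 s2 u1 u2 _ -> _ ->.
  - by move=> *; rewrite addrA.
  - by move=> *; rewrite addrC.
  - by move=> v s1; rewrite scale0r add0r.
  - by move=> *; rewrite scalerDl.
  - by move=> *; rewrite FD scalerDr.
  - by move=> *; rewrite FZ scalerA.
have evP s : ev (ind_repr (ind_pi iota s)) = ev s by apply/ev_eqv/ind_repr_eqv.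
have [||g gE] := @linear_ofP A (induced iota V) M (fun x => ev (ind_repr x)).
- elim/induced_ind=> s; elim/induced_ind=> u.
  by rewrite [_ + _](pi_ind_add iota s u) !evP.
- move=> a; elim/induced_ind=> s; rewrite [a *: _](pi_ind_scale iota a s) !evP.
  by elim: s => [b v|s hs u hu] /=; rewrite ?scalerA // hs hu scalerDr.
by exists g => a v; rewrite gE evP.
Qed.

Lemma induced_gen (x : V) : (forall v, exists b, v = b *: x) ->
  forall u : induced iota V, exists a, u = a *: ten 1 x.
Proof.
move=> Vx; elim/induced_ind; elim=> [a v|s [a sE] u [b uE]].
  have [b ->] := Vx v; exists (a * iota b); rewrite tensorZ mulr1.
  exact: esym (tensor_bal a b x).
exists (a + b); rewrite scalerDl -sE -uE.
exact: esym (pi_ind_add iota s u).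
Qed.
End InducedModule.

Section DirectSums.
Variables (A : pzRingType) (I : finType) (V : I -> lmodType A).

Definition dsum_inj (i : I) (x : V i) : dsum V := dfwith (fun j => 0 : V j) x.

Lemma dsum_ext (u v : dsum V) : (forall i, u i = v i) -> u = v.
Proof. exact: functional_extensionality_dep. Qed.

Lemma dsum_injE i (x : V i) : dsum_inj x i = x.
Proof. exact: dfwith_in. Qed.

Lemma dsum_inj0E i j (x : V i) : i != j -> dsum_inj x j = 0.
Proof. exact: dfwith_out. Qed.

Lemma dsum_sumE (T : Type) (s : seq T) (u : T -> dsum V) i :
  (\sum_(k <- s) u k : dsum V) i = \sum_(k <- s) u k i.
Proof. exact: (big_morph (fun w : dsum V => w i)). Qed.

Lemma dsum_injD i (x y : V i) : dsum_inj (x + y) = dsum_inj x + dsum_inj y.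
Proof.
apply: dsum_ext => j; have [<-|ij] := eqVneq i j.
  by rewrite dsum_injE -[RHS]/(_ i + _ i) !dsum_injE.
by rewrite dsum_inj0E // -[RHS]/(_ j + _ j) !dsum_inj0E // addr0.
Qed.

Lemma dsum_injZ i a (x : V i) : dsum_inj (a *: x) = a *: dsum_inj x.
Proof.
apply: dsum_ext => j; have [<-|ij] := eqVneq i j.
  by rewrite dsum_injE -[RHS]/(a *: _ i) dsum_injE.
by rewrite dsum_inj0E // -[RHS]/(a *: _ j) dsum_inj0E // scaler0.
Qed.

Lemma dsum_decomp (u : dsum V) : u = \sum_i dsum_inj (u i).
Proof.
apply: dsum_ext => i; rewrite dsum_sumE (bigD1 i) //= dsum_injE big1 ?addr0 //.
by move=> j ji; rewrite dsum_inj0E.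
Qed.

Lemma dsum_out (W : lmodType A) (f : forall i, {linear V i -> W}) :
  exists g : {linear dsum V -> W}, forall u, g u = \sum_i f i (u i).
Proof.
have [u v|a u|g gE] := @linear_ofP A (dsum V) W (fun u => \sum_i f i (u i)).
- by rewrite -big_split; apply: eq_bigr => i _; apply: (linearD (f i) (u i) (v i)).
- by rewrite scaler_sumr; apply: eq_bigr => i _; apply: (linearZ_LR (f i) a (u i)).
by exists g.
Qed.

Lemma dsum_inj_simple i : irreducible (V i) ->
  simple_submodule (fun u : dsum V => u = dsum_inj (u i)).
Proof.
move=> [[x x0] irrV].
have inj0 : dsum_inj (0 : V i) = 0.
  apply: dsum_ext => j; have [<-|ij] := eqVneq i j; first by rewrite dsum_injE.
  by rewrite dsum_inj0E.
split.
- apply: submoduleP => [|u v uE vE|a u uE].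
  + exact: esym inj0.
  + exact: etrans (congr2 +%R uE vE) (esym (dsum_injD _ _)).
  + exact: etrans (congr1 ( *:%R a) uE) (esym (dsum_injZ _ _)).
- exists (dsum_inj x); first by rewrite dsum_injE.
  by move=> x0'; apply: x0; rewrite -(dsum_injE x) x0'.
move=> W Wm WU; have [W0 WB WZ] := Wm.
have Wim : submodule (fun x : V i => W (dsum_inj x)).
  apply: submoduleP => [|y z Wy Wz|a y Wy]; first by rewrite inj0.
  - by rewrite dsum_injD; apply: submoduleD.
  - by rewrite dsum_injZ; apply: submoduleZ.
have [W_0|W_all] := irrV _ Wim; [left | right] => u Wu.
  have uE := WU u Wu; have ui0 : u i = 0 by apply: W_0; rewrite -uE.
  by rewrite uE ui0 inj0.
by rewrite Wu; apply: W_all.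
Qed.

Lemma dsum_semisimple : (forall i, irreducible (V i)) -> semisimple (dsum V).
Proof.
move=> irrV u; exists [seq dsum_inj (u i) | i <- index_enum I].
  by rewrite big_map; apply: dsum_decomp.
move=> _ /mapP[i _ ->]; exists (fun w : dsum V => w = dsum_inj (w i)).
  exact: dsum_inj_simple.
by rewrite dsum_injE.
Qed.
End DirectSums.

Section CyclicProjectors.
Variables (K : fieldType) (A : pzRingType) (cst : {rmorphism K -> A}) (k : nat).
Variables (z : K) (P : A).
Hypothesis z_prim : k.-primitive_root z.
Hypothesis cstC : forall c x, cst c * x = x * cst c.
Hypothesis Pk : P ^+ k = 1.

(** As P ^+ k = 1, this is the projector onto the eigenspace of P for z ^+ j. *)
Definition eigen_proj (j : nat) : A :=
  cst k%:R^-1 * \sum_(s < k) cst (z ^- (j * s)) * P ^+ s.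

Let k_gt0 : (0 < k)%N := prim_order_gt0 z_prim.
Let k_neq0 : k%:R != 0 :> K := prim_root_natf_neq0 z_prim.

Lemma prim_neq0 : z != 0.
Proof. by rewrite (prim_root_eq0 z_prim) -lt0n. Qed.

Lemma geometric_sum (w : K) : w ^+ k = 1 -> \sum_(s < k) w ^+ s = if w == 1 then k%:R else 0.
Proof.
move=> wk; case: eqVneq => [->|w1].
  under eq_bigr do rewrite expr1n.
  by rewrite sumr_const card_ord.
have := subrX1 w k; rewrite wk subrr => /esym/eqP.
by rewrite mulf_eq0 subr_eq0 (negPf w1) /= => /eqP.
Qed.

Lemma prim_sum s : (s < k)%N -> \sum_(j < k) z ^- (j * s) = if s == 0%N then k%:R else 0.
Proof.
move=> sk; under eq_bigr => j _ do rewrite mulnC exprM -exprVn.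
rewrite geometric_sum; last first.
  by rewrite exprVn -exprM mulnC exprM (prim_expr_order z_prim) expr1n invr1.
by rewrite invr_eq1 -(prim_order_dvd z_prim) /dvdn modn_small.
Qed.

Lemma eigen_proj_sum : \sum_(j < k) eigen_proj j = 1.
Proof.
rewrite -mulr_sumr exchange_big /=.
under eq_bigr => s _ do rewrite -mulr_suml -rmorph_sum prim_sum //.
case: k k_gt0 k_neq0 => // m _ m0; rewrite big_ord_recl big1 => [|i _] /=.
  by rewrite addr0 expr0 mulr1 -rmorphM mulVf ?rmorph1.
by rewrite rmorph0 mul0r.
Qed.

Lemma eigen_projE j : P * eigen_proj j = cst (z ^+ j) * eigen_proj j.
Proof.
rewrite /eigen_proj mulrA -cstC -mulrA [RHS]mulrA -rmorphM mulrC rmorphM -mulrA.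
congr (_ * _); rewrite !mulr_sumr.
pose g s := cst (z ^- (j * s)) * P ^+ s.
have shift s : P * g s = cst (z ^+ j) * g s.+1.
  rewrite /g mulrA -cstC -mulrA -exprS mulrA -rmorphM mulnS exprD invfM mulrA.
  by rewrite mulfV ?mul1r // expf_neq0 // prim_neq0.
under eq_bigr do rewrite shift.
rewrite -!mulr_sumr; congr (_ * _).
case: k k_gt0 Pk (prim_expr_order z_prim) => // m _ Pm zm.
rewrite big_ord_recr [RHS]big_ord_recl /= addrC; congr (_ + _).
by rewrite /g Pm muln0 expr0 mulnC exprM zm expr1n !expr0.
Qed.

Lemma eigen_proj_eigen (E : lmodType A) (x : E) i j : (i < k)%N -> (j < k)%N ->
  P *: x = cst (z ^+ i) *: x -> eigen_proj j *: x = if i == j then x else 0.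
Proof.
move=> ik jk Px.
have Psx s : P ^+ s *: x = cst (z ^+ (i * s)) *: x.
  elim: s => [|s IHs]; first by rewrite muln0 rmorph1.
  rewrite exprSr -scalerA Px scalerA -cstC -scalerA IHs scalerA -rmorphM -exprD.
  by rewrite mulnS.
have zi0 : z ^+ i / z ^+ j != 0 by rewrite mulf_neq0 ?invr_eq0 ?expf_neq0 ?prim_neq0.
rewrite /eigen_proj -scalerA scaler_suml.
under eq_bigr => s _.
  rewrite -scalerA Psx scalerA -rmorphM mulrC !exprM -expr_div_n; over.
rewrite -scaler_suml -rmorph_sum geometric_sum; last first.
  rewrite expr_div_n -!exprM ![(_ * k)%N]mulnC !exprM (prim_expr_order z_prim).
  by rewrite !expr1n divr1.
have -> : (z ^+ i / z ^+ j == 1) = (i == j).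
  rewrite -(inj_eq (mulIf (expf_neq0 j prim_neq0))) mulfVK ?expf_neq0 ?prim_neq0 //.
  by rewrite mul1r (eq_prim_root_expr z_prim) !modn_small.
rewrite scalerA -rmorphM; case: eqP => _; first by rewrite mulVf ?rmorph1 ?scale1r.
by rewrite mulr0 rmorph0 scale0r.
Qed.
End CyclicProjectors.

(** * The double affine Hecke algebra *)

Section IntegerIndices.
Variable n : nat.

(** The number of periods between e and its representative in {1, ..., n}. *)
Definition winding (e : int) : int := ((e - 1) %/ n)%Z.

Lemma winding0 e : 1 <= e <= n%:Z -> winding e = 0.
Proof. by move=> en; rewrite /winding divz_small //; lia. Qed.

Hypothesis n_gt1 : (1 < n)%N.

Lemma modn_bounds (e : int) : 0 <= (e %% n)%Z < n%:Z.
Proof. by rewrite modz_ge0 ?ltz_pmod; lia. Qed.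

Fact idx_subproof (e : int) : (`|(e %% n)%Z| < n)%N.
Proof. by have := modn_bounds e; move: (e %% n)%Z => x; lia. Qed.

Definition idx (e : int) : 'I_n := Ordinal (idx_subproof e).

Lemma idxE e : (idx e)%:Z = (e %% n)%Z.
Proof. by case/andP: (modn_bounds e) => e0 _; apply: gez0_abs. Qed.

Lemma idx_eq e f : (idx e == idx f) = (n %| e - f)%Z.
Proof. by rewrite -eqz_mod_dvd -val_eqE -eqz_nat !idxE. Qed.

Lemma idx_cong e f : (n %| e - f)%Z -> idx e = idx f.
Proof. by rewrite -idx_eq => /eqP. Qed.

Lemma idx_ord (i : 'I_n) : idx i%:Z = i.
Proof. by apply/val_inj/eqP; rewrite -eqz_nat idxE modz_small // ltz_nat ltn_ord. Qed.

Lemma idxS e : idx (e + 1) = ordS (idx e).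
Proof.
apply/val_inj/eqP; rewrite -eqz_nat idxE /= -modz_nat -addn1 PoszD.
by have /= -> := idxE e; rewrite modzDml.
Qed.

Lemma idx_eq0 e : (idx e == 0%N :> nat) = (n %| e)%Z.
Proof. by rewrite -eqz_nat idxE (sameP dvdz_mod0P eqP). Qed.

Lemma residue_repE e : 1 <= e <= n%:Z -> (residue_rep (idx e))%:Z = e.
Proof.
move=> en; rewrite /residue_rep idx_eq0; case: ifP => [/dvdzP[c ce]|].
  have c0 : 0 < c by nia.
  have c1 : c < 2 by nia.
  by rewrite ce (_ : c = 1) ?mul1r //; lia.
move=> ne; rewrite idxE modz_small //.
have : e != n%:Z by apply: contraFneq ne => ->; apply: dvdzz.
lia.
Qed.

Lemma residue_rep_bounds (i : 'I_n) : 1 <= (residue_rep i)%:Z <= n%:Z.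
Proof. by rewrite /residue_rep; case: eqVneq => ?; have := ltn_ord i; lia. Qed.

Lemma idx_residue_rep (i : 'I_n) : idx (residue_rep i)%:Z = i.
Proof.
rewrite /residue_rep; case: eqVneq => [i0|_]; last exact: idx_ord.
rewrite -[RHS]idx_ord i0; apply: idx_cong; rewrite subr0; exact: dvdzz.
Qed.

Lemma windingS e : winding (e + 1) = winding e + (n %| e)%Z%:Z.
Proof.
rewrite /winding addrK; case: (boolP (n %| e)%Z) => [/dvdzP[c ->]|ne].
  have n0 : n%:Z != 0 by lia.
  rewrite mulzK // (_ : c * n - 1 = (c - 1) * n%:Z + (n%:Z - 1)); last by lia.
  by rewrite divzMDl // divz_small; lia.
have n0 : n%:Z != 0 by lia.
rewrite addr0 {2}(divz_eq e n) -addrA divzMDl //.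
have := modn_bounds e; move: ne; move=> /dvdz_mod0P; move: (e %% n)%Z => x x0 xn.
by rewrite [X in _ + X]divz_small ?addr0 //; lia.
Qed.

Lemma residue_rep_winding e : e = (residue_rep (idx e))%:Z + n%:Z * winding e.
Proof.
have en := modn_bounds (e - 1).
have eE : e = ((e - 1) %% n)%Z + 1 + n%:Z * winding e.
  by rewrite /winding -[LHS](subrK 1) {1}(divz_eq (e - 1) n); lia.
rewrite {1}eE; congr (_ + _); rewrite -[LHS]residue_repE; last by lia.
congr (residue_rep _)%:Z; apply: idx_cong; rewrite {2}eE opprD addrA subrr sub0r rpredN.
by rewrite dvdz_mulr ?dvdzz.
Qed.
End IntegerIndices.

Section DahaRelations.
Variables (K : fieldType) (n : nat) (q t r : K).
Hypothesis n_gt1 : (1 < n)%N.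
Hypothesis q_neq0 : q != 0.
Hypothesis t_neq0 : t != 0.
Local Notation H := (daha n q t r).
Local Notation cst := (daha_cst n q t r).
Local Notation rel := (@daha_rel K n q t r).
Local Notation pi := (daha_pi n q t r).
Local Notation T := (@daha_T K n q t r).
Local Notation Z := (@daha_Z K n q t r).
Local Notation ZV := (@daha_ZV K n q t r).
Local Notation idx := (idx n_gt1).

Definition daha_piV : H := palg_gen rel DpiV.
Local Notation piV := daha_piV.

Definition dT (e : int) : H := T (idx e).

(** The extension of Z by Z_{e+n} = q^(2n) Z_e, which gives the relations for
    T_0 and pi the same form as the others. *)
Definition dZ (e : int) : H := cst (q ^ (2 * n%:Z * winding n e)) * Z (idx e).
Definition dY (e : int) : H := cst (q ^ (- (2 * n%:Z * winding n e))) * ZV (idx e).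

Lemma daha_cstC c (x : H) : cst c * x = x * cst c.
Proof. exact: palg_cstC. Qed.

Lemma daha_relE s u : rel s u -> palg_pi rel s = palg_pi rel u.
Proof. by move=> su; apply/palg_eq/peqv_rel. Qed.

Lemma daha_quad i : T i * T i = cst (t - t^-1) * T i + 1.
Proof.
have : (T i + cst (- t)) * (T i + cst t^-1) = cst 0.
  by have := daha_relE (rel_quad q t r i); rewrite palg_piM !palg_piD.
rewrite rmorph0 mulrDl !mulrDr -daha_cstC -rmorphM mulNr mulfV // rmorphN1.
move=> /eqP; rewrite addrA subr_eq0 => /eqP <-.
rewrite -addrA -mulrDl -rmorphD addrCA -mulrDl -rmorphD.
by rewrite addrA subrK subrr rmorph0 mul0r addr0.
Qed.

Lemma daha_TZT i e : (n %| e - i)%Z -> dT i * dZ e * dT i = dZ (e + 1).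
Proof.
move=> ei; have -> : dT i = T (idx e) by congr T; apply/esym/idx_cong.
rewrite /dZ mulrA -daha_cstC -!mulrA; rewrite !(mulrA (T _)).
rewrite idxS windingS //; case: (boolP (n %| e)%Z) => ne.
  have /eqP e0 : idx e == 0%N :> nat by rewrite idx_eq0.
  have -> : T (idx e) * Z (idx e) * T (idx e) = cst (q ^+ (2 * n)) * Z (ordS (idx e)).
    by have := daha_relE (rel_T0Z q t r e0); rewrite !palg_piM.
  rewrite mulrA -rmorphM; congr (cst _ * _).
  by rewrite exprnP -expfzDr //; congr (q ^ _); lia.
have e0 : idx e != 0%N :> nat by rewrite idx_eq0.
have -> : T (idx e) * Z (idx e) * T (idx e) = Z (ordS (idx e)).
  by have := daha_relE (rel_TZT q t r e0); rewrite !palg_piM.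
by rewrite addr0.
Qed.

Lemma daha_ZT i e : (n %| e - i)%Z = false -> (n %| e - i - 1)%Z = false ->
  dZ e * dT i = dT i * dZ e.
Proof.
move=> ei ei1; have TZ : T (idx i) * Z (idx e) = Z (idx e) * T (idx i).
  have := daha_relE (@rel_TZ K n q t r (idx i) (idx e) _ _); rewrite !palg_piM; apply.
    by rewrite idx_eq ei.
  by rewrite -idxS idx_eq opprD addrA ei1.
by rewrite /dZ mulrA -daha_cstC -!mulrA -[dT i]/(T (idx i)) TZ.
Qed.

Lemma daha_piVpi : piV * pi = 1.
Proof. by have := daha_relE (rel_piVpi n q t r); rewrite palg_piM. Qed.

Lemma daha_pin : pi ^+ n = 1.
Proof.
have piE m : pi ^+ m = palg_pi rel (iter m (PMul (PGen Dpi)) (PCst 1)).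
  by elim: m => [|m IHm] //=; rewrite exprS IHm palg_piM.
by rewrite piE; apply: daha_relE (rel_pin n q t r).
Qed.

Lemma daha_conj_pi x y : pi * x * piV = y -> pi * x = y * pi.
Proof. by move=> <-; rewrite -mulrA daha_piVpi mulr1. Qed.

Lemma daha_piT e : pi * dT e = dT (e + 1) * pi.
Proof.
apply: daha_conj_pi; rewrite /dT idxS.
by have := daha_relE (rel_piT q t r (idx e)); rewrite !palg_piM.
Qed.

Lemma daha_piZ e : pi * dZ e = cst (q ^- 2) * dZ (e + 1) * pi.
Proof.
apply: daha_conj_pi; rewrite /dZ mulrA -daha_cstC -!mulrA (mulrA pi).
rewrite idxS windingS //; case: (boolP (n %| e)%Z) => ne.
  have /eqP e0 : idx e == 0%N :> nat by rewrite idx_eq0.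
  have -> : pi * Z (idx e) * piV = cst (q ^+ (2 * n - 2)) * Z (ordS (idx e)).
    by have := daha_relE (rel_piZ0 q t r e0); rewrite !palg_piM.
  rewrite !mulrA -!rmorphM; congr (cst _ * _).
  by rewrite exprnP exprnN -!expfzDr //; congr (q ^ _); lia.
have e0 : idx e != 0%N :> nat by rewrite idx_eq0.
have -> : pi * Z (idx e) * piV = cst (q ^- 2) * Z (ordS (idx e)).
  by have := daha_relE (rel_piZ q t r e0); rewrite !palg_piM.
by rewrite addr0 !mulrA -!rmorphM mulrC.
Qed.

Lemma daha_affine_hecke : affine_hecke n t cst predT dT dZ dY.
Proof.
have TT i : dT i * dT i = cst (t - t^-1) * dT i + 1 by apply: daha_quad.
have ZV0 i : Z i * ZV i = 1 by have := daha_relE (rel_ZZV q t r i); rewrite palg_piM.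
have VZ0 i : ZV i * Z i = 1 by have := daha_relE (rel_ZVZ q t r i); rewrite palg_piM.
have far a b : (n %| a)%Z = false -> (n %| a + b)%Z -> (n %| b)%Z = false.
  by move=> na nab; apply: contraFF na => nb; rewrite -(rpredDr a nb).
split=> //.
- exact: daha_cstC.
- by move=> i j ij; congr T; apply: idx_cong.
- move=> i n2 _ _; have := daha_relE (rel_braid q t r (i := idx i) (j := idx (i + 1)) n2 _).
  by rewrite !palg_piM; apply; rewrite /cyc_adj -idxS eqxx.
- move=> i j ij ij1 ij2 _ _.
  have := daha_relE (rel_TT q t r (i := idx i) (j := idx j) _ _); rewrite !palg_piM; apply.
    move=> n2; have : (n %| i - j)%Z || (n %| i - j - 1)%Z by rewrite n2; lia.
    by rewrite ij ij1.
  rewrite /cyc_adj -!idxS !idx_eq !opprD !addrA ij1 orbF; apply/negP => h.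
  have h' : (n %| i - j + 1)%Z by rewrite -rpredN; apply: dvdz_eqarg h; lia.
  by rewrite h' in ij2.
- move=> i e _ ei; rewrite -(daha_TZT ei); move: (dT i) (dZ e) (TT i) => x z xx.
  by rewrite -[LHS]mulrA xx mulrDr mulr1 [X in X + _]mulrA -daha_cstC -!mulrA addrC.
- move=> i e _ ei; rewrite -(daha_TZT ei); move: (dT i) (dZ e) (TT i) => x z xx.
  by rewrite !mulrA xx !mulrDl mul1r addrAC subrr add0r.
- by move=> i e _; apply: daha_ZT.
- move=> e f; have ZZ : Z (idx e) * Z (idx f) = Z (idx f) * Z (idx e).
    by have := daha_relE (rel_ZZ q t r (idx e) (idx f)); rewrite !palg_piM.
  rewrite /dZ mulrA -(mulrA (cst _)) -(daha_cstC _ (Z (idx e))) !mulrA -rmorphM -mulrA ZZ.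
  rewrite mulrC rmorphM -!mulrA; congr (_ * _).
  by rewrite !mulrA (daha_cstC _ (Z (idx f))).
- move=> e; rewrite /dZ /dY mulrA -(mulrA (cst _)) -(daha_cstC _ (Z (idx e))) !mulrA.
  by rewrite -rmorphM -expfzDr // subrr expr0z rmorph1 mul1r.
- move=> e; rewrite /dZ /dY mulrA -(mulrA (cst _)) -(daha_cstC _ (ZV (idx e))) !mulrA.
  by rewrite -rmorphM -expfzDr // addNr expr0z rmorph1 mul1r.
Qed.

Lemma daha_stable (E : lmodType H) (U : E -> Prop) : (forall u v, U u -> U v -> U (u + v)) ->
  (forall c u, U u -> U (cst c *: u)) -> (forall i u, U u -> U (dT i *: u)) ->
  (forall i u, U u -> U (dZ i *: u)) -> (forall i u, U u -> U (dY i *: u)) ->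
  (forall u, U u -> U (pi *: u)) -> forall h u, U u -> U (h *: u).
Proof.
move=> UD Uc UT UZ UY Upi; elim/palg_ind; elim=> [[i|||i|i]|c|s IHs s' IHs'|s IHs s' IHs'] u Uu.
- by rewrite -(idx_ord n_gt1 i); apply: UT.
- exact: Upi.
- have -> : palg_pi rel (PGen DpiV) = pi ^+ n.-1.
    rewrite -[LHS]/piV -[RHS]mul1r -daha_piVpi -mulrA -exprS prednK ?daha_pin ?mulr1 //.
    exact: ltnW.
  by elim: (n.-1) u Uu => [|m IHm] u Uu; rewrite ?scale1r // exprSr -scalerA; apply/IHm/Upi.
- have -> : palg_pi rel (PGen (DZ i)) = dZ (residue_rep i)%:Z; last exact: UZ.
  rewrite /dZ idx_residue_rep /winding divz_small ?mulr0 ?expr0z ?rmorph1 ?mul1r //.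
  by have := residue_rep_bounds n_gt1 i; lia.
- have -> : palg_pi rel (PGen (DZV i)) = dY (residue_rep i)%:Z; last exact: UY.
  rewrite /dY idx_residue_rep /winding divz_small ?mulr0 ?oppr0 ?expr0z ?rmorph1 ?mul1r //.
  by have := residue_rep_bounds n_gt1 i; lia.
- exact: Uc.
- by rewrite palg_piD scalerDl; apply: UD; [apply: IHs | apply: IHs'].
- by rewrite palg_piM -scalerA; apply/IHs/IHs'.
Qed.
End DahaRelations.

Section HighestWeight.
Variables (K : fieldType) (n N : nat) (q t r : K).
Hypothesis n_gt1 : (1 < n)%N.
Hypothesis N_gt0 : (0 < N)%N.
Hypothesis N_n : (N %| n)%N.
Hypothesis q_neq0 : q != 0.
Hypothesis t_neq0 : t != 0.
Hypothesis q_inj : forall a c : int, q ^ (2 * a) = q ^ (2 * c) -> a = c.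
Local Notation H := (daha n q t r).
Local Notation cst := (daha_cst n q t r).
Local Notation pi := (daha_pi n q t r).
Local Notation dT := (dT q t r n_gt1).
Local Notation dZ := (dZ q t r n_gt1).
Local Notation dY := (dY q t r n_gt1).
Local Notation AH := (daha_affine_hecke r n_gt1 q_neq0 t_neq0).

(** What the vector of R_0 satisfies in all twists of L: the relations that do not
    involve pi. *)
Definition column_vector (E : lmodType H) (x : E) : Prop :=
  (forall e, dZ e *: x = cst (q ^ (2 * diag0 N e)) *: x) /\
  (forall i, ~~ (N %| i)%Z -> dT i *: x = cst (- t^-1) *: x).

Section Powers.
Variables (E : lmodType H) (x : E).
Hypothesis xcol : column_vector x.

Lemma pi_pow_weight m e : dZ (e + m%:Z) *: (pi ^+ m *: x)
  = cst (q ^ (2 * (diag0 N e + m%:Z))) *: (pi ^+ m *: x).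
Proof.
elim: m => [|m IHm]; first by rewrite !addr0 scale1r xcol.1.
have Zpi f : dZ (f + 1) * pi = cst (q ^+ 2) * pi * dZ f.
  rewrite -mulrA daha_piZ //; move: (dZ _) => z.
  by rewrite !mulrA -rmorphM mulfV ?expf_neq0 // rmorph1 mul1r.
rewrite exprS -scalerA -addn1 PoszD addrA scalerA Zpi -scalerA IHm.
rewrite -(cst_scaleC (@daha_cstC _ _ _ _ _)) -(scalerA (cst _) pi) scalerA -rmorphM.
by rewrite exprnP -expfzDr //; congr (cst (q ^ _) *: _); lia.
Qed.

Lemma pi_pow_T m i : dT i * pi ^+ m = pi ^+ m * dT (i - m%:Z).
Proof.
elim: m i => [|m IHm] i; first by rewrite subr0 mulr1 mul1r.
rewrite exprS mulrA; have -> : dT i * pi = pi * dT (i - 1) by rewrite daha_piT subrK.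
by rewrite -mulrA IHm mulrA -addn1 PoszD opprD (addrC (- m%:Z)) addrA.
Qed.

Lemma pi_pow_sign m i : ~~ (N %| i - m%:Z)%Z ->
  dT i *: (pi ^+ m *: x) = cst (- t^-1) *: (pi ^+ m *: x).
Proof.
move=> Nim; rewrite scalerA pi_pow_T -scalerA xcol.2 //.
by rewrite (cst_scaleC (@daha_cstC _ _ _ _ _)).
Qed.

Lemma daha_word_span h : exists l, word_span cst predT dT predT (fun m => pi ^+ m *: x) l (h *: x).
Proof.
set b := (fun m : nat => pi ^+ m *: x).
pose U (u : E) := exists l, word_span cst predT dT predT b l u.
have bw m e (_ : predT m) := pi_pow_weight m e.
apply: (@daha_stable K n q t r n_gt1 q_neq0 t_neq0 E U)
  => [u v [l ul] [l' vl']|c u [l ul]|i u [l ul]|i u [l ul]|i u [l ul]|u [l ul]|].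
- exists (maxn l l'); apply: kspanD; apply: (word_span_leq AH) _ _; [|exact: ul| |exact: vl'].
    exact: leq_maxl.
  exact: leq_maxr.
- by exists l; apply: kspanZ.
- by exists l.+1; apply: (word_span_T AH).
- by exists l; apply: (word_span_Z n_gt1 AH bw).
- by exists l; apply: (word_span_Y n_gt1 AH q_neq0 bw).
- exists l; apply: (kspan_map (@daha_cstC _ _ _ _ _)) ul => _ [w [m [_ _ wl ->]]].
  apply: kspan_gen; exists (map (fun i => i + 1) w), m.+1.
  rewrite size_map all_predT; split=> //; rewrite /b exprS -scalerA !scalerA; congr (_ *: x).
  rewrite -!mulrA !mulrA; congr (_ * _).
  elim: w {wl} => [|i w IHw] /=; first by rewrite mulr1 mul1r.
  by rewrite mulrA daha_piT -mulrA IHw mulrA.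
- exists 1%N; apply: kspan_gen; exists [::], 0%N; split=> //.
  by rewrite /b !scale1r.
Qed.

(** The pi^(N s) x of the key lemma are multiples of x. *)
Lemma column_weight_space (c : K) h : pi ^+ N *: x = cst c *: x ->
  (forall e, dZ e *: (h *: x) = cst (q ^ (2 * diag0 N e)) *: (h *: x)) ->
  exists d, h *: x = cst d *: x.
Proof.
move=> pix hx; have [l xl] := daha_word_span h.
have bw m e (_ : predT m) := pi_pow_weight m e.
have bs m i (_ : predT m) (Nim : ~~ (N %| i - m%:Z)%Z) := conj isT (pi_pow_sign Nim).
have := weight_diag0_top n_gt1 AH N_gt0 q_inj q_neq0 bw bs xl hx.
move: (h *: x) => y {hx xl}; elim=> [{}y [m [_ /dvdnP[d ->] ->]]||u v _ [d ->] _ [d' ->]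
    |c' u _ [d ->]].
- exists (c ^+ d); elim: d => [|d IHd]; first by rewrite mul0n !expr0 rmorph1.
  rewrite mulSn exprD -scalerA IHd -(cst_scaleC (@daha_cstC _ _ _ _ _)) pix.
  by rewrite scalerA -rmorphM -exprSr.
- by exists 0; rewrite rmorph0 scale0r.
- by exists (d + d'); rewrite rmorphD scalerDl.
- by exists (c' * d); rewrite scalerA -rmorphM.
Qed.
End Powers.
End HighestWeight.

(** * The subalgebra H(Z) *)

Lemma affine_hecke_sub (K : fieldType) (n : nat) (t : K) (A B : pzRingType)
    (cst : {rmorphism K -> A}) (J : pred int) (T Z Y : int -> A)
    (iota : {rmorphism B -> A}) (cst' : {rmorphism K -> B}) (J' : pred int)
    (T' Z' Y' : int -> B) :
  affine_hecke n t cst J T Z Y -> injective iota -> (forall c, iota (cst' c) = cst c) ->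
  (forall i, J' i -> J i) -> (forall i j, (n %| i - j)%Z -> J' i = J' j) ->
  (forall i j, (n %| i - j)%Z -> T' i = T' j) ->
  (forall i, J' i -> iota (T' i) = T i) -> (forall e, iota (Z' e) = Z e) ->
  (forall e, iota (Y' e) = Y e) -> affine_hecke n t cst' J' T' Z' Y'.
Proof.
move=> AH inj icst J'J J'per T'per iT iZ iY.
split=> //.
- by move=> c x; apply: inj; rewrite !rmorphM icst (ah_cstC AH).
- move=> i Ji; apply: inj; rewrite rmorphD !rmorphM icst rmorph1 iT //.
  exact: (ah_quad AH (J'J _ Ji)).
- move=> i n2 Ji Ji1; apply: inj; rewrite !rmorphM !iT //.
  exact: (ah_braid AH n2 (J'J _ Ji) (J'J _ Ji1)).
- move=> i j ij ij1 ij2 Ji Jj; apply: inj; rewrite !rmorphM !iT //.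
  exact: (ah_comm AH ij ij1 ij2 (J'J _ Ji) (J'J _ Jj)).
- move=> i e Ji ei; apply: inj; rewrite rmorphD !rmorphM icst iT // !iZ.
  exact: (ah_ZTl AH (J'J _ Ji) ei).
- move=> i e Ji ei; apply: inj; rewrite rmorphB !rmorphM icst iT // !iZ.
  exact: (ah_ZTr AH (J'J _ Ji) ei).
- move=> i e Ji ei ei1; apply: inj; rewrite !rmorphM iT // iZ.
  exact: (ah_ZTn AH (J'J _ Ji) ei ei1).
- by move=> e f; apply: inj; rewrite !rmorphM !iZ (ah_ZZ AH).
- by move=> e; apply: inj; rewrite rmorphM iZ iY rmorph1 (ah_ZY AH).
- by move=> e; apply: inj; rewrite rmorphM iZ iY rmorph1 (ah_YZ AH).
Qed.

Section HZ.
Variables (K : fieldType) (n N : nat) (q t r : K).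
Hypothesis n_gt1 : (1 < n)%N.
Hypothesis N_gt0 : (0 < N)%N.
Hypothesis N_n : (N %| n)%N.
Hypothesis q_neq0 : q != 0.
Hypothesis t_neq0 : t != 0.
Hypothesis q_inj : forall a c : int, q ^ (2 * a) = q ^ (2 * c) -> a = c.
Local Notation H := (daha n q t r).
Local Notation B := (HZ n q t r).
Local Notation cst := (daha_cst n q t r).
Local Notation incl := (HZ_incl n q t r).
Local Notation dT := (dT q t r n_gt1).
Local Notation dZ := (dZ q t r n_gt1).
Local Notation dY := (dY q t r n_gt1).
Local Notation inHZ := (subalg_pred cst (@gen_HZ K n q t r)).

Lemma HZ_incl_inj : injective incl.
Proof. exact: val_inj. Qed.

Fact HZ_cst_zmod : zmod_morphism (@HZ_cst K n q t r).
Proof. by move=> a b; apply: HZ_incl_inj; rewrite rmorphB -[LHS]/(cst (a - b)) rmorphB. Qed.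
Fact HZ_cst_monoid : monoid_morphism (@HZ_cst K n q t r).
Proof.
split=> [|a b]; apply: HZ_incl_inj; first by rewrite rmorph1 -[LHS]/(cst 1) rmorph1.
by rewrite rmorphM -[LHS]/(cst (a * b)) rmorphM.
Qed.
HB.instance Definition _ := GRing.isZmodMorphism.Build K B (@HZ_cst K n q t r) HZ_cst_zmod.
HB.instance Definition _ := GRing.isMonoidMorphism.Build K B (@HZ_cst K n q t r) HZ_cst_monoid.
Definition HZcst : {rmorphism K -> B} := @HZ_cst K n q t r.

(** Used on elements of H(Z) only; the value 0 outside is a default. *)
Definition to_HZ (x : H) : B := insubd 0 x.

Lemma to_HZK x : x \in inHZ -> incl (to_HZ x) = x.
Proof. exact: insubdK. Qed.

Definition hT i := to_HZ (dT i).
Definition hZ e := to_HZ (dZ e).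
Definition hY e := to_HZ (dY e).

Definition finite_index : pred int := fun i => ~~ (n %| i)%Z.

Lemma HZ_mem_T i : finite_index i -> dT i \in inHZ.
Proof.
move=> ni; apply/asboolP/subalg_gen; left; exists (idx n_gt1 i) => //.
by rewrite idx_eq0.
Qed.

Lemma HZ_mem_Z e : dZ e \in inHZ.
Proof.
apply/asboolP/subalg_mul; first exact: subalg_const.
by apply: subalg_gen; right; apply: subalg_gen; exists (idx n_gt1 e); left.
Qed.

Lemma HZ_mem_Y e : dY e \in inHZ.
Proof.
apply/asboolP/subalg_mul; first exact: subalg_const.
by apply: subalg_gen; right; apply: subalg_gen; exists (idx n_gt1 e); right.
Qed.

Lemma HZ_affine_hecke : affine_hecke n t HZcst finite_index hT hZ hY.
Proof.
apply: (affine_hecke_sub (daha_affine_hecke r n_gt1 q_neq0 t_neq0) HZ_incl_inj) => //.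
- by move=> i j ij; rewrite /finite_index -[i](subrK j) (rpredDl j ij).
- by move=> i j ij; rewrite /hT (ah_T (daha_affine_hecke r n_gt1 q_neq0 t_neq0) ij).
- by move=> i Ji; apply/to_HZK/HZ_mem_T.
- by move=> e; apply/to_HZK/HZ_mem_Z.
- by move=> e; apply/to_HZK/HZ_mem_Y.
Qed.

Lemma HZ_stable (E : lmodType B) (U : E -> Prop) : (forall u v, U u -> U v -> U (u + v)) ->
  (forall c u, U u -> U (HZcst c *: u)) ->
  (forall i u, finite_index i -> U u -> U (hT i *: u)) ->
  (forall i u, U u -> U (hZ i *: u)) -> (forall i u, U u -> U (hY i *: u)) ->
  forall h u, U u -> U (h *: u).
Proof.
move=> UD Uc UT UZ UY h.
have toE x y : x = incl y -> to_HZ x = y.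
  by move=> ->; apply: HZ_incl_inj; rewrite to_HZK //; apply: valP.
have in_genZ x : in_subalg cst (@gen_calZ K n q t r) x -> x \in inHZ.
  by move=> xZ; apply/asboolP/subalg_gen; right.
have UB u v : U u -> U v -> U (u - v).
  move=> Uu Uv; apply: (UD _ _ Uu).
  by rewrite -scaleN1r -(rmorphN1 HZcst); apply: Uc.
have closure (S : H -> Prop) : (forall x, in_subalg cst S x -> x \in inHZ) ->
    (forall x, S x -> forall u, U u -> U (to_HZ x *: u)) ->
    forall x, in_subalg cst S x -> forall u, U u -> U (to_HZ x *: u).
  move=> Sin US x; elim=> [{}x /US //|c u Uu|{}x y Sx IHx Sy IHy u Uu|{}x y Sx IHx Sy IHy u Uu].
  - by rewrite (toE _ (HZcst c)) //; apply: Uc.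
  - rewrite (toE _ (to_HZ x - to_HZ y)) ?rmorphB ?to_HZK ?Sin // scalerBl.
    by apply: UB; [apply: IHx | apply: IHy].
  - rewrite (toE _ (to_HZ x * to_HZ y)) ?rmorphM ?to_HZK ?Sin // -scalerA.
    exact/IHx/IHy.
move=> u Uu; rewrite -(toE (incl h) h erefl).
apply: (closure (@gen_HZ K n q t r)) Uu; [by move=> x xH; apply/asboolP| |exact: asboolW (valP h)].
move=> x [[i i0 ->]|xZ] v Uv.
  rewrite -[i](idx_ord n_gt1); apply: UT => //.
  by rewrite /finite_index -(idx_eq0 n_gt1) idx_ord.
have {}closure := closure _ in_genZ; apply: closure xZ v Uv.
move=> {}x [i [->|->]] v Uv.
- have -> : daha_Z q t r i = dZ (residue_rep i)%:Z; last exact: UZ.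
  rewrite /dZ idx_residue_rep /winding divz_small ?mulr0 ?expr0z ?rmorph1 ?mul1r //.
  by have := residue_rep_bounds n_gt1 i; lia.
- have -> : daha_ZV q t r i = dY (residue_rep i)%:Z; last exact: UY.
  rewrite /dY idx_residue_rep /winding divz_small ?mulr0 ?oppr0 ?expr0z ?rmorph1 ?mul1r //.
  by have := residue_rep_bounds n_gt1 i; lia.
Qed.

Definition HZ_column_vector (E : lmodType B) (x : E) : Prop :=
  (forall e, hZ e *: x = HZcst (q ^ (2 * diag0 N e)) *: x) /\
  (forall i, ~~ (N %| i)%Z -> hT i *: x = HZcst (- t^-1) *: x).

(** The key lemma with the single vector b 0 = x, as pi is not in H(Z). *)
Lemma HZ_column_weight_space (E : lmodType B) (x : E) h : HZ_column_vector x ->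
  (forall e, hZ e *: (h *: x) = HZcst (q ^ (2 * diag0 N e)) *: (h *: x)) ->
  exists d, h *: x = HZcst d *: x.
Proof.
move=> [xw xs] hx; have AH := HZ_affine_hecke.
have bw m e : m == 0%N -> hZ (e + m%:Z) *: x = HZcst (q ^ (2 * (diag0 N e + m%:Z))) *: x.
  by move=> /eqP->; rewrite !addr0.
have bs m i : m == 0%N -> ~~ (N %| i - m%:Z)%Z ->
    finite_index i /\ hT i *: x = HZcst (- t^-1) *: x.
  move=> /eqP->; rewrite subr0 => Ni; split; last exact: xs.
  by apply: contra Ni; apply: dvdz_trans.
pose U (u : E) := exists l,
  word_span HZcst finite_index hT (fun m => m == 0%N) (fun _ => x) l u.
have [l hl] : U (h *: x).
  apply: HZ_stable => [u v [l ul] [l' vl']|c u [l ul]|i u Ji [l ul]|i u [l ul]|i u [l ul]|].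
  - exists (maxn l l'); apply: kspanD; apply: (word_span_leq AH) _ _; [|exact: ul| |exact: vl'].
      exact: leq_maxl.
    exact: leq_maxr.
  - by exists l; apply: kspanZ.
  - by exists l.+1; apply: (word_span_T AH).
  - by exists l; apply: (word_span_Z n_gt1 AH bw).
  - by exists l; apply: (word_span_Y n_gt1 AH q_neq0 bw).
  - exists 1%N; apply: kspan_gen; exists [::], 0%N; split=> //.
    by rewrite scale1r.
have := weight_diag0_top n_gt1 AH N_gt0 q_inj q_neq0 bw bs hl hx.
move: (h *: x) => y {hx hl}; elim=> [{}y [m [_ _ ->]]||u v _ [d ->] _ [d' ->]|c' u _ [d ->]].
- by exists 1; rewrite rmorph1 scale1r.
- by exists 0; rewrite rmorph0 scale0r.
- by exists (d + d'); rewrite rmorphD scalerDl.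
- by exists (c' * d); rewrite scalerA -rmorphM.
Qed.
End HZ.

(** * Tableaux *)

Section PeriodicTableaux.
Variables N k : nat.
Hypothesis N_gt0 : (0 < N)%N.
Hypothesis n_gt1 : (1 < k * N)%N.
Implicit Types R : ptab N k.
Local Notation swap := (affine_swap (k * N)).

Lemma ptab_box R e : exists j c, R j c = e.
Proof.
case: (ptabP R) => -[g _ gK] _ _ _ _; exists (g e).1, (g e).2.
exact: (gK e).
Qed.

Lemma ptab_row R j c (d : nat) : R j c + d%:Z <= R j (c + d%:Z).
Proof.
case: (ptabP R) => _ row _ _ _; elim: d => [|d IHd]; first by rewrite !addr0.
have : R j (c + d%:Z) < R j (c + d.+1%:Z) by apply: row; lia.
lia.
Qed.

Lemma ptab_col R (j j' : 'I_N) c : (j <= j')%N -> R j c + j'%:Z <= R j' c + j%:Z.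
Proof.
case: (ptabP R) => _ _ col _ _; case: j' => j'; elim: j' => [|m IHm] mN /= jm.
  by rewrite (_ : j = Ordinal mN) //; apply: val_inj => /=; lia.
have [jm'|jm'] := leqP j m; last first.
  by rewrite (_ : j = Ordinal mN) //; apply: val_inj => /=; lia.
have := IHm (ltnW mN) jm'; have := col (Ordinal (ltnW mN)) (Ordinal mN) c (ltnSn m).
by rewrite /=; lia.
Qed.

Lemma ptab_dist R (j j' : 'I_N) c c' : (j <= j')%N -> c <= c' ->
  R j c + (j'%:Z - j%:Z) + (c' - c) <= R j' c'.
Proof.
move=> jj' cc'; have := ptab_col R c jj'; have := ptab_row R j' c `|c' - c|%N.
by rewrite (_ : c + _ = c'); lia.
Qed.

(** If the diagonals of R' are those of R with i and i + 1 exchanged, then so is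
    R' itself, up to translation: on each diagonal the entries of both
    tableaux are sorted. *)
Lemma ptab_swap R R' i :
  (forall j c j' c', R' j' c' = swap i (R j c) -> Ndiag R' j' c' = Ndiag R j c) ->
  exists s, forall j c, R' j (c - s) = swap i (R j c).
Proof.
move=> RR'; pose o := Ordinal N_gt0.
have [j0 [c0 e0]] := ptab_box R' (swap i (R o 0)).
pose s : int := - o%:Z - (c0 - j0%:Z).
have diagE j c j' c' : R' j' c' = swap i (R j c) -> c' - j'%:Z = c - j%:Z - s.
  move=> /RR'; have := RR' _ _ _ _ e0; rewrite /Ndiag /s /=; nia.
exists s => j c; pose d := c - j%:Z.
have fex (i' : 'I_N) : exists fi' : 'I_N,
    R' fi' (d - s + fi'%:Z) = swap i (R i' (d + i'%:Z)).
  have [j' [c' e']] := ptab_box R' (swap i (R i' (d + i'%:Z))).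
  by exists j'; rewrite -e'; congr (R' _ _); have := diagE _ _ _ _ e'; lia.
(* On the diagonal d of R, f sends the row of an entry to the row in R' of the
   exchanged entry. It is increasing, because entries on a diagonal differ by at
   least 2 and the exchange moves each of them by at most 1. *)
have [f fE] := choice fex.
have f_inc (a b : 'I_N) : (a < b)%N -> (f a < f b)%N.
  move=> ab; rewrite ltnNge; apply/negP => fba.
  have := ptab_dist R' (c := d - s + (f b)%:Z) (c' := d - s + (f a)%:Z) fba.
  rewrite !fE; have := ptab_dist R (c := d + a%:Z) (c' := d + b%:Z) (ltnW ab).
  have := affine_swap_bounds (k * N) i (R a (d + a%:Z)).
  have := affine_swap_bounds (k * N) i (R b (d + b%:Z)).
  have : swap i (R a (d + a%:Z)) <> swap i (R b (d + b%:Z)).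
    move=> /(inv_inj (affine_swapK n_gt1 i)) eab.
    have := ptab_dist R (c := d + a%:Z) (c' := d + b%:Z) (ltnW ab); lia.
  lia.
pose g (a : nat) : int := if insub a is Some a' then (f a')%:Z else 0.
have gE (a : 'I_N) : g a = (f a)%:Z by rewrite /g insubT // => ?; congr (f _)%:Z; apply: val_inj.
have /(_ j (ltn_ord j)) : forall a, (a < N)%N -> g a = a%:Z.
  apply: increasing_id => // [a aN|a aN].
    by rewrite (gE (Ordinal aN)); have := ltn_ord (f (Ordinal aN)); lia.
  rewrite (gE (Ordinal aN)) (gE (Ordinal (ltnW aN))).
  by have := f_inc (Ordinal (ltnW aN)) (Ordinal aN); rewrite /=; lia.
rewrite gE => -[] /val_inj fj; have := fE j; rewrite fj /d.
by rewrite (_ : c - j%:Z - s + j%:Z = c - s) ?subrK //; lia.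
Qed.

(** Entries differ at least by the distance of their boxes (ptab_dist), so that
    i and i + 1 on neighbouring diagonals are in adjacent boxes; exchanging them
    violates standardness. *)
Lemma ptab_swap_adjacent R R' i j c j' c' : R j c = i -> R j' c' = i + 1 ->
  `|Ndiag R j' c' - Ndiag R j c| = N%:Z ->
  ~ (forall j c j' c', R' j' c' = swap i (R j c) -> Ndiag R' j' c' = Ndiag R j c).
Proof.
move=> Rjc Rjc' dd /ptab_swap[s sE].
have E1 : R' j (c - s) = i + 1 by rewrite sE Rjc affine_swapL ?subrr.
have E2 : R' j' (c' - s) = i.
  rewrite sE Rjc' affine_swapR ?addrK // (_ : i + 1 - i - 1 = 0); [exact: dvdz0 | lia].
have {}dd : `|(c' - j'%:Z) - (c - j%:Z)| = 1 by move: dd; rewrite /Ndiag; nia.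
have [jj'|j'j] := leqP j j'; last first.
  have [cc'|/ltW c'c] := lerP c c'.
    have cE : c = c' by lia.
    by have := ptab_dist R (ltnW j'j) (lexx c'); rewrite Rjc' -cE Rjc; lia.
  by have := ptab_dist R (ltnW j'j) c'c; lia.
have [cc'|c'c] := lerP c c'; last first.
  have jE : j' = j by apply: val_inj => /=; lia.
  by have := ptab_dist R (leqnn j) (ltW c'c); rewrite Rjc -jE Rjc'; lia.
have := ptab_dist R jj' cc'; have := @ptab_dist R' j j' (c - s) (c' - s) jj'.
lia.
Qed.

Lemma ptab_swap_diag R i j c j' c' : R j c = i -> R j' c' = i + 1 ->
  Ndiag R j c <> Ndiag R j' c'.
Proof.
move=> Rjc Rjc'; rewrite /Ndiag => dd.
have {}dd : c - j%:Z = c' - j'%:Z by nia.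
have [jj'|j'j] := leqP j j'.
  have cc' : c <= c' by lia.
  have := ptab_dist R jj' cc'; rewrite Rjc Rjc' => h.
  have jE : j' = j by apply: val_inj => /=; lia.
  by move: Rjc'; rewrite jE (_ : c' = c) ?Rjc; lia.
have c'c : c' <= c by lia.
by have := ptab_dist R (ltnW j'j) c'c; lia.
Qed.

Lemma Ndiag_periodic R j c d : Ndiag R j (c + k%:Z * d) = Ndiag R j c + (k * N)%N%:Z * d.
Proof. by rewrite /Ndiag PoszM; lia. Qed.

Lemma ptab_periodic R j c d : R j (c + k%:Z * d) = R j c + (k * N)%N%:Z * d.
Proof.
case: (ptabP R) => _ _ _ per _.
have pos (m : nat) x : R j (x + k%:Z * m%:Z) = R j x + (k * N)%N%:Z * m%:Z.
  elim: m => [|m IHm]; first by rewrite !mulr0 !addr0.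
  rewrite -addn1 PoszD !mulrDr !mulr1 !addrA per IHm; lia.
case: (lerP 0 d) => d0; first by have := pos `|d|%N c; rewrite gez0_abs.
have := pos `|d|%N (c + k%:Z * d); rewrite ltz0_abs // (_ : c + _ + _ = c); last by lia.
by move=> ->; lia.
Qed.

Lemma R0_entry_sum :
  \sum_(j < N) \sum_(1 <= c < k.+1) R0_entry j c%:Z = ((k * N) * (k * N).+1 %/ 2)%N%:Z.
Proof.
have sumN m : (\sum_(j < m) j.+1%:Z) * 2 = m%:Z * (m%:Z + 1).
  by elim: m => [|m IHm]; rewrite ?big_ord0 // big_ord_recr /= mulrDl IHm; lia.
have twice m : (\sum_(1 <= c < m.+1) \sum_(j < N) R0_entry j c%:Z) * 2
    = (m * N)%N%:Z * ((m * N)%N%:Z + 1).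
  elim: m => [|m IHm]; first by rewrite big_geq.
  rewrite big_nat_recr //= mulrDl IHm.
  have -> : \sum_(j < N) R0_entry j m.+1%:Z = (m * N)%N%:Z * N%:Z + \sum_(j < N) j.+1%:Z.
    rewrite /R0_entry big_split /= sumr_const card_ord -mulr_natr; congr (_ + _).
    by rewrite -addn1 PoszD addrK PoszM natz.
  rewrite mulrDl sumN mulSn PoszD; lia.
rewrite exchange_big /=; apply: (mulIf (_ : 2%:Z != 0)) => //; rewrite twice.
have dv : (2 %| (k * N) * (k * N).+1)%N by rewrite dvdn2 oddM oddS; case: odd.
by rewrite -[RHS]PoszM divnK //; move: (k * N)%N => m; lia.
Qed.

Lemma Ndiag_R0 j c : Ndiag (R0 k N_gt0) j c = diag0 N (R0_entry j c).
Proof.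
rewrite /Ndiag /ptab_p R0_entry_sum subrr div0z addr0 /R0_entry.
rewrite -addn1 PoszD addrA diag0E //; last by have := ltn_ord j; lia.
by congr (_ * _); lia.
Qed.

Lemma ex_diag_fun R : exists D : int -> int, forall j c, D (R j c) = Ndiag R j c.
Proof.
case: (ptabP R) => -[g gK _] _ _ _ _; exists (fun e => Ndiag R (g e).1 (g e).2) => j c.
by rewrite (gK (j, c)).
Qed.

(** Ndiag as a function of the entry: the weight of the vector of R. *)
Definition diag_fun R : int -> int := sval (cid (ex_diag_fun R)).

Lemma diag_funE R j c : diag_fun R (R j c) = Ndiag R j c.
Proof. exact: (svalP (cid (ex_diag_fun R))). Qed.

Lemma diag_fun_periodic R e d :
  diag_fun R (e + (k * N)%N%:Z * d) = diag_fun R e + (k * N)%N%:Z * d.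
Proof.
have [j [c <-]] := ptab_box R e.
by rewrite -ptab_periodic !diag_funE Ndiag_periodic.
Qed.

Lemma diag_fun_neq R i : diag_fun R i <> diag_fun R (i + 1).
Proof.
have [j [c e]] := ptab_box R i; have [j' [c' e']] := ptab_box R (i + 1).
by rewrite -e' -{1}e !diag_funE; apply: ptab_swap_diag e e'.
Qed.

(** ptab_swap_adjacent for weights: exchanging two adjacent entries leads out of
    the weights of periodic tableaux. *)
Lemma diag_fun_swap R R' i : `|diag_fun R i - diag_fun R (i + 1)| = N%:Z ->
  ~ (diag_fun R' =1 diag_fun R \o swap i).
Proof.
have [j [c e]] := ptab_box R i; have [j' [c' e']] := ptab_box R (i + 1).
rewrite -{1}e -e' !diag_funE distrC => DN RR'; case: (ptab_swap_adjacent e e' DN (R' := R')).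
move=> j1 c1 j2 c2 e2; rewrite -diag_funE RR' /= e2 affine_swapK // diag_funE.
by [].
Qed.

Lemma diag_fun_R0 : diag_fun (R0 k N_gt0) =1 diag0 N.
Proof.
by move=> e; have [j [c <-]] := ptab_box (R0 k N_gt0) e; rewrite diag_funE Ndiag_R0.
Qed.
End PeriodicTableaux.

Section FiniteTableaux.
Variables N k : nat.
Hypothesis N_gt0 : (0 < N)%N.
Hypothesis k_gt0 : (0 < k)%N.
Hypothesis n_gt1 : (1 < k * N)%N.
Local Notation n := (k * N)%N.
Local Notation swap := (affine_swap n).
Local Notation idx := (idx n_gt1).

Lemma diag0_winding e : diag0 N e = diag0 N (residue_rep (idx e))%:Z + n%:Z * winding n e.
Proof.
by rewrite {1}[e](residue_rep_winding n_gt1) PoszM mulrAC diag0_addMr.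
Qed.

Definition R0_syt_fun : {ffun 'I_N * 'I_k -> 'I_n} :=
  [ffun b : 'I_N * 'I_k => idx ((b.2 : nat)%:Z * N%:Z + (b.1 : nat)%:Z + 1)].

Lemma box_bounds (j : 'I_N) (m : 'I_k) : 1 <= m%:Z * N%:Z + j%:Z + 1 <= n%:Z.
Proof. by have := ltn_ord j; have := ltn_ord m; rewrite PoszM; nia. Qed.

Lemma R0_sytE (j : 'I_N) (m : 'I_k) :
  (residue_rep (R0_syt_fun (j, m)))%:Z = m%:Z * N%:Z + j%:Z + 1.
Proof. by rewrite ffunE residue_repE // box_bounds. Qed.

Fact R0_is_syt : is_syt R0_syt_fun.
Proof.
have inj : injective R0_syt_fun.
  move=> [j m] [j' m'] e; have := R0_sytE j m; rewrite e R0_sytE => {}e.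
  have jN := ltn_ord j; have j'N := ltn_ord j'.
  have mm : m'%:Z = m%:Z by case: (ltrgtP m'%:Z m%:Z) => // ?; nia.
  by congr (_, _); apply: val_inj; move: e; rewrite mm /=; lia.
apply/and4P; split.
- exact/injectiveP.
- have bij : bijective R0_syt_fun.
    apply: inj_card_bij => //; by rewrite card_prod !card_ord mulnC.
  case: bij => g gK Kg; apply/forallP => i; apply/existsP; exists (g i).
  by rewrite Kg.
- apply/forallP => j; apply/forallP => m; apply/forallP => m'; apply/implyP => mm'.
  by rewrite -ltz_nat !R0_sytE; nia.
- apply/forallP => j; apply/forallP => j'; apply/forallP => m; apply/implyP => jj'.
  by rewrite -ltz_nat !R0_sytE; lia.
Qed.

Definition R0_syt : syt N k := exist _ R0_syt_fun R0_is_syt.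

(** Such an S would have, in the column of i, entries that become those of the
    column of R_0 once i and i + 1 are exchanged (column_of_diagonals), with i + 1
    above i. The case of a column that the exchange unsorts is excluded by the
    diagonals of i and i + 1. *)
Lemma syt_swap_adjacent (S : syt N k) i : 1 <= i <= n%:Z -> ~~ (N %| i)%Z ->
  ~ (forall j m, diag0 N (swap i (residue_rep (val S (j, m)))%:Z) = N%:Z * (m%:Z - j%:Z)).
Proof.
move=> i_n Ni diagS; have [c0 [j0 [j0N iE]]] := column_coords N_gt0 i.
have j0N1 : j0 + 1 < N%:Z.
  suff : j0 + 1 != N%:Z by lia.
  by apply: contraNneq Ni => j0E; rewrite iE -addrA j0E rpredD ?dvdz_mull ?dvdzz.
have c0k : 0 <= c0 < k%:Z.
  by move: i_n; rewrite iE PoszM => i_n; apply/andP; split; nia.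
have m0k : (`|c0| < k)%N by lia.
pose m0 := Ordinal m0k.
pose e (a : nat) : int :=
  if insub a is Some j then (residue_rep (val S (j, m0)))%:Z else 0.
have eE (a : nat) (aN : (a < N)%N) : e a = (residue_rep (val S (Ordinal aN, m0)))%:Z.
  by rewrite /e insubT.
have e_bounds a : (a < N)%N -> 1 <= e a <= n%:Z.
  by move=> aN; rewrite eE; apply: residue_rep_bounds n_gt1 _.
have e_diag a : (a < N)%N -> diag0 N (swap i (e a)) = N%:Z * (c0 - a%:Z).
  by move=> aN; rewrite eE diagS /= gez0_abs //; lia.
have e_inc a : (a.+1 < N)%N -> e a < e a.+1.
  move=> aN; rewrite (eE _ aN) (eE _ (ltnW aN)) ltz_nat.
  have /and4P[_ _ _ /forallP/(_ (Ordinal (ltnW aN)))/forallP/(_ (Ordinal aN))] := valP S.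
  by move=> /forallP/(_ m0)/implyP; apply.
have [[a [aN desc]]|inc] := pselect (exists a, (a.+1 < N)%N /\ swap i (e a.+1) <= swap i (e a)).
  have ea := e_inc a aN.
  have neq : swap i (e a.+1) <> swap i (e a).
    by move=> /(inv_inj (affine_swapK n_gt1 i)); lia.
  have sa := affine_swap_bounds (k * N) i (e a); have sa1 := affine_swap_bounds (k * N) i (e a.+1).
  have saE : swap i (e a) = e a + 1 by lia.
  have ea1 : e a.+1 = e a + 1 by lia.
  have nea : (n %| e a - i)%Z.
    by move: saE; rewrite /affine_swap; case: ifP => // _; case: ifP => _; lia.
  have eai : e a = i.
    have := e_bounds a (ltnW aN) => ean; have /dvdzP[d dE] := nea.
    have : d = 0 by nia.
    by move: dE => /[swap] ->; lia.
  have := e_diag _ (ltnW aN); rewrite saE eai.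
  have := e_diag _ aN; rewrite ea1 eai.
  have -> : swap i (i + 1) = i.
    by rewrite affine_swapR ?addrK // (_ : i + 1 - i - 1 = 0); [exact: dvdz0 | lia].
  rewrite iE diag0E // (_ : c0 * N + j0 + 1 + 1 = c0 * N%:Z + (j0 + 1) + 1); last by lia.
  by rewrite diag0E //; [nia | lia].
have xE := @column_of_diagonals N N_gt0 (fun a => swap i (e a)) c0 _ e_diag.
have {}xE a : (a < N)%N -> swap i (e a) = c0 * N%:Z + a%:Z + 1.
  apply: xE => b bN; rewrite ltNge; apply/negP => desc; apply: inc.
  by exists b.
have j0a : (`|j0|.+1 < N)%N by lia.
have := xE _ (ltnW j0a); have := xE _ j0a.
rewrite -addn1 PoszD gez0_abs; last by lia.
rewrite -iE (_ : c0 * N + (j0 + 1) + 1 = i + 1); last by lia.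
move=> /(congr1 (swap i)) + /(congr1 (swap i)).
rewrite !affine_swapK // affine_swapR; first last.
- by rewrite (_ : i + 1 - i - 1 = 0); [exact: dvdz0 | lia].
- by [].
rewrite affine_swapL ?subrr // addn1; have := e_inc _ j0a; lia.
Qed.
End FiniteTableaux.

(** * Column vectors and twists *)

Section Main.
Variables (K : fieldType) (N k : nat) (q t r : K).
Local Notation n := (k * N)%N.
Hypothesis n_gt1 : (1 < n)%N.
Hypothesis N_gt0 : (0 < N)%N.
Hypothesis k_gt0 : (0 < k)%N.
Hypothesis q_neq0 : q != 0.
Hypothesis q_inj : forall a c : int, q ^ (2 * a) = q ^ (2 * c) -> a = c.
Hypothesis t_def : t = q ^+ N.
Local Notation H := (daha n q t r).
Local Notation B := (HZ n q t r).
Local Notation cst := (daha_cst n q t r).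
Local Notation incl := (HZ_incl n q t r).
Local Notation HZcst := (@HZcst K n q t r).
Local Notation pi := (daha_pi n q t r).
Local Notation dT := (@dT K n q t r n_gt1).
Local Notation dZ := (@dZ K n q t r n_gt1).
Local Notation dY := (@dY K n q t r n_gt1).
Local Notation hT := (@hT K n q t r n_gt1).
Local Notation hZ := (@hZ K n q t r n_gt1).
Local Notation hY := (@hY K n q t r n_gt1).
Local Notation has_weight := (has_weight q cst dZ).
Local Notation intertwine := (intertwine q t cst dT).
Local Notation column_vector := (column_vector N n_gt1).
Local Notation swap := (affine_swap n).
Local Notation R0 := (R0 k N_gt0).
Local Notation cstC := (@daha_cstC K n q t r).

Fact t_neq0 : t != 0. Proof. by rewrite t_def expf_neq0. Qed.
Fact N_dvd_n : (N %| n)%N. Proof. exact: dvdn_mull. Qed.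
Local Notation AH := (daha_affine_hecke r n_gt1 q_neq0 t_neq0).

Section Supported.
Variable M : lmodType H.

(** The property of L on which the vanishing of intertwiners rests; it passes to
    the modules with the support of L. *)
Definition tableau_weights : Prop := forall (w : M) D, w <> 0 ->
  quasi_periodic n D -> has_weight w D -> exists R : ptab N k, D =1 diag_fun R.

(** The image would have the weight of R with two adjacent entries exchanged. *)
Lemma adjacent_intertwine (w : M) (R : ptab N k) i : tableau_weights ->
  has_weight w (diag_fun R) -> `|diag_fun R i - diag_fun R (i + 1)| = N%:Z ->
  intertwine (diag_fun R) i w = 0.
Proof.
move=> Mw wR DN; apply: contrapT => /Mw h.
have Rper : quasi_periodic n (diag_fun R) by move=> e d; apply: diag_fun_periodic.
have [|R' R'E] := h _ (quasi_periodic_swap i Rper).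
  by apply: (intertwine_weight n_gt1 q_neq0 q_inj AH) => //; apply: diag_fun_neq.
by apply: (diag_fun_swap N_gt0 n_gt1 DN (R' := R')) => e; rewrite -R'E.
Qed.

(** The entries i and i + 1 of a column of R_0 are on neighbouring diagonals, so
    that the intertwiner kills w, which fixes the action of T_i. *)
Lemma supported_column_vector (w : M) : tableau_weights -> has_weight w (diag0 N) ->
  column_vector w.
Proof.
move=> Mw w0; split=> // i Ni.
have R0E := diag_fun_R0 N_gt0 n_gt1 (k := k).
have wR : has_weight w (diag_fun R0) by move=> e; rewrite R0E.
have DN : diag_fun R0 i - diag_fun R0 (i + 1) = N%:Z by rewrite !R0E diag0_step.
have /intertwine0 -> : intertwine (diag_fun R0) i w = 0.
  by apply: adjacent_intertwine => //; rewrite DN.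
by rewrite (twining_column n_gt1 q_neq0 t_def q_inj DN) //; apply: diag_fun_neq.
Qed.
End Supported.

(** In the submodule of the direct sum generated by (x, y) the only vectors of
    weight diag0 are the multiples of (x, y), which excludes (0, y). If the
    annihilator of x did not kill y, it would map y onto its simple submodule and
    produce (0, y). *)
Lemma column_glue (S Q : lmodType H) (x : S) (y : Q) (U : Q -> Prop) c :
  x <> 0 -> column_vector x -> column_vector y ->
  pi ^+ N *: x = cst c *: x -> pi ^+ N *: y = cst c *: y ->
  simple_submodule U -> U y -> forall h, h *: x = 0 -> h *: y = 0.
Proof.
move=> x0 [xw xs] [yw ys] xpi ypi [Um _ Us] Uy.
pose W (u : Q) := exists2 h, h *: x = 0 & u = h *: y.
have Wm : submodule W.
  apply: submoduleP => [|_ _ [h hx ->] [h' hx' ->]|b _ [h hx ->]].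
  - by exists 0; rewrite scale0r.
  - by exists (h + h'); rewrite scalerDl ?hx ?hx' ?addr0.
  - by exists (b * h); rewrite -scalerA ?hx ?scaler0.
have WU u : W u -> U u by case=> h _ ->; apply: submoduleZ.
have [W0|UW] := Us W Wm WU; first by move=> h hx; apply: W0; exists h.
have [h hx yE] := UW y Uy.
have xy_col : column_vector ((x, y) : (S * Q)%type).
  by split=> i *; congr (_, _); [apply: xw | apply: yw | apply: xs | apply: ys].
have hxy : h *: ((x, y) : (S * Q)%type) = (0, y) by rewrite -{1}hx {2}yE.
have [||d] := column_weight_space N_gt0 N_dvd_n q_neq0 t_neq0 q_inj xy_col (c := c) (h := h).
- by congr (_, _).
- by rewrite hxy => e; congr (_, _); [rewrite !scaler0 | apply: yw].
rewrite hxy => -[/esym dx yd] h' _; have : d = 0.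
  by apply/eqP/negPn/negP => d0; apply: x0; apply: (cst_scaleI (cst := cst)) dx.
by move=> d0; rewrite yd d0 rmorph0 scale0r scaler0.
Qed.

Section Twists.
Variable b : nroot K n.
Local Notation tw := (@pi_twist K n q t r b).

Lemma pi_twist_term s : tw (palg_pi (@daha_rel K n q t r) s) = peval (@pi_twist_gen K n q t r b) s.
Proof. exact: palg_end_pi. Qed.

Lemma pi_twist_cst c : tw (cst c) = cst c.
Proof. exact: pi_twist_term. Qed.

Lemma pi_twist_T i : tw (dT i) = dT i.
Proof. exact: pi_twist_term. Qed.

Lemma pi_twist_Z e : tw (dZ e) = dZ e.
Proof. by rewrite /dZ rmorphM pi_twist_cst; congr (_ * _); apply: pi_twist_term. Qed.

Lemma pi_twist_pi : tw (pi ^+ N) = cst (nroot_val b ^+ N) * pi ^+ N.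
Proof.
rewrite rmorphXn; have -> : tw pi = cst (nroot_val b) * pi by apply: pi_twist_term.
by rewrite exprMn_comm ?rmorphXn //; apply: cstC.
Qed.

Lemma pi_twist_HZ (h : B) : tw (incl h) = incl h.
Proof.
have fix_alg (S : H -> Prop) : (forall x, S x -> tw x = x) ->
    forall x, in_subalg cst S x -> tw x = x.
  move=> tS x; elim=> [{}x /tS //|c|{}x y _ IHx _ IHy|{}x y _ IHx _ IHy].
  - exact: pi_twist_cst.
  - by rewrite rmorphB IHx IHy.
  - by rewrite rmorphM IHx IHy.
apply: (fix_alg (@gen_HZ K n q t r)); last exact: asboolW (valP h).
move=> x [[i _ ->]|]; first exact: pi_twist_term.
by apply: fix_alg => _ [i [->|->]]; apply: pi_twist_term.
Qed.

Lemma pi_twist_surj x : exists y, tw y = x.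
Proof.
have b0 := nroot_neq0 b.
elim/palg_ind: x; elim=> [g|c|s [x xE] s' [y yE]|s [x xE] s' [y yE]].
- case: g => [i|||i|i].
  + by exists (palg_gen _ (DT i)); apply: pi_twist_term.
  + exists (cst (nroot_val b)^-1 * palg_gen _ Dpi); rewrite rmorphM pi_twist_cst pi_twist_term /=.
    by rewrite mulrA -rmorphM mulVf // rmorph1 mul1r.
  + exists (cst (nroot_val b) * palg_gen _ DpiV); rewrite rmorphM pi_twist_cst pi_twist_term /=.
    by rewrite mulrA -rmorphM mulfV // rmorph1 mul1r.
  + by exists (palg_gen _ (DZ i)); apply: pi_twist_term.
  + by exists (palg_gen _ (DZV i)); apply: pi_twist_term.
- by exists (cst c); apply: pi_twist_cst.
- by exists (x + y); rewrite rmorphD xE yE palg_piD.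
- by exists (x * y); rewrite rmorphM xE yE palg_piM.
Qed.

Variable L : lmodType H.

Lemma pitwist_scale h (w : L) : h *: to_pitwist b w = to_pitwist b (tw h *: w).
Proof. by []. Qed.

Lemma pitwist_irreducible : irreducible L -> irreducible (pitwist b L).
Proof.
move=> [[w w0] irrL]; split; first by exists w.
move=> U [U0 UB UZ]; apply: (irrL U); split=> // h u _ Uu.
by have [h' <-] := pi_twist_surj h; apply: (UZ h').
Qed.

Lemma pitwist_column (w : L) : column_vector w -> column_vector (to_pitwist b w).
Proof.
by move=> [ww ws]; split=> [e|i Ni]; rewrite !pitwist_scale pi_twist_cst
  ?pi_twist_Z ?pi_twist_T ?ww ?ws.
Qed.

Lemma pitwist_pi (w : L) c : pi ^+ N *: w = cst c *: w ->
  pi ^+ N *: to_pitwist b w = cst (nroot_val b ^+ N * c) *: to_pitwist b w.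
Proof.
by move=> wc; rewrite !pitwist_scale pi_twist_pi pi_twist_cst -scalerA wc scalerA -rmorphM.
Qed.

Lemma pitwist_support z : weight_support (pitwist b L) z <-> weight_support L z.
Proof.
have tZ i : tw (daha_Z q t r i) = daha_Z q t r i by apply: pi_twist_term.
split=> -[z0 [w w0 ww]]; split=> //; exists w => // i.
  have := ww i; rewrite (pitwist_scale _ w) (pitwist_scale _ w) tZ pi_twist_cst; exact.
by have := ww i; rewrite -{1}tZ -{1}(pi_twist_cst (z i)).
Qed.
End Twists.

(** * The modules L and Rect *)

Local Notation AHB := (HZ_affine_hecke r n_gt1 q_neq0 t_neq0).
Local Notation idx := (idx n_gt1).

Section Lbar.
Variables (L : lmodType H) (v : Pbar N k -> L).
Hypothesis L_Lbar : is_Lbar N_gt0 v.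

Lemma Lbar_cyclic_neq0 i : v i <> 0.
Proof. by case: L_Lbar => _ v_basis _ _; apply: (basis_neq0 v_basis). Qed.

Lemma Lbar_weight R : has_weight (v (ptab_class R)) (diag_fun R).
Proof.
case: L_Lbar => _ _ v_wt _ e; have [j [c RE]] := ptab_box R e.
have RE' : R j (c - k%:Z * winding n e) = (residue_rep (idx e))%:Z.
  by rewrite -mulrN ptab_periodic // RE {1}[e](residue_rep_winding n_gt1) mulrN addrK.
rewrite /dZ -scalerA (v_wt _ _ _ _ RE') scalerA -rmorphM -expfzDr //.
rewrite -[in RHS]RE diag_funE -mulrN Ndiag_periodic //; congr (cst (q ^ _) *: _); lia.
Qed.

Lemma Lbar_tableau_weights : tableau_weights L.
Proof.
case: (L_Lbar) => _ v_basis _ _ w D w0 _ wD.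
have classP (i : Pbar N k) : exists R, i = ptab_class R.
  by exists (repr (i : {eq_quot (translate_equiv N k)})%qT); apply/esym/reprK.
have [||i iD] := basis_weight cstC v_basis (h := dZ) (z := fun e => q ^ (2 * D e)) (w := w) _ w0.
- move=> i e; have [R ->] := classP i.
  by exists (q ^ (2 * diag_fun R e)); apply: Lbar_weight.
- exact: wD.
have [R iR] := classP i; exists R => e; apply/q_inj.
apply: (cst_scale_inj (cst := cst) (@Lbar_cyclic_neq0 i)).
by rewrite -[LHS]iD iR; apply: Lbar_weight.
Qed.

Lemma Lbar_column : column_vector (v (ptab_class R0)).
Proof.
apply: supported_column_vector Lbar_tableau_weights _ => // e.
by rewrite Lbar_weight diag_fun_R0.
Qed.
End Lbar.

Section Rect.
Variables (V : lmodType B) (vV : syt N k -> V).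
Hypothesis V_Rect : is_Rect vV.
Local Notation Rsyt := (R0_syt N_gt0 k_gt0 n_gt1).

Lemma hZ_winding e : hZ e = HZcst (q ^ (2 * n%:Z * winding n e)) * hZ (residue_rep (idx e))%:Z.
Proof.
apply: HZ_incl_inj; rewrite rmorphM !to_HZK ?HZ_mem_Z //.
rewrite -[incl (HZcst _)]/(cst _) /dZ idx_residue_rep (winding0 (residue_rep_bounds n_gt1 _)).
by rewrite mulr0 expr0z rmorph1 mul1r.
Qed.

Lemma Rect_weight (S : syt N k) j m : hZ (residue_rep (val S (j, m)))%:Z *: vV S
  = HZcst (q ^ (2 * (N%:Z * (m%:Z - j%:Z)))) *: vV S.
Proof.
have tE e : t ^ e = q ^ (N%:Z * e) by rewrite t_def exprnP exprz_exp.
case: V_Rect => _ _ _ wt; rewrite (wt S j m).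
  by rewrite -[HZ_cst _ _ _ _ _]/(HZcst _) tE; congr (HZcst (q ^ _) *: _); lia.
rewrite -[\val _]/(incl _) to_HZK ?HZ_mem_Z //.
by rewrite /dZ idx_residue_rep (winding0 (residue_rep_bounds n_gt1 _)) mulr0 expr0z rmorph1 mul1r.
Qed.

Lemma syt_surj (S : syt N k) i : exists j m, val S (j, m) = i.
Proof.
have /and4P[_ /forallP/(_ i)/existsP[[j m] /eqP e] _ _] := valP S.
by exists j, m.
Qed.

(** No standard tableau has the weight to which the intertwiner would carry the
    vector of R_0. *)
Lemma Rect_column : HZ_column_vector N n_gt1 (vV Rsyt).
Proof.
have x_wt e : hZ e *: vV Rsyt = HZcst (q ^ (2 * diag0 N e)) *: vV Rsyt.
  rewrite hZ_winding -scalerA.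
  have [j [m jm]] := syt_surj Rsyt (idx e).
  rewrite -jm Rect_weight scalerA -rmorphM -expfzDr // (diag0_winding N_gt0 n_gt1) -jm.
  have -> : (residue_rep (val Rsyt (j, m)))%:Z = m%:Z * N%:Z + j%:Z + 1 by apply: R0_sytE.
  rewrite diag0E; [|by []|by have := ltn_ord j; lia].
  by congr (HZcst (q ^ _) *: _); lia.
split=> // i Ni; have [_ v_basis _ _] := V_Rect.
pose i' := (residue_rep (idx i))%:Z.
have ii' : (n %| i - i')%Z.
  by rewrite {1}[i](residue_rep_winding n_gt1) /i' addrAC subrr add0r dvdz_mulr ?dvdzz.
have Ni' : ~~ (N %| i')%Z.
  apply: contra Ni => Ni'; rewrite -[i](subrK i') rpredD //.
  by apply: dvdz_trans ii'; apply: dvdn_mull.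
have fi' : finite_index n i'.
  by apply: contra Ni' => ni'; apply: dvdz_trans ni'; apply: dvdn_mull.
have Dper : quasi_periodic n (diag0 N).
  by move=> e d; rewrite PoszM mulrAC diag0_addMr.
have DN := diag0_step N_gt0 Ni'.
have D_neq : diag0 N i' <> diag0 N (i' + 1) by move: DN N_gt0; lia.
rewrite (ah_T AHB ii') -(twining_column n_gt1 q_neq0 t_def q_inj DN) //.
apply: intertwine0; apply: contrapT => y0.
have y_wt := intertwine_weight n_gt1 q_neq0 q_inj AHB fi' Dper D_neq x_wt.
have [S e|S SD] := basis_weight (ah_cstC AHB) v_basis _ y0 y_wt.
  rewrite hZ_winding; have [j [m <-]] := syt_surj S (idx e).
  exists (q ^ (2 * n%:Z * winding n e) * q ^ (2 * (N%:Z * (m%:Z - j%:Z)))).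
  by rewrite -scalerA Rect_weight scalerA -rmorphM.
apply: (@syt_swap_adjacent N k N_gt0 k_gt0 n_gt1 S i') => // [|j m].
  exact: residue_rep_bounds.
apply: q_inj; apply: (cst_scale_inj (cst := HZcst) (basis_neq0 v_basis (i := S))).
by rewrite -Rect_weight SD.
Qed.
End Rect.

(** * Embedding Rect in L *)

Section Embedding.
Variables (L : lmodType H) (v : Pbar N k -> L).
Hypothesis L_Lbar : is_Lbar N_gt0 v.
Variables (V : lmodType B) (vV : syt N k -> V).
Hypothesis V_Rect : is_Rect vV.
Local Notation x := (vV (R0_syt N_gt0 k_gt0 n_gt1)).
Local Notation x0 := (v (ptab_class R0)).

(** The image in L of the annihilator of the generator of Rect: it vanishes if
    and only if Rect maps to L with x going to x0. *)
Definition obstruction (l : L) : Prop := exists2 h : B, h *: x = 0 & l = incl h *: x0.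

Lemma obstruction_add l l' : obstruction l -> obstruction l' -> obstruction (l + l').
Proof.
move=> [h hx ->] [h' hx' ->]; exists (h + h'); first by rewrite scalerDl hx hx' addr0.
by rewrite rmorphD scalerDl.
Qed.

Lemma obstruction_scale b l : obstruction l -> obstruction (incl b *: l).
Proof.
move=> [h hx ->]; exists (b * h); first by rewrite -scalerA hx scaler0.
by rewrite rmorphM scalerA.
Qed.

Lemma obstruction_cst c l : obstruction l -> obstruction (cst c *: l).
Proof. exact: (@obstruction_scale (HZcst c)). Qed.

Lemma obstruction_T i l : finite_index n i -> obstruction l -> obstruction (dT i *: l).
Proof. by move=> Ji; rewrite -(to_HZK (HZ_mem_T _ _ _ _ Ji)); apply: obstruction_scale. Qed.

Lemma obstruction_Z e l : obstruction l -> obstruction (dZ e *: l).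
Proof. by rewrite -(to_HZK (HZ_mem_Z _ _ _ _ e)); apply: obstruction_scale. Qed.

(** In Rect + L the key lemma makes (0, l) a multiple of (x, x0). *)
Lemma obstruction_diag0 l : obstruction l -> has_weight l (diag0 N) -> l = 0.
Proof.
move=> [h hx lE] lw; have [xw xs] := Rect_column V_Rect.
have [x0w x0s] := Lbar_column L_Lbar.
pose E : lmodType B := (V * restr incl L)%type.
have col : HZ_column_vector N n_gt1 ((x, x0) : E).
  split=> [e|i Ni]; congr (_, _); [exact: xw | | exact: xs | ]; rewrite !restr_scaleE.
    by rewrite to_HZK ?HZ_mem_Z //; apply: x0w.
  rewrite to_HZK; first exact: x0s.
  by apply: HZ_mem_T; apply: contra Ni => ni; apply: dvdz_trans ni; apply: dvdn_mull.
have hE : h *: ((x, x0) : E) = (0, l) by rewrite -hx lE.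
have [|d] := HZ_column_weight_space N_gt0 N_dvd_n q_neq0 t_neq0 q_inj col (h := h).
  rewrite hE => e; congr (_, _); first by rewrite !scaler0.
  by rewrite !restr_scaleE to_HZK ?HZ_mem_Z //; apply: lw.
rewrite hE => -[/esym dx ->].
have x_neq0 : x <> 0 by case: V_Rect => _ vb _ _; apply: (basis_neq0 vb).
have : d = 0 by apply: (cst_scale_inj (cst := HZcst) x_neq0); rewrite dx rmorph0 scale0r.
by move=> ->; rewrite rmorph0 scale0r.
Qed.

Definition unobstructed (w : L) : Prop := exists R : ptab N k,
  has_weight w (diag_fun R) /\ forall l, obstruction l -> has_weight l (diag_fun R) -> l = 0.

(** The span of the unobstructed weight vectors is stable under H(Z): an
    intertwiner between weights of L is invertible, so it cannot lead from an
    unobstructed weight to an obstructed one. *)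
Lemma unobstructed_stable (h : B) w :
  kspan cst unobstructed w -> kspan cst unobstructed (incl h *: w).
Proof.
pose U (w : restr incl L) := kspan cst unobstructed (w : L).
rewrite -/(U (h *: (w : restr incl L))) -/(U w).
apply: (HZ_stable N_gt0 N_dvd_n q_neq0 t_neq0) => {w} [w w'|c w|i w Ji|e w|e w].
- exact: kspanD.
- exact: kspanZ.
- rewrite /U restr_scaleE to_HZK ?HZ_mem_T //.
  apply: (kspan_map cstC) => {}w [R [wR R_un]].
  set D := diag_fun R.
  have Dper : quasi_periodic n D by move=> e d; apply: diag_fun_periodic.
  have D_neq : D i <> D (i + 1) by apply: diag_fun_neq.
  have -> : dT i *: w = intertwine D i w - cst (twining q t D i) *: w by rewrite addrK.
  apply: kspanB; last by apply/kspanZ/kspan_gen; exists R.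
  have [->|w'0] := pselect (intertwine D i w = 0); first exact: kspan0.
  have w'D := intertwine_weight n_gt1 q_neq0 q_inj AH isT Dper D_neq wR.
  have Lw := Lbar_tableau_weights L_Lbar.
  have Dper' := quasi_periodic_swap i Dper.
  have [R' R'E] := Lw _ _ w'0 Dper' w'D.
  have Dfar : `|D i - D (i + 1)| <> N%:Z.
    by move=> DN; apply: w'0; apply: (adjacent_intertwine Lw wR DN).
  have D'i : (D \o swap i) i = D (i + 1) by rewrite /= affine_swapL ?subrr.
  have D'i1 : (D \o swap i) (i + 1) = D i.
    by rewrite /= affine_swapR ?addrK // (_ : i + 1 - i - 1 = 0); [exact: dvdz0 | lia].
  have D'_neq : (D \o swap i) i <> (D \o swap i) (i + 1) by rewrite D'i D'i1; apply/nesym.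
  apply: kspan_gen; exists R'; split=> [e|l lA lR']; first by rewrite -R'E; apply: w'D.
  have lD' : has_weight l (D \o swap i) by move=> e; rewrite R'E; apply: lR'.
  have D'far : `|(D \o swap i) i - (D \o swap i) (i + 1)| <> N%:Z by rewrite D'i D'i1 distrC.
  have [c c0 lK] := intertwineK n_gt1 q_neq0 t_def q_inj AH l isT D'_neq D'far.
  have l'D : has_weight (intertwine (D \o swap i) i l) D.
    move=> e; rewrite (intertwine_weight n_gt1 q_neq0 q_inj AH isT Dper' D'_neq lD').
    by rewrite /= affine_swapK.
  have l'A : obstruction (intertwine (D \o swap i) i l).
    by apply: obstruction_add; [apply: obstruction_T | apply: obstruction_cst].
  apply: (cst_scaleI (cst := cst) c0); rewrite -lK (R_un _ l'A l'D).
  by rewrite /intertwine !scaler0 addr0.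
- rewrite /U restr_scaleE to_HZK ?HZ_mem_Z //.
  apply: (kspan_map cstC) => {}w [R [wR R_un]].
  by rewrite wR; apply/kspanZ/kspan_gen; exists R.
- rewrite /U restr_scaleE to_HZK ?HZ_mem_Y //.
  apply: (kspan_map cstC) => {}w [R [wR R_un]].
  have -> : dY e *: w = cst (q ^ (2 * diag_fun R e))^-1 *: w.
    rewrite -[w in RHS]scale1r -(ah_YZ AH e) -(scalerA (dY e)) wR (cst_scaleC cstC).
    by rewrite [cst _ *: (cst _ *: _)]scalerA -rmorphM mulVf ?rmorph1 ?scale1r // expfz_neq0.
  by apply/kspanZ/kspan_gen; exists R.
Qed.

(** The obstruction lies in the span of the unobstructed vectors, as x0 is one of
    them. Write l as a sum of unobstructed vectors and let w be the first one.
    With z the eigenvalue of w, (Z_e - z) l is in the obstruction and has fewer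
    terms, so it vanishes by induction: l has the weight of w, which is
    unobstructed. *)
Lemma obstruction0 l : obstruction l -> l = 0.
Proof.
move=> lA; have : kspan cst unobstructed l.
  case: (lA) => h _ ->; apply: unobstructed_stable; apply: kspan_gen; exists R0.
  split=> [|l' l'A l'w]; first exact: Lbar_weight.
  by apply: obstruction_diag0 l'A _ => e; rewrite -(diag_fun_R0 N_gt0 n_gt1 (k := k)).
have un_scale c u : unobstructed u -> unobstructed (cst c *: u).
  move=> [R [uR R_un]]; exists R; split=> //.
  exact: (has_weight_scale AH).
move=> /(kspan_seq un_scale)[s]; have [m] := ubnP (size s).
elim: m s l lA => // m IHm [|w s] l lA sm s_un lE; first by rewrite lE big_nil.
have [R [wR R_un]] := s_un w (mem_head _ _); apply: R_un => // e.
apply/eqP; rewrite -subr_eq0; apply/eqP.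
have s_wt u : exists c, u \in s -> dZ e *: u = cst c *: u.
  have [us|] := boolP (u \in s); last by exists 0.
  have [R' [uR' _]] := s_un u (mem_behead (s := w :: s) us).
  by exists (q ^ (2 * diag_fun R' e)).
have [c cE] := choice s_wt; set z := q ^ (2 * _).
have lZ : dZ e *: l - cst z *: l = \sum_(u <- s) cst (c u - z) *: u.
  rewrite lE big_cons !scalerDr opprD addrACA wR subrr add0r !scaler_sumr -sumrB.
  rewrite big_seq [RHS]big_seq; apply: eq_bigr => u us.
  by rewrite cE // rmorphB scalerBl.
have lA' : obstruction (dZ e *: l - cst z *: l).
  rewrite -scaleNr -rmorphN; apply: obstruction_add; first exact: obstruction_Z.
  exact: obstruction_cst.
apply: (IHm [seq cst (c u - z) *: u | u <- s]) => //; first by rewrite size_map.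
  by move=> _ /mapP[u us ->]; apply/un_scale/s_un/(mem_behead (s := w :: s)).
by rewrite lZ big_map.
Qed.
End Embedding.

(** * The induced module and its quotients *)

Section Quotient.
Variables (L : lmodType H) (v : Pbar N k -> L).
Hypothesis L_Lbar : is_Lbar N_gt0 v.
Variables (V : lmodType B) (vV : syt N k -> V).
Hypothesis V_Rect : is_Rect vV.
Local Notation x := (vV (R0_syt N_gt0 k_gt0 n_gt1)).
Local Notation x0 := (v (ptab_class R0)).

Local Notation P := (pi ^+ N).
Variable a : nroot K n.
Hypothesis a_prim : n.-primitive_root (nroot_val a).
Local Notation z := (nroot_val a ^+ N).
Local Notation Lj j := (pitwist (nroot_exp a j) L).
Local Notation x0_ j := (to_pitwist (nroot_exp a j) x0).
Local Notation proj := (eigen_proj cst k z P).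

Lemma z_prim : k.-primitive_root z.
Proof.
have := dvdn_prim_root a_prim (dvdn_mulr N (dvdnn k)).
by rewrite mulKn.
Qed.

Lemma P_order : P ^+ k = 1.
Proof. by rewrite -exprM mulnC daha_pin. Qed.

Lemma column_kspan (M : lmodType H) (u w : M) : column_vector u ->
  kspan cst (fun y => exists s, y = P ^+ s *: u) w -> column_vector w.
Proof.
move=> uc; elim=> [{}w [s ->]||w1 w2 _ [h1 s1] _ [h2 s2]|c w1 _ [h1 s1]].
- rewrite -exprM; split=> [e|i Ni].
    have := pi_pow_weight N_gt0 N_dvd_n q_neq0 t_neq0 uc (N * s)%N (e - (N * s)%N%:Z).
    rewrite subrK => ->; congr (cst (q ^ (2 * _)) *: _).
    by rewrite [in RHS](_ : e = e - (N * s)%N%:Z + s%:Z * N%:Z) ?diag0_addMr //; lia.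
  apply: (pi_pow_sign uc); apply: contra Ni => Ni.
  by rewrite -[i](subrK (N * s)%N%:Z) rpredD // PoszM dvdz_mulr ?dvdzz.
- by split=> *; rewrite !scaler0.
- by split=> *; rewrite !scalerDr ?h1 ?h2 ?s1 ?s2.
- by split=> *; rewrite -(cst_scaleC cstC c) ?h1 ?s1 // (cst_scaleC cstC).
Qed.

Lemma proj_column (M : lmodType H) (u : M) j : column_vector u -> column_vector (proj j *: u).
Proof.
move=> uc; apply: (column_kspan uc).
rewrite /eigen_proj -scalerA scaler_suml; apply: kspanZ.
apply: (big_ind (kspan cst _)); [exact: kspan0 | exact: kspanD | move=> s _].
by rewrite -scalerA; apply/kspanZ/kspan_gen; exists s.
Qed.

Lemma proj_pi (M : lmodType H) (u : M) j : P *: (proj j *: u) = cst (z ^+ j) *: (proj j *: u).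
Proof. by rewrite scalerA (eigen_projE z_prim cstC P_order) -scalerA. Qed.

Lemma x0_neq0 : x0 <> 0.
Proof. exact: Lbar_cyclic_neq0 L_Lbar _. Qed.

Lemma x0_column b : column_vector (to_pitwist b x0).
Proof. exact/pitwist_column/(Lbar_column L_Lbar). Qed.

Lemma x0_pi (b : nroot K n) : P *: to_pitwist b x0 = cst (nroot_val b ^+ N) *: to_pitwist b x0.
Proof.
have := @pitwist_pi b L x0 1; rewrite mulr1; apply.
by rewrite rmorph1 scale1r; case: L_Lbar.
Qed.

Lemma L_irreducible : irreducible L.
Proof. by case: L_Lbar. Qed.

Lemma irreducible_simple (M : lmodType H) : irreducible M -> simple_submodule (fun _ : M => True).
Proof.
move=> [[w w0] irrM]; split; first by split.
- by exists w.
- by move=> W /irrM[W0|Wall] _; [left | right].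
Qed.

(** By column_glue, x1 |-> y1 extends to a homomorphism; Schur's lemma applies. *)
Lemma column_iso (M Q : lmodType H) (x1 : M) (y1 : Q) c : irreducible M -> irreducible Q ->
  x1 <> 0 -> y1 <> 0 -> column_vector x1 -> column_vector y1 ->
  P *: x1 = cst c *: x1 -> P *: y1 = cst c *: y1 -> mod_iso M Q.
Proof.
move=> Mirr Qirr x1_0 y1_0 x1c y1c x1P y1P.
have ann := column_glue x1_0 x1c y1c x1P y1P (irreducible_simple Qirr) I.
have [f fx] := cyclic_extend (irreducible_cyclic Mirr x1_0) ann.
by exists f; apply: (irreducible_bij (x := x1)) => //; rewrite fx.
Qed.

(** An isomorphism sends x0 to a vector of weight diag0, that is to a multiple of
    x0, so that the eigenvalue of pi^N is an invariant; by column_iso it is the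
    only one. *)
Lemma twist_iso (b c : nroot K n) :
  mod_iso (pitwist b L) (pitwist c L) <-> nroot_val b ^+ N = nroot_val c ^+ N.
Proof.
have irr b' := @pitwist_irreducible b' L L_irreducible.
split=> [[f f_bij]|bc]; last first.
  apply: (@column_iso _ _ (to_pitwist b x0) (to_pitwist c x0) (nroot_val b ^+ N)) => //;
    try exact: x0_neq0; try exact: x0_column; first exact: x0_pi.
  by rewrite bc; apply: x0_pi.
have fx0 : f (to_pitwist b x0) <> 0.
  by rewrite -(linear0 f) => /(bij_inj f_bij); apply: x0_neq0.
have [h fE] := @irreducible_cyclic _ _ (to_pitwist c x0) (irr c) x0_neq0 (f (to_pitwist b x0)).
have f_wt e : dZ e *: f (to_pitwist b x0) = cst (q ^ (2 * diag0 N e)) *: f (to_pitwist b x0).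
  by rewrite -!linearZ_LR (x0_column b).1.
have [d dE] : exists d, f (to_pitwist b x0) = cst d *: to_pitwist c x0.
  rewrite fE in f_wt *; apply: (column_weight_space N_gt0 N_dvd_n q_neq0 t_neq0 q_inj
    (x0_column c) (x0_pi c) f_wt).
apply: (cst_scale_inj (cst := cst) fx0).
rewrite -linearZ_LR -(x0_pi b) linearZ_LR dE.
by rewrite -(cst_scaleC cstC) x0_pi scalerA (cst_scaleC cstC) scalerA -!rmorphM.
Qed.

(** M has the weights of L only, and a vector u of weight diag0, which is
    therefore a column vector; some projection of u to an eigenspace of pi^N is
    not zero. *)
Lemma same_support_twist (M : lmodType H) : irreducible M ->
  (forall y, weight_support M y <-> weight_support L y) ->
  exists j : 'I_k, mod_iso M (Lj j).
Proof.
move=> Mirr MS.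
have wt_supp (E : lmodType H) (w : E) D : w <> 0 -> has_weight w D ->
    weight_support E (fun i => q ^ (2 * D (residue_rep i)%:Z)).
  move=> w0 wD; split=> [i|]; first exact: expfz_neq0.
  exists w => // i; rewrite -wD /dZ idx_residue_rep winding0 ?residue_rep_bounds //.
  by rewrite mulr0 expr0z rmorph1 mul1r.
have supp_wt (E : lmodType H) (w : E) D : quasi_periodic n D ->
    (forall i, daha_Z q t r i *: w = cst (q ^ (2 * D (residue_rep i)%:Z)) *: w) ->
    has_weight w D.
  move=> Dper wD e; rewrite {2}[e](residue_rep_winding n_gt1) Dper /dZ -scalerA wD scalerA.
  by rewrite -rmorphM -expfzDr //; congr (cst (q ^ _) *: _); lia.
have Mw : tableau_weights M.
  move=> w D w0 Dper wD; have /MS[_ [w' w'0 w'D]] := wt_supp _ _ _ w0 wD.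
  apply: (Lbar_tableau_weights L_Lbar w'0 Dper).
  exact: supp_wt.
have D0per : quasi_periodic n (diag0 N) by move=> e d; rewrite PoszM mulrAC diag0_addMr.
have [x0w _] := x0_column (nroot_exp a 0).
have /MS[_ [u u0 uD]] : weight_support L (fun i => q ^ (2 * diag0 N (residue_rep i)%:Z)).
  apply: (wt_supp _ x0) => // [|e]; first exact: x0_neq0.
  by case: (Lbar_column L_Lbar).
have u_col : column_vector u.
  exact/(supported_column_vector Mw)/supp_wt.
have [j uj] : exists j : 'I_k, proj j *: u <> 0.
  apply: contrapT => no; apply: u0.
  rewrite -[u]scale1r -(eigen_proj_sum cst P z_prim) scaler_suml big1 // => j _.
  by apply: contrapT => uj; apply: no; exists j.
exists j; apply: (@column_iso _ _ (proj j *: u) (x0_ j) (z ^+ j)) => //.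
- exact: pitwist_irreducible L_irreducible.
- exact: x0_neq0.
- exact: proj_column.
- exact: x0_column.
- exact: proj_pi.
- by rewrite x0_pi /= exprAC.
Qed.

Local Notation S := (dsum (fun j : 'I_k => Lj j)).

(** The diagonal map from Rect to the twists, on which H(Z) acts in the same way,
    extends to the induced module; the projectors of pi^N separate the twists,
    which makes the extension onto. For another semisimple quotient, the projected
    images of the generator receive maps from the twists. *)
Lemma induced_max_semisimple : max_semisimple_quotient (Ind V) S.
Proof.
have [Virr vb _ _] := V_Rect.
have Vx := irreducible_cyclic Virr (basis_neq0 vb (i := R0_syt N_gt0 k_gt0 n_gt1)).
have [f fx] : exists f : {linear V -> restr incl L}, f x = x0.
  apply: cyclic_extend Vx _ => h hx.
  by apply: (obstruction0 L_Lbar V_Rect); exists h.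
pose F (w : V) : S := fun j => to_pitwist (nroot_exp a j) (f w).
have [w w'|h w|p pE] := @induced_extend _ _ incl V S F.
- by apply: dsum_ext => j; rewrite /F linearD.
- apply: dsum_ext => j; rewrite /F linearZ_LR.
  by rewrite -[RHS]/(@pi_twist K n q t r (nroot_exp a j) (incl h) *: (f w : L)) pi_twist_HZ.
have irr (j : 'I_k) : irreducible (Lj j) by apply: pitwist_irreducible L_irreducible.
have x0_pij (j : 'I_k) : P *: x0_ j = cst (z ^+ j) *: x0_ j.
  by rewrite x0_pi /= exprAC.
have pgen (j : 'I_k) : p (tensor incl 1 x) j = x0_ j by rewrite pE scale1r /F fx.
exists p; split; [|exact: dsum_semisimple|].
  move=> y; have [h hE] := choice (fun j : 'I_k => irreducible_cyclic (irr j) x0_neq0 (y j)).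
  (* Only the j-th coordinate of the generator is an eigenvector for z ^+ j. *)
  exists (\sum_(j < k) (h j * proj j) *: tensor incl 1 x).
  rewrite linear_sum; apply: dsum_ext => i; rewrite dsum_sumE.
  under eq_bigr => j _.
    rewrite linearZ_LR -[(_ *: _ : S) i]/((h j * proj j) *: (p (tensor incl 1 x) i)) pgen.
    rewrite -scalerA (eigen_proj_eigen z_prim cstC (ltn_ord i) (ltn_ord j) (x0_pij i)).
    over.
  rewrite (bigD1 i) //= eqxx -hE big1 ?addr0 // => j ji.
  by rewrite eq_sym (negPf ji : (j == i :> nat) = false) scaler0.
move=> Q p' _ Qss; set y := p' (tensor incl 1 x).
have [xw xs] := Rect_column V_Rect.
have tensor_cst c : tensor incl 1 (HZcst c *: x) = cst c *: tensor incl 1 x.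
  by rewrite -tensor_bal mul1r tensorZ mulr1.
have y_col : column_vector y.
  split=> [e|i Ni].
    rewrite -!linearZ_LR -tensor_cst -xw tensorZ mulr1 -tensor_bal mul1r.
    by rewrite to_HZK ?HZ_mem_Z.
  rewrite -!linearZ_LR -tensor_cst -(xs i Ni) tensorZ mulr1 -tensor_bal mul1r.
  rewrite to_HZK //; apply: HZ_mem_T.
  by apply: contra Ni => ni; apply: dvdz_trans ni; apply: dvdn_mull.
have [s [yE sU s_ann]] := semisimple_independent y Qss.
have s_col u : u \in s -> column_vector u.
  move=> us; split=> [e|i Ni]; apply/eqP; rewrite -subr_eq0 -scalerBl; apply/eqP/s_ann => //.
    by rewrite scalerBl y_col.1 subrr.
  by rewrite scalerBl y_col.2 // subrr.
have ann (j : 'I_k) h : h *: x0_ j = 0 -> h *: (proj j *: y) = 0.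
  move=> hx; rewrite yE !scaler_sumr big_seq big1 // => u us.
  have [U U_simple Uu] := sU u us.
  apply: (column_glue (S := Lj j) (x := x0_ j) x0_neq0 (x0_column _) (proj_column j (s_col u us))
    (x0_pij j) (proj_pi u j) U_simple _ hx).
  by case: (U_simple) => Um _ _; apply: submoduleZ.
pose g (j : 'I_k) := cid (cyclic_extend (irreducible_cyclic (irr j) x0_neq0) (@ann j)).
have [G GE] := dsum_out (fun j => sval (g j)).
exists G => u; have [h ->] := induced_gen Vx u.
rewrite /= !linearZ_LR GE; congr (_ *: _).
under eq_bigr => j _ do rewrite pgen (svalP (g j)).
by rewrite -scaler_suml (eigen_proj_sum cst P z_prim) scale1r.
Qed.
End Quotient.
End Main.

(** * The top of the induced module and the twists of L *)

Theorem theorem6p12 (K : fieldType) (N k : nat) (q t r : K)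
  (charK : [pchar K] =i pred0)
  (N_gt0 : (0 < N)%N) (k_gt0 : (0 < k)%N) (n_ge2 : (2 <= k * N)%N)
  (q_neq0 : q != 0)
  (q_nonroot : forall m : nat, (0 < m)%N -> q ^+ m != 1)
  (t_nonroot : forall m : nat, (0 < m)%N -> t ^+ m != 1)
  (t_def : t = q ^+ N) (r_def : r = q ^ (1 - N%:Z ^+ 2))
  (a : nroot K (k * N)) (a_prim : (k * N).-primitive_root (nroot_val a))
  (V : lmodType (HZ (k * N) q t r)) (vV : syt N k -> V) (V_Rect : is_Rect vV)
  (L : lmodType (daha (k * N) q t r)) (v : Pbar N k -> L) (L_Lbar : is_Lbar N_gt0 v) :
  [/\ max_semisimple_quotient (Ind V)
        (dsum (fun j : 'I_k => pitwist (nroot_exp a j) L)),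
      (forall b c : nroot K (k * N),
         mod_iso (pitwist b L) (pitwist c L) <->
         nroot_val b ^+ N = nroot_val c ^+ N),
      (forall j : 'I_k, irreducible (pitwist (nroot_exp a j) L) /\
         forall z, weight_support (pitwist (nroot_exp a j) L) z <-> weight_support L z) /\
      (forall M : lmodType (daha (k * N) q t r), irreducible M ->
         (forall z, weight_support M z <-> weight_support L z) ->
         exists j : 'I_k, mod_iso M (pitwist (nroot_exp a j) L))
    & let v0 := v (ptab_class (R0 k N_gt0)) in
      let piN := daha_pi (k * N) q t r ^+ N in
      let cst := daha_cst (k * N) q t r in
      (forall b : nroot K (k * N),
         piN *: to_pitwist b v0 = cst (nroot_val b ^+ N) *: to_pitwist b v0) /\
      (forall (b b' : nroot K (k * N)) (c c' : K),
         piN *: to_pitwist b v0 = cst c *: to_pitwist b v0 ->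
         piN *: to_pitwist b' v0 = cst c' *: to_pitwist b' v0 ->
         (mod_iso (pitwist b L) (pitwist b' L) <-> c = c'))].
Proof.
have q_inj (b c : int) : q ^ (2 * b) = q ^ (2 * c) -> b = c.
  move=> bc; have : q ^ (2 * (b - c)) = 1.
    by rewrite mulrBr expfzDr // bc -expfzDr // subrr.
  case mE: (2 * (b - c)) => [[|m]|m]; first by lia.
    by move=> /eqP; rewrite -exprnP (negPf (q_nonroot _ _)).
  by move=> /eqP; rewrite NegzE -exprnN invr_eq1 (negPf (q_nonroot _ _)).
have n_gt1 := n_ge2.
have irr b := @pitwist_irreducible K N k q t r b L (L_irreducible L_Lbar).
have piv0 := x0_pi L_Lbar.
have v0_neq0 := x0_neq0 L_Lbar.
split.
- exact: (induced_max_semisimple n_gt1 k_gt0 q_neq0 q_inj t_def L_Lbar V_Rect a_prim).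
- exact: (twist_iso n_gt1 k_gt0 q_neq0 q_inj t_def L_Lbar).
- split=> [j|M]; first by split=> [|z]; [apply: irr | apply: pitwist_support].
  exact: (same_support_twist n_gt1 k_gt0 q_neq0 q_inj t_def L_Lbar a_prim).
split=> [b|b b' c c']; first exact: piv0.
have eigen_inj d := @cst_scale_inj K _ (daha_cst (k * N) q t r) (pitwist d L)
  (to_pitwist d (v (ptab_class (R0 k N_gt0)))) _ _ v0_neq0.
rewrite !piv0 => /eigen_inj <- /eigen_inj <-.
exact: (twist_iso n_gt1 k_gt0 q_neq0 q_inj t_def L_Lbar).
Qed.
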